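(* Let $x\in\mathbb R$ with $0<x\le1$ and let $N\ge2$ be an integer. Set \[ L_N(x):=\sum_{\ell=0}^{N-1}(-1)^{\ell}\log\Gamma_{N-\ell}(x)\prod_{i=1}^{N-\ell-1}i\sum_{1\le a_1\le\cdots\le a_\ell\le N-\ell}(a_1-x)\cdots(a_\ell-x), \] (inner sum over integers $a_1,\ldots,a_\ell$, equal to $1$ when $\ell=0$; empty product equal to $1$), and $H_{N-1}:=1+\frac12+\cdots+\frac1{N-1}$. If $N$ is even, then \[ L_N(x)=\frac{2(-1)^{N/2}(N-1)!}{(2\pi)^N}\left\{\sum_{n=1}^\infty\frac{(\log n)\cos(2\pi nx)}{n^N}+\big(\log(2\pi)+\gamma-H_{N-1}\big)\sum_{n=1}^\infty\frac{\cos(2\pi nx)}{n^N}-\frac{\pi}{2}\sum_{n=1}^\infty\frac{\sin(2\pi nx)}{n^N}\right\}. \] If $N$ is odd, then \[ L_N(x)=\frac{2(-1)^{(N-1)/2}(N-1)!}{(2\pi)^N}\left\{\sum_{n=1}^\infty\frac{(\log n)\sin(2\pi nx)}{n^N}+\big(\log(2\pi)+\gamma-H_{N-1}\big)\sum_{n=1}^\infty\frac{\sin(2\pi nx)}{n^N}+\frac{\pi}{2}\sum_{n=1}^\infty\frac{\cos(2\pi nx)}{n^N}\right\}. \]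
   Context: For $M\ge1$, the multiple Hurwitz zeta function is $\zeta_M(s,x):=\sum_{n_1,\ldots,n_M\ge0}(x+n_1+\cdots+n_M)^{-s}$ ($\mathrm{Re}(s)>M$), meromorphically continued in $s$, and the multiple gamma function is $\Gamma_M(x):=\exp\big(\zeta_M'(0,x)\big)$, the prime denoting $\partial/\partial s$; thus $\log\Gamma_M(x):=\zeta_M'(0,x)$. $\gamma$ is Euler's constant. *)

(* Defs.v *)
From Stdlib Require Export Reals ClassicalEpsilon.
From mathcomp Require Export all_boot.
From Coquelicot Require Export Coquelicot.
Set Implicit Arguments.
Unset Strict Implicit.
Unset Printing Implicit Defensive.
Open Scope R_scope.

(* Unordered summation over the index type T, i.e. the limit of the finite
   partial sums along the finite subsets of T (given as duplicate-free
   sequences) directed by inclusion. *)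
Definition is_unordered_sum (T : eqType) (f : T -> C) (l : C) : Prop :=
  forall eps : posreal, exists s0 : seq T, forall s : seq T,
    uniq s -> {subset s0 <= s} ->
    Cmod (Cminus (\big[Cplus/RtoC 0]_(t <- s) f t) l) < eps.

Definition Cexp (z : C) : C := (exp (Re z) * cos (Im z), exp (Re z) * sin (Im z)).

(* a ^ s for a real base a > 0 (principal value). *)
Definition Cpower (a : R) (s : C) : C := Cexp (Cmult s (RtoC (ln a))).

Definition analytic_at (f : C -> C) (a : C) : Prop :=
  exists (c : nat -> C) (r : R), 0 < r /\
    forall s : C, Cmod (Cminus s a) < r ->
      @is_pseries C_AbsRing C_NormedModule c (Cminus s a) (f s).

(* f has a pole of order m > 0 at a: on a punctured disc around a it is the sum
   of a Laurent series starting with the term of degree -m. The value f a is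
   not constrained. *)
Definition pole_at (f : C -> C) (a : C) : Prop :=
  exists (m : nat) (c : nat -> C) (r : R), (0 < m)%N /\ 0 < r /\ c 0%N <> RtoC 0 /\
    forall s : C, 0 < Cmod (Cminus s a) < r ->
      @is_pseries C_AbsRing C_NormedModule c (Cminus s a)
        (Cmult (Cpow (Cminus s a) m) (f s)).

(* Removable singularities with a wrong value are excluded, so that a
   meromorphic function is meaningful at every point that is not a pole. *)
Definition meromorphic (f : C -> C) : Prop :=
  forall a : C, analytic_at f a \/ pole_at f a.

Definition is_hurwitz_zeta (M : nat) (x : R) (Z : C -> C) : Prop :=
  meromorphic Z /\
  forall s : C, INR M < Re s ->
    is_unordered_sum
      (fun n : M.-tuple nat => Cpower (x + INR (sumn n)) (Copp s)) (Z s).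

(* For M >= 1 and x > 0 the function specified here exists and is unique
   except for its irrelevant values at its poles (which lie in {1, ..., M}). *)
Definition hurwitz_zeta (M : nat) (x : R) : C -> C :=
  epsilon (inhabits (fun _ : C => RtoC 0)) (is_hurwitz_zeta M x).

Definition log_multiple_gamma (M : nat) (x : R) : C :=
  C_derive (hurwitz_zeta M x) (RtoC 0).

Definition harmonic (n : nat) : R := \big[Rplus/0]_(1 <= k < n.+1) (/ INR k).

Definition euler_gamma : R :=
  real (Lim_seq (fun n : nat => harmonic n - ln (INR n))).

(* The integers 1 <= a_1 <= ... <= a_l <= m are a_j = i_j + 1 with i_j : 'I_m. *)
Definition shifted_sum (l m : nat) (x : R) : R :=
  \big[Rplus/0]_(a : l.-tuple 'I_m | path.sorted leq [seq val i | i <- a])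
    \big[Rmult/1]_(i <- a) (INR i.+1 - x).

Definition L_sum (N : nat) (x : R) : C :=
  \big[Cplus/RtoC 0]_(0 <= l < N)
    Cmult (Cmult (Cmult (RtoC ((-1) ^ l)) (log_multiple_gamma (N - l) x))
                 (RtoC (\big[Rmult/1]_(1 <= i < N - l) INR i)))
          (RtoC (shifted_sum l (N - l) x)).

(* Main.v *)
(* Newton interpolation of zeta_M by shifts of zeta = zeta_1 collapses L_N(x) to
   zeta'(1 - N, x). Euler-Maclaurin summation continues (1 - s) zeta(s, x) to an entire
   function and writes zeta'(1 - N, x), with psi'(t) = - t^(N-1) ln t, as the limit of
     psi'(x) + ... + psi'(M - 1 + x) - sum of B_k(x) / k! psi^(k)(M) over k <= N,
   uniformly in x. The limit is identified by its Fourier coefficients: N - 2 integrations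
   by parts, in which the periodic boundary terms cancel, leave the integrals over [0, M]
   of t ln t against cos(wt) and sin(wt), w = 2 pi m. These reduce to those of
   (1 - cos(wt)) / t and sin(wt) / t, which are ln M + ln w + gamma + o(1) and
   pi/2 + o(1) by Dirichlet's kernels and the Riemann-Lebesgue lemma. *)
From HB Require Import structures.
Require Import Defs.
From Stdlib Require Import Lra Psatz.
From mathcomp Require Import zify.
Set Implicit Arguments.
Unset Strict Implicit.
Unset Printing Implicit Defensive.
Open Scope R_scope.

(* The series of the theorem are indexed from 0. *)
Local Notation freq m := (2 * PI * INR m.+1) (only parsing).

(** Neither contour integrals nor a functional equation occur. [hurwitz_zeta] is only some
    meromorphic function with prescribed values to the right of [M], so an explicit continuation is
    built and then matched with the chosen one by comparing Laurent expansions. Analytic means given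
    by a convergent power series; the Euler-Maclaurin limit is therefore taken on the Taylor
    coefficients in s, by an exchange of double sums, and the derivative at [1 - N] is read off as a
    coefficient. The factor [1 - s] is carried along because the primitive [t ^ (1 - s)] of
    [(1 - s) t ^ (- s)] is entire in s; dividing it out replaces [t ^ (1 - s)] by [psi], the
    s-derivative of [t ^ (1 - s) / (1 - s)] at [1 - N]. Since the limit is not known in advance to
    have a Fourier expansion, the partial Fourier sum is subtracted before the limit is taken: the
    difference converges uniformly, its coefficients tend to 0, hence its limit vanishes. The
    integrations by parts stop at [t ln t], the last derivative of [psi] that is continuous at 0. *)

Lemma Cmod_le_abs (z : C) : Cmod z <= Rabs (Re z) + Rabs (Im z).
Proof.
case: z => a b; rewrite /Cmod /=.
have h := Rabs_pos a; have h' := Rabs_pos b.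
rewrite -[X in _ <= X]sqrt_Rsqr; last lra.
apply: sqrt_le_1_alt; rewrite /Rsqr.
have -> : a * (a * 1) = Rabs a * Rabs a by rewrite -Rabs_mult Rabs_pos_eq; [ring|nra].
have -> : b * (b * 1) = Rabs b * Rabs b by rewrite -Rabs_mult Rabs_pos_eq; [ring|nra].
nra.
Qed.

Lemma Im_le_Cmod (z : C) : Rabs (Im z) <= Cmod z.
Proof. by apply: Rle_trans (Rmax_Cmod z); apply: Rmax_r. Qed.

Lemma Cmod_sub_sym (a b : C) : Cmod (a - b) = Cmod (b - a).
Proof. by rewrite -Cmod_opp; congr Cmod; ring. Qed.

Lemma Cmod_tri3 (a b c : C) : Cmod (a - c) <= Cmod (a - b) + Cmod (b - c).
Proof.
have -> : (a - c = (a - b) + (b - c))%C by ring.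
exact: Cmod_triangle.
Qed.

(** * Finite sums and limits of real sequences *)

Fixpoint rsum (f : nat -> R) (n : nat) : R :=
  if n is m.+1 then rsum f m + f m else 0.
Fixpoint csum (f : nat -> C) (n : nat) : C :=
  if n is m.+1 then (csum f m + f m)%C else RtoC 0.

Lemma rsum_ext (f g : nat -> R) n :
  (forall k, (k < n)%N -> f k = g k) -> rsum f n = rsum g n.
Proof.
elim: n => //= n IH h; rewrite IH ?h // => k hk; apply: h; exact: ltnW.
Qed.

Lemma csum_ext (f g : nat -> C) n :
  (forall k, (k < n)%N -> f k = g k) -> csum f n = csum g n.
Proof.
elim: n => //= n IH h; rewrite IH ?h // => k hk; apply: h; exact: ltnW.
Qed.

Lemma rsum_plus f g n : rsum (fun k => f k + g k) n = rsum f n + rsum g n.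
Proof. by elim: n => /= [|n ->]; ring. Qed.
Lemma rsum_minus f g n : rsum (fun k => f k - g k) n = rsum f n - rsum g n.
Proof. by elim: n => /= [|n ->]; ring. Qed.
Lemma rsum_scal a f n : rsum (fun k => a * f k) n = a * rsum f n.
Proof. by elim: n => /= [|n ->]; ring. Qed.
Lemma csum_plus f g n : csum (fun k => f k + g k)%C n = (csum f n + csum g n)%C.
Proof. by elim: n => /= [|n ->]; ring. Qed.
Lemma csum_minus f g n : csum (fun k => f k - g k)%C n = (csum f n - csum g n)%C.
Proof. by elim: n => /= [|n ->]; ring. Qed.
Lemma csum_scal a f n : csum (fun k => a * f k)%C n = (a * csum f n)%C.
Proof. by elim: n => /= [|n ->]; ring. Qed.
Lemma Re_csum f n : Re (csum f n) = rsum (fun k => Re (f k)) n.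
Proof. by elim: n => //= n <-. Qed.
Lemma Im_csum f n : Im (csum f n) = rsum (fun k => Im (f k)) n.
Proof. by elim: n => //= n <-. Qed.
Lemma csum_RtoC f n : csum (fun k => RtoC (f k)) n = RtoC (rsum f n).
Proof. by elim: n => //= n ->; rewrite RtoC_plus. Qed.
Lemma rsum_le f g n : (forall k, (k < n)%N -> f k <= g k) -> rsum f n <= rsum g n.
Proof.
elim: n => /= [|n IH] h; first lra.
apply: Rplus_le_compat; last exact: h.
by apply: IH => k hk; apply: h; exact: ltnW.
Qed.
Lemma rsum_ge0 f n : (forall k, (k < n)%N -> 0 <= f k) -> 0 <= rsum f n.
Proof.
elim: n => /= [|n IH] h; first lra.
apply: Rplus_le_le_0_compat; last exact: h.
by apply: IH => k hk; apply: h; exact: ltnW.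
Qed.
Lemma Cmod_csum f n : Cmod (csum f n) <= rsum (fun k => Cmod (f k)) n.
Proof.
elim: n => /= [|n IH]; first by rewrite Cmod_0; lra.
apply: Rle_trans (Cmod_triangle _ _) _; lra.
Qed.
Lemma Rabs_rsum f n : Rabs (rsum f n) <= rsum (fun k => Rabs (f k)) n.
Proof.
elim: n => /= [|n IH]; first by rewrite Rabs_R0; lra.
apply: Rle_trans (Rabs_triang _ _) _; lra.
Qed.
Lemma csum_recl f n : csum f n.+1 = (f 0%N + csum (fun k => f k.+1) n)%C.
Proof. by elim: n => [|n IH] /=; [ring|rewrite -/(csum f n.+1) IH; ring]. Qed.
Lemma rsum_recl f n : rsum f n.+1 = f 0%N + rsum (fun k => f k.+1) n.
Proof. by elim: n => [|n IH] /=; [ring|rewrite -/(rsum f n.+1) IH; ring]. Qed.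
Lemma csum_exch (f : nat -> nat -> C) n m :
  csum (fun k => csum (f k) m) n = csum (fun l => csum (fun k => f k l) n) m.
Proof.
elim: n => /= [|n ->]; last by rewrite -csum_plus.
by elim: m => //= m <-; ring.
Qed.
Lemma rsum_sum_n f n : rsum f n.+1 = sum_n f n.
Proof.
elim: n => [|n IH]; first by rewrite sum_O /=; ring.
by rewrite sum_Sn -IH.
Qed.
Lemma csum_sum_n (f : nat -> C) n : csum f n.+1 = @sum_n C_AbelianMonoid f n.
Proof.
elim: n => [|n IH]; first by rewrite sum_O /=; ring.
by rewrite sum_Sn -IH.
Qed.
Lemma rsum_shift f n m : rsum f (n + m) = rsum f n + rsum (fun k => f (n + k)%N) m.
Proof.
elim: m => [|m IH] /=; first by rewrite addn0; ring.
by rewrite addnS /= IH; ring.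
Qed.
Lemma csum_shift f n m :
  csum f (n + m) = (csum f n + csum (fun k => f (n + k)%N) m)%C.
Proof.
elim: m => [|m IH] /=; first by rewrite addn0; ring.
by rewrite addnS /= IH; ring.
Qed.

Lemma lim_rsum f l : is_series f l <-> is_lim_seq (rsum f) l.
Proof.
split=> h.
  apply/is_lim_seq_incr_1.
  apply: (is_lim_seq_ext (sum_n f)) => [n|]; first by rewrite rsum_sum_n.
  exact: h.
suff : is_lim_seq (sum_n f) l by [].
apply: (is_lim_seq_ext (fun n => rsum f n.+1)) => [n|]; first exact: rsum_sum_n.
by apply/(is_lim_seq_incr_1 (rsum f)).
Qed.

Lemma lim_seq_eps (u : nat -> R) (l : R) :
  is_lim_seq u l <->
  forall eps, 0 < eps -> exists N, forall n, (N <= n)%N -> Rabs (u n - l) < eps.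
Proof.
split=> h.
  move=> e he; have /is_lim_seq_spec/(_ (mkposreal e he)) [N hN] := h.
  by exists N => n hn; apply: hN; apply/leP.
apply/is_lim_seq_spec => e; have [N hN] := h _ (cond_pos e).
by exists N => n /leP; apply: hN.
Qed.

Lemma lim0_le (u v : nat -> R) :
  (forall n, 0 <= u n <= v n) -> is_lim_seq v 0 -> is_lim_seq u 0.
Proof.
move=> h hv; apply: (is_lim_seq_le_le (fun _ => 0) u v) => //.
exact: is_lim_seq_const.
Qed.

Lemma lim0_abs (u v : nat -> R) :
  (forall n, Rabs (u n) <= v n) -> is_lim_seq v 0 -> is_lim_seq u 0.
Proof.
move=> h hv; apply/is_lim_seq_abs_0; apply: lim0_le hv => n.
by split; [exact: Rabs_pos | exact: h].
Qed.

(** * Limits and power series over C *)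

Definition Clim (u : nat -> C) (l : C) : Prop :=
  is_lim_seq (fun n => Cmod (u n - l)) 0.

Lemma Clim_eps u l : Clim u l <->
  forall eps, 0 < eps -> exists N, forall n, (N <= n)%N -> Cmod (u n - l) < eps.
Proof.
rewrite /Clim lim_seq_eps; split=> h e he; have [N hN] := h e he; exists N => n hn.
  by have := hN n hn; rewrite Rminus_0_r Rabs_pos_eq //; exact: Cmod_ge_0.
by rewrite Rminus_0_r Rabs_pos_eq; [exact: hN | exact: Cmod_ge_0].
Qed.

Lemma Clim_ext u v l : (forall n, u n = v n) -> Clim u l -> Clim v l.
Proof. by move=> h; apply: is_lim_seq_ext => n; rewrite h. Qed.

Lemma Clim_ext_loc u v l N :
  (forall n, (N <= n)%N -> u n = v n) -> Clim u l -> Clim v l.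
Proof.
move=> h; apply: is_lim_seq_ext_loc; exists N => n hn; rewrite h //.
by apply/leP.
Qed.

Lemma Clim_const l : Clim (fun _ => l) l.
Proof.
apply: (is_lim_seq_ext (fun _ => 0)); last exact: is_lim_seq_const.
by move=> n; rewrite (_ : l - l = 0)%C; [rewrite Cmod_0 | ring].
Qed.

Lemma lim_plus0 u v :
  is_lim_seq u 0 -> is_lim_seq v 0 -> is_lim_seq (fun n => u n + v n) 0.
Proof.
move=> hu hv; have := is_lim_seq_plus' _ _ _ _ hu hv; by rewrite Rplus_0_l.
Qed.

Lemma lim_scal0 a u : is_lim_seq u 0 -> is_lim_seq (fun n => a * u n) 0.
Proof.
move=> hu; have := is_lim_seq_scal_l _ a _ hu; by rewrite /= Rmult_0_r.
Qed.

Lemma Clim_plus u v l m :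
  Clim u l -> Clim v m -> Clim (fun n => u n + v n)%C (l + m).
Proof.
move=> hu hv; rewrite /Clim; apply: lim0_le (lim_plus0 hu hv) => n; split; first exact: Cmod_ge_0.
have -> : (u n + v n - (l + m) = (u n - l) + (v n - m))%C by ring.
exact: Cmod_triangle.
Qed.

Lemma Clim_scal a u l : Clim u l -> Clim (fun n => a * u n)%C (a * l).
Proof.
move=> hu; rewrite /Clim; apply: lim0_le (lim_scal0 (Cmod a) hu) => n.
split; first exact: Cmod_ge_0.
have -> : (a * u n - a * l = a * (u n - l))%C by ring.
by rewrite Cmod_mult; lra.
Qed.

Lemma Clim_minus u v l m :
  Clim u l -> Clim v m -> Clim (fun n => u n - v n)%C (l - m).
Proof.
move=> hu hv.
have -> : (l - m = l + (-(1)) * m)%C by ring.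
apply: (Clim_ext (u := fun n => (u n + (-(1)) * v n)%C)); first by move=> n; ring.
by apply: Clim_plus => //; apply: Clim_scal.
Qed.

Lemma Clim_unique u l m : Clim u l -> Clim u m -> l = m.
Proof.
move=> hl hm.
have h : is_lim_seq (fun _ : nat => Cmod (l - m)) 0.
  apply: lim0_le (lim_plus0 hl hm) => n; split; first exact: Cmod_ge_0.
  rewrite (Cmod_sub_sym (u n) l); exact: Cmod_tri3.
have h0 : Cmod (l - m) = 0.
  by have := is_lim_seq_unique _ _ h; rewrite Lim_seq_const => -[].
have : (l - m = 0)%C by apply: Cmod_eq_0.
by move=> e; have -> : (l = (l - m) + m)%C by [ring]; rewrite e; ring.
Qed.

Lemma Clim_shift u l k : Clim (fun n => u (n + k)%N) l <-> Clim u l.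
Proof.
rewrite /Clim; symmetry.
exact: (is_lim_seq_incr_n (fun n => Cmod (u n - l)) k).
Qed.

Lemma Clim_S u l : Clim (fun n => u n.+1) l <-> Clim u l.
Proof.
rewrite -(Clim_shift u l 1); split; apply: Clim_ext => n; by rewrite addn1.
Qed.

Lemma Clim_components u l : Clim u l <->
  is_lim_seq (fun n => Re (u n)) (Re l) /\ is_lim_seq (fun n => Im (u n)) (Im l).
Proof.
split=> [h|[/lim_seq_eps h1 /lim_seq_eps h2]].
  move/Clim_eps: h => h.
  split; apply/lim_seq_eps => e he; have [N hN] := h e he; exists N => n hn.
    have -> : Re (u n) - Re l = Re (u n - l)%C by [].
    exact: Rle_lt_trans (re_le_Cmod _) (hN _ hn).
  have -> : Im (u n) - Im l = Im (u n - l)%C by [].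
  exact: Rle_lt_trans (Im_le_Cmod _) (hN _ hn).
apply/Clim_eps => e he.
have he2 : 0 < e / 2 by lra.
have [N1 H1] := h1 _ he2; have [N2 H2] := h2 _ he2.
exists (maxn N1 N2) => n; rewrite geq_max => /andP [hn1 hn2].
apply: Rle_lt_trans (Cmod_le_abs _) _.
have := H1 n hn1; have := H2 n hn2.
rewrite -[Re (u n) - Re l]/(Re (u n - l)%C) -[Im (u n) - Im l]/(Im (u n - l)%C); lra.
Qed.

Lemma Clim_RtoC (u : nat -> R) (l : R) : is_lim_seq u l -> Clim (fun n => RtoC (u n)) (RtoC l).
Proof.
move=> h; apply/Clim_components; split=> //.
exact: is_lim_seq_const.
Qed.

Lemma Clim_csum (f : nat -> nat -> C) (l : nat -> C) m :
  (forall k, (k < m)%N -> Clim (f k) (l k)) ->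
  Clim (fun n => csum (fun k => f k n) m) (csum l m).
Proof.
elim: m => [|m IH] h /=; first exact: Clim_const.
by apply: Clim_plus; [apply: IH => k hk; apply: h; exact: ltnW | exact: h].
Qed.

Lemma Clim_bound u l B : Clim u l -> (forall n, Cmod (u n) <= B) -> Cmod l <= B.
Proof.
move=> h hB; apply: Rnot_lt_le => hlt.
have he : 0 < Cmod l - B by lra.
have [N hN] := (Clim_eps u l).1 h _ he.
have := hN N (leqnn N); have := hB N.
have := Cmod_triangle (u N) (l - u N).
rewrite (Cmod_sub_sym (u N) l) (_ : u N + (l - u N) = l)%C; last ring.
lra.
Qed.

Lemma rsum_tail (b : nat -> R) : (forall n, 0 <= b n) -> ex_series b ->
  forall eps, 0 < eps -> exists N, forall n m, (N <= n)%N -> (n <= m)%N ->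
    rsum b m - rsum b n < eps.
Proof.
move=> hb [l /lim_rsum /lim_seq_eps h] e he.
have he2 : 0 < e / 2 by lra.
have [N hN] := h _ he2; exists N => n m hn hm.
have := Rabs_def2 _ _ (hN n hn); have := Rabs_def2 _ _ (hN m (leq_trans hn hm)); lra.
Qed.

Lemma csum_abs_conv (u : nat -> C) (b : nat -> R) :
  (forall n, Cmod (u n) <= b n) -> ex_series b -> exists l, Clim (csum u) l.
Proof.
move=> h hb.
have [l1 h1] : ex_series (fun n => Re (u n)).
  apply: (@ex_series_le R_AbsRing R_CompleteNormedModule _ b) => // n.
  exact: Rle_trans (re_le_Cmod _) (h n).
have [l2 h2] : ex_series (fun n => Im (u n)).
  apply: (@ex_series_le R_AbsRing R_CompleteNormedModule _ b) => // n.
  exact: Rle_trans (Im_le_Cmod _) (h n).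
exists (l1, l2); apply/Clim_components; split.
  by apply: is_lim_seq_ext ((lim_rsum _ _).1 h1) => n; rewrite Re_csum.
by apply: is_lim_seq_ext ((lim_rsum _ _).1 h2) => n; rewrite Im_csum.
Qed.

(* Tannery's theorem, applied to the partial row sums. *)
Lemma double_series (c : nat -> nat -> C) (b : nat -> R) (r col : nat -> C) :
  (forall n m, rsum (fun k => Cmod (c n k)) m <= b n) -> ex_series b ->
  (forall n, Clim (csum (c n)) (r n)) ->
  (forall k, Clim (csum (fun n => c n k)) (col k)) ->
  exists S, Clim (csum r) S /\ Clim (csum col) S.
Proof.
move=> hb hs hr hcol.
have b0 n : 0 <= b n by exact: (hb n 0%N).
have hpb n m : Cmod (csum (c n) m) <= b n by apply: Rle_trans (Cmod_csum _ _) (hb n m).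
have hrb n : Cmod (r n) <= b n by apply: Clim_bound (hr n) _; exact: hpb.
have [S hS] := csum_abs_conv hrb hs.
exists S; split=> //.
apply/Clim_eps => e he.
have he4 : 0 < e / 8 by lra.
have [N hN] := rsum_tail b0 hs he4.
(* [D n m] is the total error over the first [n] rows when each is cut at column [m]. As [n] grows
   it tends to [S - csum col m], and the rows past [N] change it by at most twice the tail of
   [b]. *)
pose D n m := csum (fun i => r i - csum (c i) m)%C n.
have hD0 : Clim (D N) 0.
  have -> : RtoC 0 = csum (fun i => r i - r i)%C N.
    by elim: (N) => //= k <-; ring.
  by apply: Clim_csum => k _; apply: Clim_minus; [exact: Clim_const|exact: hr].
have [M hM] := (Clim_eps _ _).1 hD0 _ he4.
exists M => m hm.
have hDm : Clim (fun n => D n m) (S - csum col m).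
  apply: (Clim_ext (u := fun n => (csum r n - csum (fun k => csum (fun i => c i k) n) m)%C)).
    by move=> n; rewrite /D csum_minus csum_exch.
  by apply: Clim_minus => //; apply: Clim_csum => k _.
have [M' hM'] := (Clim_eps _ _).1 hDm _ he4.
pose n := maxn M' N.
have h1 := hM' n (leq_maxl _ _).
have h2 := hM m hm.
have h3 : Cmod (D n m - D N m) <= 2 * (rsum b n - rsum b N).
  have -> : n = (N + (n - N))%N by rewrite subnKC // leq_maxr.
  rewrite /D csum_shift rsum_shift.
  have -> (x y : C) : (x + y - x = y)%C by ring.
  rewrite (_ : forall x y, x + y - x = y); last by move=> *; ring.
  apply: Rle_trans (Cmod_csum _ _) _; rewrite -rsum_scal.
  apply: rsum_le => k _; have := hrb (N + k)%N; have := hpb (N + k)%N m.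
  have := Cmod_triangle (r (N + k)%N) (- csum (c (N + k)%N) m).
  rewrite Cmod_opp /Cminus; lra.
have h4 := hN N n (leqnn _) (leq_maxr _ _).
rewrite (Cmod_sub_sym (D n m)) in h1.
have h5 := Cmod_tri3 (S - csum col m) (D n m) 0.
have h6 := Cmod_tri3 (D n m) (D N m) 0.
have -> : (csum col m - S = - (S - csum col m - 0))%C by ring.
rewrite Cmod_opp; lra.
Qed.

Definition Cps (c : nat -> C) (z l : C) : Prop :=
  Clim (csum (fun k => c k * Cpow z k)%C) l.

(** The balls of the uniform structure on C are squares, and passing from such a ball to [Cmod]
    costs a factor [sqrt 2]; the bound 2 is enough. *)
Lemma sqrt2_le : sqrt 2 <= 2.
Proof.
rewrite -[X in _ <= X]sqrt_Rsqr; last lra.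
by apply: sqrt_le_1_alt; rewrite /Rsqr; lra.
Qed.

Lemma pow_n_Cpow (z : C) k : @pow_n C_Ring z k = Cpow z k.
Proof. by elim: k => //= k ->. Qed.

Lemma Cps_pseries c z l :
  Cps c z l <-> @is_pseries C_AbsRing C_NormedModule c z l.
Proof.
rewrite /Cps -Clim_S /is_pseries /is_series.
have e n : csum (fun k => c k * Cpow z k)%C n.+1 =
  @sum_n C_AbelianMonoid (fun k => scal (pow_n (K:=C_Ring) z k) (c k)) n.
  rewrite csum_sum_n; apply: sum_n_ext => k.
  by rewrite pow_n_Cpow /scal /= /mult /= Cmult_comm.
split=> h.
  apply/filterlim_locally => eps; have [N hN] := (Clim_eps _ _).1 h _ (cond_pos eps).
  exists N => n /leP hn; apply: C_NormedModule_mixin_compat1.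
  have := hN n hn; rewrite e; exact.
apply/Clim_eps => d hd.
have hd2 : 0 < d / 2 by lra.
have [N hN] := (filterlim_locally _ _).1 h (mkposreal _ hd2).
exists N => n hn.
have := C_NormedModule_mixin_compat2 _ _ _ (hN n (leP hn)).
rewrite e /=.
move=> h3; have h2 := sqrt2_le; apply: Rlt_le_trans h3 _.
have : sqrt 2 * (d / 2) <= 2 * (d / 2) by apply: Rmult_le_compat_r; lra.
lra.
Qed.

(* Coquelicot's rules restated for real functions: ring and field do not recognize
   values typed in the carrier of R_NormedModule. *)
Lemma derive_ext (f g : R -> R) (x l : R) :
  (forall t, f t = g t) -> is_derive f x l -> is_derive g x l.
Proof. exact: is_derive_ext. Qed.
Lemma derive_plus (f g : R -> R) (x df dg : R) :
  is_derive f x df -> is_derive g x dg -> is_derive (fun t => f t + g t) x (df + dg).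
Proof. exact: is_derive_plus. Qed.
Lemma derive_minus (f g : R -> R) (x df dg : R) :
  is_derive f x df -> is_derive g x dg -> is_derive (fun t => f t - g t) x (df - dg).
Proof. exact: is_derive_minus. Qed.
Lemma derive_scal (f : R -> R) (x a df : R) :
  is_derive f x df -> is_derive (fun t => a * f t) x (a * df).
Proof. exact: is_derive_scal. Qed.
Lemma derive_const (a x : R) : is_derive (fun _ : R => a) x 0.
Proof. exact: is_derive_const. Qed.

(** * Mean value estimates and a convergent comparison series *)

Lemma deriv_cont (f : R -> R) x l : is_derive f x l -> continuity_pt f x.
Proof.
move=> h; apply/continuity_pt_filterlim.
by apply: (ex_derive_continuous (V := R_NormedModule)); exists l.
Qed.

Lemma mvt_closed (f df : R -> R) a b : a <= b ->
  (forall t, a <= t <= b -> is_derive f t (df t)) ->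
  exists c, a <= c <= b /\ f b - f a = df c * (b - a).
Proof.
move=> hab h.
have [|t|c hc] := @MVT_gen f a b df.
- move=> t; rewrite Rmin_left // Rmax_right // => ht; apply: h; lra.
- rewrite Rmin_left // Rmax_right // => ht; apply: deriv_cont; apply: h; lra.
- by exists c; move: hc; rewrite Rmin_left // Rmax_right.
Qed.

Lemma mvt_bound (f df : R -> R) a b B : a <= b ->
  (forall t, a <= t <= b -> is_derive f t (df t)) ->
  (forall t, a <= t <= b -> Rabs (df t) <= B) ->
  Rabs (f b - f a) <= B * (b - a).
Proof.
move=> hab h hB; have [c [hc ->]] := mvt_closed hab h.
rewrite Rabs_mult (Rabs_pos_eq (b - a)); last lra.
by apply: Rmult_le_compat_r; [lra | exact: hB].
Qed.

(** Both [g - f] and [g + f] have a nonnegative derivative. *)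
Lemma deriv_dominate (f df g dg : R -> R) a b : a <= b ->
  (forall t, a <= t <= b -> is_derive f t (df t)) ->
  (forall t, a <= t <= b -> is_derive g t (dg t)) ->
  (forall t, a <= t <= b -> Rabs (df t) <= dg t) ->
  Rabs (f b - f a) <= g b - g a.
Proof.
move=> hab hf hg h.
have [c [hc e1]] := @mvt_closed (fun t => g t - f t) (fun t => dg t - df t) _ _ hab
  (fun t ht => derive_minus (hg t ht) (hf t ht)).
have [d [hd e2]] := @mvt_closed (fun t => g t + f t) (fun t => dg t + df t) _ _ hab
  (fun t ht => derive_plus (hg t ht) (hf t ht)).
have h1 : 0 <= (dg c - df c) * (b - a).
  apply: Rmult_le_pos; last lra; have := h c hc; have := Rle_abs (df c); lra.
have h2 : 0 <= (dg d + df d) * (b - a).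
  apply: Rmult_le_pos; last lra; have := h d hd; have := Rle_abs (- df d).
  rewrite Rabs_Ropp; lra.
apply: Rabs_le; lra.
Qed.

Lemma is_derive_rsum (f df : nat -> R -> R) n x :
  (forall k, (k < n)%N -> is_derive (f k) x (df k x)) ->
  is_derive (fun t => rsum (fun k => f k t) n) x (rsum (fun k => df k x) n).
Proof.
elim: n => /= [|n IH] h; first exact: derive_const.
apply: derive_plus; last exact: h.
by apply: IH => k hk; apply: h; exact: ltnW.
Qed.

Lemma ex_series_bounded (b : nat -> R) B :
  (forall n, 0 <= b n) -> (forall n, rsum b n <= B) -> ex_series b.
Proof.
move=> h hB.
have [l hl] : ex_finite_lim_seq (rsum b).
  apply: (ex_finite_lim_seq_incr _ B) => // n /=; have := h n; lra.
by exists l; apply/lim_rsum.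
Qed.

Lemma Rpower_deriv (p t : R) : 0 < t ->
  is_derive (fun t => Rpower t p) t (p * Rpower t (p - 1)).
Proof.
move=> ht; rewrite /Rpower; auto_derive => //.
rewrite (_ : (p - 1) * ln t = p * ln t + - ln t); last ring.
by rewrite exp_plus exp_Ropp exp_ln //; field; lra.
Qed.

(** Integral comparison through the mean value theorem: every term but the first is at most a
    decrement of [t ^ (1 - p) / (p - 1)], and the decrements telescope. *)
Lemma ex_series_Rpower p : 1 < p -> ex_series (fun n => Rpower (INR n.+1) (- p)).
Proof.
move=> hp.
have hpos n : 0 < INR n.+1 by apply: lt_0_INR; apply/ltP.
have step n : Rpower (INR n.+2) (- p) <=
   / (p - 1) * (Rpower (INR n.+1) (1 - p) - Rpower (INR n.+2) (1 - p)).
  have hn := hpos n.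
  have hS : INR n.+2 = INR n.+1 + 1 by rewrite S_INR.
  have [|t ht|c [hc e]] := @mvt_closed (fun t => Rpower t (1 - p))
    (fun t => (1 - p) * Rpower t (1 - p - 1)) (INR n.+1) (INR n.+2); first lra.
    by apply: Rpower_deriv; lra.
  have e2 : Rpower (INR n.+1) (1 - p) - Rpower (INR n.+2) (1 - p) = (p - 1) * Rpower c (- p).
    have -> : - p = 1 - p - 1 by ring.
    move: e; rewrite hS; lra.
  rewrite e2 -Rmult_assoc Rinv_l ?Rmult_1_l; last lra.
  rewrite !Rpower_Ropp; apply: Rinv_le_contravar; first exact: exp_pos.
  apply: Rle_Rpower_l; lra.
apply: (@ex_series_bounded _ (1 + / (p - 1))) => n.
  exact: Rlt_le (exp_pos _).
have hip : 0 < / (p - 1) by apply: Rinv_0_lt_compat; lra.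
have H m : rsum (fun n => Rpower (INR n.+1) (- p)) m.+1 <=
   1 + / (p - 1) * (1 - Rpower (INR m.+1) (1 - p)).
  elim: m => [|m IH].
    rewrite /= /Rpower ln_1 !Rmult_0_r exp_0; lra.
  have := step m.
  change (rsum (fun n => Rpower (INR n.+1) (- p)) m.+2) with
    (rsum (fun n => Rpower (INR n.+1) (- p)) m.+1 + Rpower (INR m.+2) (- p)).
  lra.
case: n => [|m]; first by rewrite /=; lra.
apply: Rle_trans (H m) _.
have : 0 < / (p - 1) * Rpower (INR m.+1) (1 - p) by apply: Rmult_lt_0_compat => //; exact: exp_pos.
lra.
Qed.

(** * Euler-Maclaurin summation *)

(* beta k is the Bernoulli polynomial B_k divided by k!. *)
Fixpoint beta (k : nat) : R -> R :=
  if k is j.+1 then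
    fun x => RInt (beta j) 0 x - RInt (fun y => RInt (beta j) 0 y) 0 1
  else fun _ => 1.

Lemma RInt_cont_ex (f : R -> R) a b : (forall t, continuous f t) -> ex_RInt f a b.
Proof. by move=> h; apply: ex_RInt_continuous => t _. Qed.

Lemma is_derive_prim (f : R -> R) x : (forall t, continuous f t) ->
  is_derive (fun y => RInt f 0 y) x (f x).
Proof.
move=> h; apply: (is_derive_RInt f) => //.
by apply: filter_forall => y; apply: RInt_correct; exact: RInt_cont_ex.
Qed.

(** The difference of [f] and the primitive of [g] has derivative 0 inside the interval.
    Differentiability is asked there only, because the primitives met later contain [t * ln t],
    which is merely continuous at 0. *)
Lemma FTC_open (f g : R -> R) a b : a <= b ->
  (forall t, a < t < b -> is_derive f t (g t)) ->
  (forall t, a <= t <= b -> continuity_pt f t) ->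
  (forall t, continuous g t) -> is_RInt g a b (f b - f a).
Proof.
move=> hab hd hc hg.
have dG t : is_derive (fun y => RInt g a y) t (g t).
  apply: (is_derive_RInt g) => //.
  by apply: filter_forall => y; apply: RInt_correct; exact: RInt_cont_ex.
have [|t|c [_]] := @MVT_gen (fun t => f t - RInt g a t) a b (fun _ => 0).
- move=> t; rewrite Rmin_left // Rmax_right // => ht.
  rewrite -(Rminus_diag (g t)).
  by apply: derive_minus; [exact: hd | exact: dG].
- rewrite Rmin_left // Rmax_right // => ht.
  by apply: continuity_pt_minus; [exact: hc | exact: deriv_cont (dG t)].
- rewrite RInt_point Rmult_0_l => e.
  have <- : RInt g a b = f b - f a by move: e; rewrite /zero /=; lra.
  by apply: RInt_correct; exact: RInt_cont_ex.
Qed.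

Lemma FTC (f g : R -> R) a b : a <= b -> (forall t, is_derive f t (g t)) ->
  (forall t, continuous g t) -> is_RInt g a b (f b - f a).
Proof.
move=> hab hd hg; apply: FTC_open => // t _; exact: deriv_cont (hd t).
Qed.

Lemma beta_cont k x : continuous (beta k) x.
Proof.
elim: k x => [|k IH] x /=; first exact: continuous_const.
apply: (continuous_minus (V := R_NormedModule)); last exact: continuous_const.
by apply: (ex_derive_continuous (V := R_NormedModule)); exists (beta k x); apply: is_derive_prim.
Qed.

Lemma beta_deriv k x : is_derive (beta k.+1) x (beta k x).
Proof.
rewrite -[beta k x]Rminus_0_r.
apply: derive_minus; last exact: derive_const.
by apply: is_derive_prim; exact: beta_cont.
Qed.

Lemma beta_mean k : RInt (beta k.+1) 0 1 = 0.
Proof.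
rewrite /=.
have hc t : continuous (fun y => RInt (beta k) 0 y) t.
  apply: (ex_derive_continuous (V := R_NormedModule)); exists (beta k t).
  by apply: is_derive_prim; exact: beta_cont.
rewrite (RInt_minus (V := R_CompleteNormedModule)); first last.
- exact: ex_RInt_const.
- exact: RInt_cont_ex.
rewrite RInt_const /minus /plus /opp /scal /= /mult /=.
have h (a : R) : a + - ((1 - 0) * a) = 0 by ring.
exact: h.
Qed.

Lemma beta1 x : beta 1 x = x - 1 / 2.
Proof.
rewrite /= RInt_const.
have -> : RInt (fun y => RInt (fun _ : R => 1) 0 y) 0 1 = 1 / 2.
  rewrite (RInt_ext _ (fun y => y)); last first.
    by move=> y _; rewrite RInt_const /scal /= /mult /=; ring.
  have h : is_RInt (fun y : R => y) 0 1 (1 ^ 2 / 2 - 0 ^ 2 / 2).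
    apply: (FTC (f := fun y => y ^ 2 / 2)); first lra; last exact: continuous_id.
    by move=> t; auto_derive => //; field.
  have e : 1 ^ 2 / 2 - 0 ^ 2 / 2 = 1 / 2 by field.
  exact: eq_trans (is_RInt_unique _ _ _ _ h) e.
by rewrite /scal /= /mult /=; ring.
Qed.

(** The increment over [0,1] is the mean of [beta k.+1], which is 0; among the nonconstant ones only
    [beta 1] jumps. *)
Lemma beta_per k : beta k.+2 1 = beta k.+2 0.
Proof. by have := beta_mean k; rewrite /= => ->; rewrite RInt_point. Qed.

(* The Euler-Maclaurin remainder of Phi' on [0,1], Phi k standing for the k-th
   derivative of Phi. *)
Definition EM (K : nat) (Phi : nat -> R -> R) (x : R) : R :=
  Phi 1%N x - rsum (fun k => beta k x * (Phi k 1 - Phi k 0)) K.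

(** Differentiation in [x] lowers the order by one and replaces [Phi] by its derivative, and a
    function with a zero in [0,1] is bounded there by any bound of its derivative. The estimate thus
    descends without loss to order 0, where the remainder is [Phi 1] itself. *)
Lemma EM_bound K (Phi : nat -> R -> R) B x :
  (forall k t, 0 <= t <= 1 -> is_derive (Phi k) t (Phi k.+1 t)) ->
  (forall t, 0 <= t <= 1 -> Rabs (Phi K.+1 t) <= B) ->
  0 <= x <= 1 -> Rabs (EM K Phi x) <= B.
Proof.
elim: K Phi x => [|K IH] Phi x hd hB hx.
  by rewrite /EM /= Rminus_0_r; exact: hB.
have dEM t : 0 <= t <= 1 ->
    is_derive (EM K.+1 Phi) t (EM K (fun k => Phi k.+1) t).
  move=> ht; apply: derive_minus; first exact: hd.
  have -> : rsum (fun k => beta k t * (Phi k.+1 1 - Phi k.+1 0)) K =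
      rsum (fun k => (if k is j.+1 then beta j t else 0) * (Phi k 1 - Phi k 0)) K.+1.
    by rewrite rsum_recl; ring.
  apply: (is_derive_rsum (f := fun k t => beta k t * (Phi k 1 - Phi k 0))
     (df := fun k t => (if k is j.+1 then beta j t else 0) * (Phi k 1 - Phi k 0))) => -[|k] _.
    rewrite Rmult_0_l; apply: (derive_ext (f := fun _ => Phi 0%N 1 - Phi 0%N 0)).
      by move=> s; rewrite Rmult_1_l.
    exact: derive_const.
  apply: (derive_ext (f := fun t => (Phi k.+1 1 - Phi k.+1 0) * beta k.+1 t)).
    by move=> s; ring.
  rewrite Rmult_comm; apply: derive_scal; exact: beta_deriv.
have bEM t : 0 <= t <= 1 -> Rabs (EM K (fun k => Phi k.+1) t) <= B.
  by move=> ht; apply: IH => //; move=> k s hs; exact: hd.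
(* EM has a zero by Rolle: its primitive takes equal values at 0 and 1. *)
have [y [hy ey]] : exists y, 0 <= y <= 1 /\ EM K.+1 Phi y = 0.
  pose G t := Phi 0%N t - rsum (fun k => beta k.+1 t * (Phi k 1 - Phi k 0)) K.+1.
  have [||y [hy e]] := @mvt_closed G (EM K.+1 Phi) 0 1; first lra.
    move=> t ht; apply: derive_minus; first exact: hd.
    apply: (is_derive_rsum (f := fun k t => beta k.+1 t * (Phi k 1 - Phi k 0))
     (df := fun k t => beta k t * (Phi k 1 - Phi k 0))) => k _.
    apply: (derive_ext (f := fun t => (Phi k 1 - Phi k 0) * beta k.+1 t)).
      by move=> s; ring.
    rewrite Rmult_comm; apply: derive_scal; exact: beta_deriv.
  exists y; split=> //.
  move: e; rewrite Rminus_0_r Rmult_1_r => <-.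
  (* The jump 1 of [beta 1] makes the term of index 0 cancel the increment of [Phi 0]; the other
     terms are periodic. *)
  rewrite /G !rsum_recl !beta1.
  rewrite (@rsum_ext (fun k => beta k.+2 1 * _) (fun k => beta k.+2 0 * (Phi k.+1 1 - Phi k.+1 0))).
    by field.
  by move=> k _; rewrite beta_per.
have B0 : 0 <= B by apply: Rle_trans (Rabs_pos _) (bEM x hx).
have -> : EM K.+1 Phi x = EM K.+1 Phi x - EM K.+1 Phi y by rewrite ey; ring.
case: (Rle_dec y x) => hxy.
  apply: Rle_trans (mvt_bound (B := B) (df := EM K (fun k => Phi k.+1)) hxy _ _) _.
  - by move=> t ht; apply: dEM; lra.
  - by move=> t ht; apply: bEM; lra.
  - by rewrite -[X in _ <= X]Rmult_1_r; apply: Rmult_le_compat_l; lra.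
rewrite Rabs_minus_sym.
have hyx : x <= y by lra.
apply: Rle_trans (mvt_bound (B := B) (df := EM K (fun k => Phi k.+1)) hyx _ _) _.
- by move=> t ht; apply: dEM; lra.
- by move=> t ht; apply: bEM; lra.
- by rewrite -[X in _ <= X]Rmult_1_r; apply: Rmult_le_compat_l; lra.
Qed.

(** * The exponential series *)

Lemma Cexp_plus a b : Cexp (a + b) = (Cexp a * Cexp b)%C.
Proof.
case: a => a1 a2; case: b => b1 b2; rewrite /Cexp /Cplus /Cmult /=.
by rewrite exp_plus cos_plus sin_plus; congr (_, _); ring.
Qed.

Lemma Cmod_Cexp z : Cmod (Cexp z) = exp (Re z).
Proof.
rewrite /Cexp /Cmod /=.
have h := exp_pos (Re z).
rewrite -[RHS]sqrt_Rsqr; last lra.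
congr sqrt; have := sin2_cos2 (Im z); rewrite /Rsqr => e.
have -> : exp (Re z) * cos (Im z) * (exp (Re z) * cos (Im z) * 1) +
  exp (Re z) * sin (Im z) * (exp (Re z) * sin (Im z) * 1) =
  exp (Re z) * exp (Re z) * (sin (Im z) * sin (Im z) + cos (Im z) * cos (Im z)) by ring.
by rewrite e; ring.
Qed.

Lemma derive_pow_fact k s :
  is_derive (fun t => t ^ k.+1 / INR (k.+1)`!) s (s ^ k / INR k`!).
Proof.
have hf : 0 < INR k`! by apply: lt_0_INR; apply/ltP; exact: fact_gt0.
have hk : 0 < INR k.+1 by apply: lt_0_INR; apply/ltP.
rewrite factS mult_INR; auto_derive => //.
rewrite -[match k with 0%N => _ | _ => _ end]/(INR k.+1).
by field; split; apply: Rgt_not_eq.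
Qed.

(* By induction on K, integrating the bound; the factor 2 comes from estimating the
   real and imaginary parts separately. *)
Lemma Cexp_Taylor_bound (z : C) K t : 0 <= t <= 1 ->
  Cmod (Cexp (RtoC t * z) - csum (fun k => Cpow z k * RtoC (t ^ k / INR k`!))%C K)
  <= exp (Rabs (Re z)) * ((2 * Cmod z * t) ^ K / INR (K`!)).
Proof.
pose E t := Cexp (RtoC t * z).
pose T K t := csum (fun k => Cpow z k * RtoC (t ^ k / INR (k`!)))%C K.
have dE s : is_derive (fun t => Re (E t)) s (Re (z * E s)%C) /\
            is_derive (fun t => Im (E t)) s (Im (z * E s)%C).
  case: z @E @T => a b E T; rewrite /E /Cexp /=; split.
    by auto_derive => //; rewrite /Rminus; ring.
  by auto_derive => //; rewrite /Rminus; ring.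
have dT k s : is_derive (fun t => Re (T k.+1 t)) s (Re (z * T k s)%C) /\
              is_derive (fun t => Im (T k.+1 t)) s (Im (z * T k s)%C).
  have key (f : C -> R) : (forall w r, f (w * RtoC r)%C = f w * r) ->
     (forall g n, f (csum g n) = rsum (fun k => f (g k)) n) ->
     is_derive (fun t => f (T k.+1 t)) s (f (z * T k s)%C).
    move=> fr fs.
    apply: (derive_ext (f := fun t => rsum (fun j => f (Cpow z j) * (t ^ j / INR j`!)) k.+1)).
      by move=> u; rewrite fs; apply: rsum_ext => j _; rewrite fr.
    have -> : f (z * T k s)%C =
      rsum (fun j => f (Cpow z j) * (if j is i.+1 then s ^ i / INR i`! else 0)) k.+1.
      rewrite rsum_recl Rmult_0_r Rplus_0_l /T -csum_scal fs.
      by apply: rsum_ext => j _; rewrite Cmult_assoc fr.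
    apply: (is_derive_rsum (f := fun j t => f (Cpow z j) * (t ^ j / INR j`!))
      (df := fun j s => f (Cpow z j) * (if j is i.+1 then s ^ i / INR i`! else 0))) => -[|j] _.
      rewrite Rmult_0_r; apply: (derive_ext (f := fun _ => f (Cpow z 0) * (1 / INR 0`!))) => //.
      exact: derive_const.
    by apply: derive_scal; exact: derive_pow_fact.
  split; apply: key => [[w1 w2] r|g n]; rewrite ?Re_csum ?Im_csum //= ; ring.
elim: K t => [|K IH] t ht.
  rewrite /= (_ : _ - 0 = Cexp (t * z))%C; last ring.
  rewrite Cmod_Cexp; have -> : 1 / INR 0`! = 1 by rewrite /= ; field.
  rewrite Rmult_1_r; have -> : Re (t * z)%C = t * Re z by case: (z) => a b; rewrite /=; ring.
  have h : t * Re z <= Rabs (Re z).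
    have := Rle_abs (Re z); have := Rabs_pos (Re z); nra.
  case: h => [h|->]; [by apply: Rlt_le; apply: exp_increasing | lra].
set B := exp (Rabs (Re z)) in IH *.
have HB : 0 < B by exact: exp_pos.
pose g t := B * ((2 * Cmod z) ^ K * Cmod z * (t ^ K.+1 / INR (K.+1)`!)).
have dg s : is_derive g s (B * ((2 * Cmod z) ^ K * Cmod z * (s ^ K / INR K`!))).
  by do 2 apply: derive_scal; exact: derive_pow_fact.
have bd s : 0 <= s <= t -> Cmod (z * (E s - T K s)) <= B * ((2 * Cmod z) ^ K * Cmod z * (s ^ K / INR K`!)).
  move=> hs; rewrite Cmod_mult.
  have hs1 : 0 <= s <= 1 by lra.
  have := IH s hs1; rewrite -/(E s) -/(T K s) Rpow_mult_distr => h.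
  have := Rmult_le_compat_l _ _ _ (Cmod_ge_0 z) h; rewrite /Rdiv; lra.
have T0 k : T k.+1 0 = RtoC 1.
  rewrite /T csum_recl /= (_ : csum _ k = RtoC 0).
    by rewrite (_ : 1 / 1 = 1); [ring | field].
  by elim: k => //= k ->; rewrite Rmult_0_l /Rdiv Rmult_0_l; ring.
have E0 : E 0 = RtoC 1.
  rewrite /E (_ : 0 * z = 0)%C; last ring.
  by rewrite /Cexp /= exp_0 cos_0 sin_0 Rmult_1_l Rmult_0_r.
have hd (f : C -> R) : (forall w, Rabs (f w) <= Cmod w) -> (forall w1 w2, f (w1 - w2)%C = f w1 - f w2) ->
   (forall s, is_derive (fun t => f (E t)) s (f (z * E s)%C)) ->
   (forall s, is_derive (fun t => f (T K.+1 t)) s (f (z * T K s)%C)) ->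
   Rabs (f (E t - T K.+1 t)%C) <= g t.
  move=> h1 h2 h3 h4.
  have g0 : g 0 = 0 by rewrite /g pow_ne_zero // /Rdiv; ring.
  have f0 : f (E 0 - T K.+1 0)%C = 0.
    rewrite h2 E0 T0; ring.
  have -> : f (E t - T K.+1 t)%C = f (E t - T K.+1 t)%C - f (E 0 - T K.+1 0)%C by rewrite f0; ring.
  have -> : g t = g t - g 0 by rewrite g0; ring.
  apply: (deriv_dominate (f := fun t => f (E t - T K.+1 t)%C) (df := fun s => f (z * (E s - T K s))%C)
     (g := g) (dg := fun s => B * ((2 * Cmod z) ^ K * Cmod z * (s ^ K / INR K`!)))); first by lra.
  - move=> s _; rewrite (_ : z * (E s - T K s) = z * E s - z * T K s)%C; last ring.
    rewrite h2; apply: (derive_ext (f := fun t => f (E t) - f (T K.+1 t))).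
      by move=> u; rewrite h2.
    by apply: derive_minus.
  - by move=> s _; exact: dg.
  - by move=> s hs; apply: Rle_trans (h1 _) (bd s hs).
apply: Rle_trans (Cmod_le_abs _) _.
have h1 := hd Re re_le_Cmod (fun _ _ => erefl) (fun s => (dE s).1) (fun s => (dT K s).1).
have h2 := hd Im Im_le_Cmod (fun _ _ => erefl) (fun s => (dE s).2) (fun s => (dT K s).2).
have -> : B * ((2 * Cmod z * t) ^ K.+1 / INR (K.+1)`!) = 2 * g t.
  by rewrite /g Rpow_mult_distr /= /Rdiv; ring.
rewrite -/(E t) -/(T K.+1 t); lra.
Qed.

Lemma fact_Factorial n : n`! = Factorial.fact n.
Proof. by elim: n => //= n <-; rewrite factS. Qed.

Lemma lim_pow_fact a : is_lim_seq (fun n => a ^ n / INR n`!) 0.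
Proof.
have h := cv_speed_pow_fact a.
by apply/is_lim_seq_Reals => e he; have [N hN] := h e he; exists N => n hn;
   rewrite fact_Factorial; apply: hN.
Qed.

Lemma Cexp_series (z : C) : Cps (fun k => RtoC (/ INR k`!)) z (Cexp z).
Proof.
rewrite /Cps /Clim; apply: (lim0_le (v := fun n => exp (Rabs (Re z)) * ((2 * Cmod z) ^ n / INR n`!))).
  move=> n; split; first exact: Cmod_ge_0.
  have := @Cexp_Taylor_bound z n 1; rewrite Rmult_1_r Cmod_sub_sym.
  rewrite (_ : 1 * z = z)%C; last ring.
  rewrite (@csum_ext (fun k => Cpow z k * _)%C (fun k => RtoC (/ INR k`!) * Cpow z k)%C).
    by apply; lra.
  by move=> k _; rewrite pow1 Cmult_comm; congr (RtoC _ * _)%C; rewrite /Rdiv Rmult_1_l.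
apply: lim_scal0; exact: lim_pow_fact.
Qed.

Lemma Cps_shift c z l : Cps c z l ->
  Cps (fun k => if k is j.+1 then c j else RtoC 0) z (z * l).
Proof.
move=> h; apply/Clim_S.
apply: Clim_ext (Clim_scal z h) => n.
rewrite csum_recl -csum_scal.
rewrite (@csum_ext (fun k => z * (c k * Cpow z k))%C (fun k => c k * Cpow z k.+1)%C).
  by ring.
by move=> k _; rewrite Cpow_S; ring.
Qed.

Lemma Cps_plus c d z l m : Cps c z l -> Cps d z m ->
  Cps (fun k => c k + d k)%C z (l + m).
Proof.
move=> h1 h2; apply: Clim_ext (Clim_plus h1 h2) => n.
by rewrite -csum_plus; apply: csum_ext => k _; ring.
Qed.

Lemma Cps_scal a c z l : Cps c z l -> Cps (fun k => a * c k)%C z (a * l).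
Proof.
move=> h; apply: Clim_ext (Clim_scal a h) => n.
by rewrite -csum_scal; apply: csum_ext => k _; ring.
Qed.

Lemma Cps_minus c d z l m : Cps c z l -> Cps d z m ->
  Cps (fun k => c k - d k)%C z (l - m).
Proof.
move=> h1 h2; apply: Clim_ext (Clim_minus h1 h2) => n.
by rewrite -csum_minus; apply: csum_ext => k _; ring.
Qed.

Lemma Cps_ext c d z l : (forall k, c k = d k) -> Cps c z l -> Cps d z l.
Proof. by move=> h; apply: Clim_ext => n; apply: csum_ext => k _; rewrite h. Qed.

Lemma Cps_0 z : Cps (fun _ => RtoC 0) z 0.
Proof.
apply: (Clim_ext (u := fun _ => RtoC 0)); last exact: Clim_const.
by elim=> //= n <-; ring.
Qed.

Lemma Cps_csum (c : nat -> nat -> C) z l m : (forall n, (n < m)%N -> Cps (c n) z (l n)) ->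
  Cps (fun k => csum (fun n => c n k) m) z (csum l m).
Proof.
elim: m => [|m IH] h; first exact: Cps_0.
apply: Cps_plus; last exact: h.
by apply: IH => n hn; apply: h; exact: ltnW.
Qed.

(** * Continuation of the Hurwitz zeta function *)

Fixpoint ffC (w : C) (j : nat) : C :=
  if j is i.+1 then (ffC w i * (w - RtoC (INR i)))%C else RtoC 1.

(* The j-th derivative in t of t ^ (1 - s). *)
Definition Pt (t : R) (j : nat) (s : C) : C :=
  (RtoC (/ t ^ j) * (ffC (1 - s) j * Cpower t (1 - s)))%C.

(* Its Taylor coefficients in s at a. *)
Fixpoint Acoef (a : C) (t : R) (j i : nat) : C :=
  if j is j'.+1 then
    (RtoC (/ t) * ((1 - a - RtoC (INR j')) * Acoef a t j' i
                   - (if i is i'.+1 then Acoef a t j' i' else RtoC 0)))%C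
  else (RtoC ((- ln t) ^ i / INR i`!) * Cpower t (1 - a))%C.

Lemma AcoefS a t j i : Acoef a t j.+1 i =
  (RtoC (/ t) * ((1 - a - RtoC (INR j)) * Acoef a t j i
                 - (if i is i'.+1 then Acoef a t j i' else RtoC 0)))%C.
Proof. by []. Qed.

(** One more derivative in t brings the factor [(1 - s - j) / t]. Its numerator is
    [(1 - a - j) - (s - a)], and multiplying by [s - a] shifts the coefficients; this is the
    recursion of [Acoef]. *)
Lemma Acoef_series a s t j : 0 < t -> Cps (Acoef a t j) (s - a) (Pt t j s).
Proof.
move=> ht; elim: j => [|j IH].
  have -> : Pt t 0 s = (Cpower t (1 - a) * Cexp ((s - a) * RtoC (- ln t)))%C.
    rewrite /Pt /Cpower -Cexp_plus /= Rinv_1 Cmult_1_l Cmult_1_l.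
    by congr Cexp; rewrite RtoC_opp; ring.
  apply: (Cps_ext (c := fun i => Cpower t (1 - a) * RtoC ((- ln t) ^ i / INR i`!))%C).
    by move=> i /=; rewrite Cmult_comm.
  apply: Cps_scal; apply: Clim_ext (Cexp_series ((s - a) * RtoC (- ln t))) => n.
  apply: csum_ext => i _.
  by rewrite Cpow_mult_l -RtoC_pow /Rdiv RtoC_mult; ring.
have -> : Pt t j.+1 s = (RtoC (/ t) * ((1 - a - RtoC (INR j)) * Pt t j s - (s - a) * Pt t j s))%C.
  rewrite /Pt [ffC _ j.+1]/= [t ^ j.+1]/= Rinv_mult RtoC_mult; ring.
apply: Cps_scal; apply: Cps_minus; first exact: Cps_scal.
exact: Cps_shift.
Qed.

Definition Cder (f : R -> C) (t : R) (l : C) : Prop :=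
  is_derive (fun u => Re (f u)) t (Re l) /\ is_derive (fun u => Im (f u)) t (Im l).

Lemma Cder_minus f g t l m : Cder f t l -> Cder g t m ->
  Cder (fun u => f u - g u)%C t (l - m).
Proof. by move=> [h1 h2] [h3 h4]; split; apply: derive_minus. Qed.

Lemma Cder_scal c f t l : Cder f t l -> Cder (fun u => c * f u)%C t (c * l).
Proof.
move=> [h1 h2]; split.
  exact: (derive_minus (derive_scal (Re c) h1) (derive_scal (Im c) h2)).
exact: (derive_plus (derive_scal (Re c) h2) (derive_scal (Im c) h1)).
Qed.

Lemma derive_mult (f g : R -> R) (x df dg : R) :
  is_derive f x df -> is_derive g x dg ->
  is_derive (fun t => f t * g t) x (df * g x + f x * dg).
Proof.
move=> hf hg; apply: (@is_derive_mult R_AbsRing f g x df dg) => //.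
by move=> n m; rewrite /mult /= Rmult_comm.
Qed.

Lemma Re_mulR (r : R) z : Re (RtoC r * z)%C = r * Re z.
Proof. by case: z => a b /=; ring. Qed.
Lemma Im_mulR (r : R) z : Im (RtoC r * z)%C = r * Im z.
Proof. by case: z => a b /=; ring. Qed.

Lemma Cder_mulR (r : R -> R) (r' : R) f t l : is_derive r t r' -> Cder f t l ->
  Cder (fun u => RtoC (r u) * f u)%C t (RtoC r' * f t + RtoC (r t) * l).
Proof.
move=> hr [h1 h2]; split.
  apply: (derive_ext (f := fun u => r u * Re (f u))) => [u|]; first by rewrite Re_mulR.
  have -> : Re (RtoC r' * f t + RtoC (r t) * l)%C = r' * Re (f t) + r t * Re l.
    by rewrite -!Re_mulR.
  exact: derive_mult.
apply: (derive_ext (f := fun u => r u * Im (f u))) => [u|]; first by rewrite Im_mulR.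
have -> : Im (RtoC r' * f t + RtoC (r t) * l)%C = r' * Im (f t) + r t * Im l.
  by rewrite -!Im_mulR.
exact: derive_mult.
Qed.

Lemma Cder_eq f t l m : l = m -> Cder f t l -> Cder f t m.
Proof. by move=> ->. Qed.

Lemma derive_eq (f : R -> R) (t l m : R) : l = m -> is_derive f t l -> is_derive f t m.
Proof. by move=> ->. Qed.

Lemma Cder_0 t : Cder (fun _ => RtoC 0) t 0.
Proof. by split; exact: derive_const. Qed.

Lemma Cder_Cpower w t : 0 < t -> Cder (fun u => Cpower u w) t (RtoC (/ t) * (w * Cpower t w)).
Proof.
case: w => a b ht; split; rewrite /Cpower /Cexp /=; auto_derive => //; rewrite /Rminus; ring.
Qed.

Lemma derive_lnpow i t : 0 < t -> is_derive (fun u => (- ln u) ^ i / INR i`!) t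
  (- / t * (if i is i'.+1 then (- ln t) ^ i' / INR i'`! else 0)).
Proof.
move=> ht; case: i => [|i].
  by rewrite Rmult_0_r /=; exact: derive_const.
have h := @is_derive_comp R_AbsRing R_NormedModule (fun v => v ^ i.+1 / INR (i.+1)`!) (fun u => - ln u) t _ _
  (derive_pow_fact i (- ln t)).
apply: h; by auto_derive => //; ring.
Qed.

(** Proved from the recursion itself, which avoids differentiating the series in t term by term. *)
Lemma Acoef_derive a t j i : 0 < t ->
  Cder (fun u => Acoef a u j i) t (Acoef a t j.+1 i).
Proof.
move=> ht; elim: j i => [|j IH] i.
  apply: Cder_eq (Cder_mulR (derive_lnpow i ht) (Cder_Cpower (1 - a) ht)).
  case: i => [|i] /=; rewrite ?RtoC_mult ?RtoC_opp; ring.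
have dinv : is_derive (fun u => / u) t (- / t * / t).
  by auto_derive; [lra | rewrite /=; field; lra].
have H : Cder (fun u => (1 - a - RtoC (INR j)) * Acoef a u j i
      - (if i is i'.+1 then Acoef a u j i' else RtoC 0))%C t
   ((1 - a - RtoC (INR j)) * Acoef a t j.+1 i
      - (if i is i'.+1 then Acoef a t j.+1 i' else RtoC 0))%C.
  apply: Cder_minus; first exact: Cder_scal (IH i).
  case: (i) => [|i']; [exact: Cder_0 | exact: IH].
apply: Cder_eq (Cder_mulR dinv H).
rewrite (AcoefS a t j.+1 i) S_INR RtoC_plus RtoC_mult RtoC_opp.
have -> : ((1 - a - RtoC (INR j)) * Acoef a t j i - (if i is i'.+1 then Acoef a t j i' else RtoC 0))%C
    = (RtoC t * Acoef a t j.+1 i)%C.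
  rewrite AcoefS RtoC_inv; last lra.
  field; move=> /RtoC_inj; lra.
rewrite RtoC_inv; last lra.
case: (i) => [|i']; field; move=> /RtoC_inj; lra.
Qed.

Lemma INR_ge1 n : 1 <= INR n.+1.
Proof. by rewrite S_INR; have := pos_INR n; lra. Qed.

Lemma ln_ge0 x : 1 <= x -> 0 <= ln x.
Proof.
move=> h; rewrite -ln_1; case: (Rle_lt_or_eq_dec _ _ h) => [h'|<-]; last lra.
by apply: Rlt_le; apply: ln_increasing; lra.
Qed.

Lemma exp_le x y : x <= y -> exp x <= exp y.
Proof.
move=> h; case: (Rle_lt_or_eq_dec _ _ h) => [h'|<-]; last lra.
by apply: Rlt_le; apply: exp_increasing; lra.
Qed.

Lemma exp_partial x m : 0 <= x -> rsum (fun i => x ^ i / INR i`!) m <= exp x.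
Proof.
move=> hx.
have hl : is_lim_seq (rsum (fun i => x ^ i / INR i`!)) (exp x).
  apply/lim_rsum; have := is_exp_Reals x; rewrite /is_pseries.
  apply: is_series_ext => n.
  by rewrite pow_n_pow /scal /= /mult /= fact_Factorial /Rdiv.
apply: (is_lim_seq_incr_compare (rsum _) _ hl) => n /=.
have : 0 <= x ^ n / INR n`!.
  apply: Rmult_le_pos; first exact: pow_le.
  by apply: Rlt_le; apply: Rinv_0_lt_compat; apply: lt_0_INR; apply/ltP; exact: fact_gt0.
lra.
Qed.

(** [V] dominates the coefficients uniformly on a unit interval, and its generating sum is taken at
    1/2, the radius of the disc in s on which convergence is wanted. Each derivative in t gains a
    factor [/ INR n.+1]. *)
Lemma Acoef_bound_aux (a : C) (j : nat) : exists Cst, forall n, exists V : nat -> R,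
  (forall t, INR n.+1 <= t <= INR n.+1 + 1 -> forall i, Cmod (Acoef a t j i) <= V i) /\
  (forall m, rsum (fun i => V i * (1/2) ^ i) m <=
             Cst * (/ INR n.+1 ^ j * Rpower (INR n.+1) (3 / 2 - Re a))).
Proof.
elim: j => [|j [Cst IH]].
  exists (exp (Rabs (1 - Re a) * ln 2) * exp (ln 2 / 2)) => n.
  set v := INR n.+1; have hv : 1 <= v by exact: INR_ge1.
  pose l := ln (2 * v).
  have el : l = ln 2 + ln v by rewrite /l ln_mult; lra.
  have hlv : 0 <= ln v by exact: ln_ge0.
  have hl2 : 0 <= ln 2 by apply: ln_ge0; lra.
  pose C0 := exp (Rabs (1 - Re a) * ln 2) * Rpower v (1 - Re a).
  have hC0 : 0 < C0 by apply: Rmult_lt_0_compat; exact: exp_pos.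
  (* Since [v <= t <= v + 1 <= 2 * v], the logarithm of [t] is at most [l], and
     [exp (Rabs (1 - Re a) * ln 2)] absorbs the ratio [t / v]. The sum at 1/2 is then at most
     [C0 * exp (l / 2)], that is [C0] times the square root of [2 * v]: hence the exponent 3/2 in
     place of 1. *)
  exists (fun i => C0 * (l ^ i / INR i`!)); split.
    move=> t ht i; rewrite /= Cmod_mult Cmod_R /Cpower Cmod_Cexp.
    have hif : 0 < / INR i`! by apply: Rinv_0_lt_compat; apply: lt_0_INR; apply/ltP; exact: fact_gt0.
    have hlt : ln v <= ln t by apply: ln_le; lra.
    have hlt2 : ln t <= l by apply: ln_le; lra.
    rewrite Rmult_comm; apply: Rmult_le_compat.
    - exact: Rlt_le (exp_pos _).
    - exact: Rabs_pos.
    - rewrite /C0 /Rpower -exp_plus; apply: exp_le.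
      have -> : Re ((1 - a) * RtoC (ln t))%C = (1 - Re a) * ln t.
        by case: (a) => a1 a2 /=; ring.
      have -> : (1 - Re a) * ln t = (1 - Re a) * (ln t - ln v) + (1 - Re a) * ln v by ring.
      apply: Rplus_le_compat_r.
      apply: Rle_trans (Rle_abs _) _; rewrite Rabs_mult.
      apply: Rmult_le_compat_l; first exact: Rabs_pos.
      rewrite Rabs_pos_eq; lra.
    - rewrite Rabs_mult (Rabs_pos_eq (/ _)); last lra.
      apply: Rmult_le_compat_r; first lra.
      rewrite -RPow_abs Rabs_Ropp Rabs_pos_eq; last lra.
      by apply: pow_incr; lra.
  move=> m.
  rewrite (@rsum_ext _ (fun i => C0 * ((l / 2) ^ i / INR i`!))); last first.
    move=> i _; rewrite /Rdiv Rmult_1_l Rpow_mult_distr; ring.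
  rewrite rsum_scal.
  have h : rsum (fun i => (l / 2) ^ i / INR i`!) m <= exp (l / 2) by apply: exp_partial; lra.
  apply: Rle_trans (Rmult_le_compat_l _ _ _ (Rlt_le _ _ hC0) h) _.
  rewrite /= Rinv_1 Rmult_1_l /C0 Rmult_assoc Rmult_assoc.
  apply: Rmult_le_compat_l; first exact: Rlt_le (exp_pos _).
  rewrite /Rpower -!exp_plus; apply: exp_le; rewrite el; lra.
exists ((Cmod (1 - a) + INR j + 1 / 2) * Cst) => n.
have [V [h1 h2]] := IH n.
set v := INR n.+1 in h1 h2 *; have hv : 1 <= v by exact: INR_ge1.
have hiv : 0 < / v by apply: Rinv_0_lt_compat; lra.
have hj := pos_INR j.
exists (fun i => / v * ((Cmod (1 - a) + INR j) * V i + (if i is i'.+1 then V i' else 0))).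
have hV i : 0 <= V i by apply: Rle_trans (Cmod_ge_0 _) (h1 v _ i); lra.
split.
  move=> t ht i; rewrite AcoefS Cmod_mult Cmod_R Rabs_pos_eq; last first.
    by apply: Rlt_le; apply: Rinv_0_lt_compat; lra.
  apply: Rmult_le_compat.
  - by apply: Rlt_le; apply: Rinv_0_lt_compat; lra.
  - exact: Cmod_ge_0.
  - by apply: Rinv_le_contravar; lra.
  apply: Rle_trans (Cmod_triangle _ _) _; rewrite Cmod_opp Cmod_mult.
  apply: Rplus_le_compat; last by case: (i) => [|i']; [rewrite Cmod_0; lra | exact: h1].
  apply: Rmult_le_compat; try exact: Cmod_ge_0; last exact: h1.
  apply: Rle_trans (Cmod_triangle _ _) _; rewrite Cmod_opp Cmod_R Rabs_pos_eq //; lra.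
move=> m.
have hs : rsum (fun i => (if i is i'.+1 then V i' else 0) * (1 / 2) ^ i) m <=
          1 / 2 * rsum (fun i => V i * (1 / 2) ^ i) m.
  case: m => [|m]; first by rewrite /=; lra.
  rewrite rsum_recl -rsum_scal /= Rmult_0_l Rplus_0_l.
  rewrite (@rsum_ext _ (fun i => 1 / 2 * (V i * (1 / 2) ^ i))); last by move=> i _; ring.
  have := hV m; have : 0 < (1 / 2) ^ m by apply: pow_lt; lra.
  move=> hp hVm; have := Rmult_le_pos _ _ hVm (Rlt_le _ _ hp); lra.
have e : rsum (fun i => / v * ((Cmod (1 - a) + INR j) * V i + (if i is i'.+1 then V i' else 0)) * (1 / 2) ^ i) m
  = / v * ((Cmod (1 - a) + INR j) * rsum (fun i => V i * (1 / 2) ^ i) m +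
     rsum (fun i => (if i is i'.+1 then V i' else 0) * (1 / 2) ^ i) m).
  rewrite -rsum_scal -rsum_plus -rsum_scal; apply: rsum_ext => i _; ring.
rewrite e.
have hL : 0 <= Cmod (1 - a) + INR j + 1 / 2 by have := Cmod_ge_0 (1 - a); lra.
have hsm := h2 m; set s := rsum (fun i => V i * (1 / 2) ^ i) m in hs hsm *.
apply: (Rle_trans _ (/ v * ((Cmod (1 - a) + INR j + 1 / 2) * s))).
  apply: Rmult_le_compat_l; lra.
rewrite [v ^ _]/= Rinv_mult.
have := Rmult_le_compat_l _ _ _ (Rlt_le _ _ hiv) (Rmult_le_compat_l _ _ _ hL hsm); lra.
Qed.

(** The disc of radius 1/2 costs half a power and the [K + 1] derivatives gain [K + 1] powers. Under
    [2 <= INR K + Re a] the exponent [3/2 - Re a - (K + 1)] is at most -3/2, which is summable. *)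
Lemma Acoef_bound (a : C) (K : nat) : 2 <= INR K + Re a ->
  exists Cst, forall n, exists V : nat -> R,
  (forall t, INR n.+1 <= t <= INR n.+1 + 1 -> forall i, Cmod (Acoef a t K.+1 i) <= V i) /\
  (forall m, rsum (fun i => V i * (1/2) ^ i) m <= Cst * Rpower (INR n.+1) (- (3 / 2))).
Proof.
move=> hK; have [Cst H] := Acoef_bound_aux a K.+1.
exists (Rmax Cst 0) => n; have [V [h1 h2]] := H n; exists V; split=> // m.
apply: Rle_trans (h2 m) _.
have hv : 1 <= INR n.+1 by exact: INR_ge1.
have -> : / INR n.+1 ^ K.+1 = Rpower (INR n.+1) (- INR K.+1).
  by rewrite Rpower_Ropp Rpower_pow //; lra.
rewrite -Rpower_plus.
apply: (Rle_trans _ (Rmax Cst 0 * Rpower (INR n.+1) (- INR K.+1 + (3 / 2 - Re a)))).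
  by apply: Rmult_le_compat_r; [exact: Rlt_le (exp_pos _) | exact: Rmax_l].
apply: Rmult_le_compat_l; first exact: Rmax_r.
apply: exp_le; apply: Rmult_le_compat_r; first exact: ln_ge0.
rewrite S_INR; lra.
Qed.

(* The partial sum of Psi'(n + x), n < M, minus its Euler-Maclaurin
   asymptotics of order K; Psi k stands for the k-th derivative of Psi. *)
Definition EM_partial (K : nat) (x : R) (Psi : nat -> R -> C) (M : nat) : C :=
  (csum (fun n => Psi 1%N (Rplus (INR n) x)) M
   - csum (fun k => RtoC (beta k x) * Psi k (INR M)) K)%C.

Definition EMC (K : nat) (Phi : nat -> R -> C) (x : R) : C :=
  (Phi 1%N x - csum (fun k => RtoC (beta k x) * (Phi k 1 - Phi k 0)) K)%C.

(** The Euler-Maclaurin remainder on one unit interval is an increment in [M], so bounds on the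
    remainders yield convergence by summation. *)
Lemma EM_partial_S K x Psi M :
  (EM_partial K x Psi M.+1 - EM_partial K x Psi M)%C = EMC K (fun k t => Psi k (INR M + t)) x.
Proof.
rewrite /EM_partial /EMC -[csum _ M.+1]/(csum (fun n => Psi 1%N (Rplus (INR n) x)) M + Psi 1%N (Rplus (INR M) x))%C.
rewrite (@csum_ext (fun k => RtoC (beta k x) * (Psi k (Rplus (INR M) 1) - Psi k (Rplus (INR M) 0)))%C
  (fun k => RtoC (beta k x) * Psi k (INR M.+1) - RtoC (beta k x) * Psi k (INR M))%C).
  by rewrite csum_minus; ring.
by move=> k _; rewrite S_INR Rplus_0_r; ring.
Qed.

Lemma Re_EMC K Phi x : Re (EMC K Phi x) = EM K (fun k t => Re (Phi k t)) x.
Proof.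
rewrite /EMC /EM -[Re (_ - _)%C]/(Re _ - Re _) Re_csum; congr (_ - _).
by apply: rsum_ext => k _; rewrite Re_mulR.
Qed.
Lemma Im_EMC K Phi x : Im (EMC K Phi x) = EM K (fun k t => Im (Phi k t)) x.
Proof.
rewrite /EMC /EM -[Im (_ - _)%C]/(Im _ - Im _) Im_csum; congr (_ - _).
by apply: rsum_ext => k _; rewrite Im_mulR.
Qed.

Lemma EMC_bound K (Phi : nat -> R -> C) B x :
  (forall k t, 0 <= t <= 1 -> Cder (Phi k) t (Phi k.+1 t)) ->
  (forall t, 0 <= t <= 1 -> Cmod (Phi K.+1 t) <= B) ->
  0 <= x <= 1 -> Cmod (EMC K Phi x) <= 2 * B.
Proof.
move=> hd hB hx; apply: Rle_trans (Cmod_le_abs _) _; rewrite Re_EMC Im_EMC.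
have h1 : Rabs (EM K (fun k t => Re (Phi k t)) x) <= B.
  apply: EM_bound => // [k t ht|t ht]; first exact: (hd k t ht).1.
  exact: Rle_trans (re_le_Cmod _) (hB t ht).
have h2 : Rabs (EM K (fun k t => Im (Phi k t)) x) <= B.
  apply: EM_bound => // [k t ht|t ht]; first exact: (hd k t ht).2.
  exact: Rle_trans (Im_le_Cmod _) (hB t ht).
lra.
Qed.

Lemma derive_shift (f : R -> R) (v t l : R) : is_derive f (v + t) l ->
  is_derive (fun u => f (v + u)) t l.
Proof.
move=> h.
have h2 : is_derive (fun u : R => v + u) t 1 by auto_derive.
have := @is_derive_comp R_AbsRing R_NormedModule f (fun u => v + u) t l 1 h h2.
by rewrite /scal /= /mult /= Rmult_1_l.
Qed.

Lemma Cder_shift (f : R -> C) v t l : Cder f (v + t) l ->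
  Cder (fun u => f (v + u)) t l.
Proof.
by move=> [h1 h2]; split; [exact: (derive_shift (f := fun t => Re (f t))) |
  exact: (derive_shift (f := fun t => Im (f t)))].
Qed.

Lemma csum_telescope (u : nat -> C) n :
  csum (fun k => u k.+1 - u k)%C n = (u n - u 0%N)%C.
Proof. by elim: n => /= [|n ->]; ring. Qed.

Lemma EM_partial_series K x a s M : 0 < x -> (0 < M)%N ->
  Cps (fun i => EM_partial K x (fun k t => Acoef a t k i) M) (s - a)
      (EM_partial K x (fun k t => Pt t k s) M).
Proof.
move=> hx hM; apply: (Cps_minus (c := fun i => csum (fun n => Acoef a (Rplus (INR n) x) 1 i) M)
  (d := fun i => csum (fun k => RtoC (beta k x) * Acoef a (INR M) k i)%C K)).
  apply: (Cps_csum (c := fun n i => Acoef a (Rplus (INR n) x) 1 i)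
    (l := fun n => Pt (Rplus (INR n) x) 1 s)) => n _.
  by apply: Acoef_series; have := pos_INR n; lra.
apply: (Cps_csum (c := fun n i => (RtoC (beta n x) * Acoef a (INR M) n i)%C)
   (l := fun n => (RtoC (beta n x) * Pt (INR M) n s)%C)) => n _.
by apply: Cps_scal; apply: Acoef_series; apply: lt_0_INR; apply/ltP.
Qed.

(** The increments in [M], expanded in powers of [s - a], form a double array dominated by a
    summable sequence on the disc of radius 1/2. Summing it in both orders shows that the limit is
    the power series of the limit coefficients; this takes the place of the theorem on locally
    uniform limits of analytic functions. *)
Lemma EM_partial_analytic K x a : 0 < x <= 1 -> 2 <= INR K + Re a ->
  exists col : nat -> C,
    (forall i, Clim (EM_partial K x (fun k t => Acoef a t k i)) (col i)) /\
    forall s, Cmod (s - a) <= 1 / 2 ->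
      exists L, Clim (EM_partial K x (fun k t => Pt t k s)) L /\ Cps col (s - a) L.
Proof.
move=> hx hK; have [Cst HC] := Acoef_bound hK.
pose H i := EM_partial K x (fun k t => Acoef a t k i).
(* The increments start at [M = 1], since the asymptotic terms contain negative powers of
   [INR M]. *)
pose c n i := (H i n.+2 - H i n.+1)%C.
pose b n := 2 * (Cst * Rpower (INR n.+1) (- (3 / 2))).
have hb n m : rsum (fun i => Cmod (c n i) * (1 / 2) ^ i) m <= b n.
  have [V [h1 h2]] := HC n.
  apply: Rle_trans (Rmult_le_compat_l 2 _ _ ltac:(lra) (h2 m)).
  rewrite -rsum_scal; apply: rsum_le => i _.
  rewrite -Rmult_assoc; apply: Rmult_le_compat_r; first by apply: pow_le; lra.
  rewrite /c /H EM_partial_S; apply: EMC_bound; last lra.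
    move=> k t ht; apply: (Cder_shift (f := fun t => Acoef a t k i)).
    by apply: Acoef_derive; have := INR_ge1 n; lra.
  by move=> t ht; apply: h1; lra.
have hs : ex_series b.
  have h := ex_series_scal_l (2 * Cst) _ (@ex_series_Rpower (3 / 2) ltac:(lra)).
  by apply: ex_series_ext h => n; rewrite /b -Rmult_assoc.
have cc n i : csum (fun n => c n i) n = (H i n.+1 - H i 1%N)%C.
  by rewrite (csum_telescope (fun n => H i n.+1)).
have hcol i : exists l, Clim (csum (fun n => c n i)) l.
  (* The term of index [i] alone in [hb] bounds [c n i] by [2 ^ i * b n]. *)
  apply: (@csum_abs_conv _ (fun n => 2 ^ i * b n)); last exact: ex_series_scal_l.
  move=> n.
  have h1 : rsum (fun i => Cmod (c n i) * (1 / 2) ^ i) i + Cmod (c n i) * (1 / 2) ^ i <= b n by exact: (hb n i.+1).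
  have h0 : 0 <= rsum (fun i => Cmod (c n i) * (1 / 2) ^ i) i.
    by apply: rsum_ge0 => k _; apply: Rmult_le_pos; [exact: Cmod_ge_0 | apply: pow_le; lra].
  have h2 : Cmod (c n i) * (1 / 2) ^ i <= b n by lra.
  have h2i : 0 <= 2 ^ i by apply: pow_le; lra.
  have := Rmult_le_compat_l _ _ _ h2i h2.
  have -> : 2 ^ i * (Cmod (c n i) * (1 / 2) ^ i) = Cmod (c n i) * (2 * (1 / 2)) ^ i.
    by rewrite Rpow_mult_distr; ring.
  by rewrite (_ : 2 * (1 / 2) = 1); [rewrite pow1 Rmult_1_r | field].
have [d hd] : exists d : nat -> C, forall i, Clim (csum (fun n => c n i)) (d i).
  exact: (choice (fun i l => Clim (csum (fun n => c n i)) l) hcol).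
exists (fun i => H i 1%N + d i)%C; split.
  move=> i; apply/Clim_S.
  apply: Clim_ext (Clim_plus (Clim_const (H i 1%N)) (hd i)) => n.
  by rewrite cc /H; ring.
move=> s hsa; set z := (s - a)%C in hsa *.
pose T M := EM_partial K x (fun k t => Pt t k s) M.
have hT M : Cps (fun i => H i M.+1) z (T M.+1) by apply: EM_partial_series; lra || lia.
have [||n|k|S [hS1 hS2]] := @double_series (fun n i => c n i * Cpow z i)%C b
   (fun n => T n.+2 - T n.+1)%C (fun i => d i * Cpow z i)%C.
- move=> n m; apply: Rle_trans (hb n m); apply: rsum_le => i _.
  rewrite Cmod_mult Cmod_pow; apply: Rmult_le_compat_l; first exact: Cmod_ge_0.
  by apply: pow_incr; split; [exact: Cmod_ge_0 | lra].
- exact: hs.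
- exact: (Cps_minus (hT n.+1) (hT n)).
- apply: (Clim_ext (u := fun n => Cpow z k * csum (fun n => c n k) n)%C).
    by move=> n; rewrite -csum_scal; apply: csum_ext => i _; ring.
  by rewrite Cmult_comm; exact: Clim_scal.
exists (T 1%N + S)%C; split.
  apply/Clim_S; apply: Clim_ext (Clim_plus (Clim_const (T 1%N)) hS1) => n.
  by rewrite (csum_telescope (fun n => T n.+1)) /T; ring.
exact: (Cps_plus (hT 0%N)).
Qed.

Lemma lim_Rpower_0 q : 0 < q -> is_lim_seq (fun n => Rpower (INR n) (- q)) 0.
Proof.
move=> hq; rewrite /Rpower.
apply: (is_lim_comp_seq exp (fun n => - q * ln (INR n)) m_infty 0).
- exact: is_lim_exp_m.
- by exists 0%N.
have h : is_lim_seq (fun n => ln (INR n)) p_infty.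
  apply: (is_lim_comp_seq ln INR p_infty p_infty); [exact: is_lim_ln_p | by exists 0%N | exact: is_lim_seq_INR].
have hm := is_lim_seq_scal_l _ (- q) _ h.
suff <- : Rbar_mult (- q) p_infty = m_infty by [].
by apply: is_Rbar_mult_unique; apply: is_Rbar_mult_sym; apply: is_Rbar_mult_p_infty_neg => /=; lra.
Qed.

Lemma Cmod_Pt t k s : 0 < t ->
  Cmod (Pt t k s) = Cmod (ffC (1 - s) k) * Rpower t (- (INR k + Re s - 1)).
Proof.
move=> ht; rewrite /Pt !Cmod_mult Cmod_R Rabs_pos_eq; last first.
  by apply: Rlt_le; apply: Rinv_0_lt_compat; apply: pow_lt.
rewrite /Cpower Cmod_Cexp.
have -> : / t ^ k = Rpower t (- INR k) by rewrite Rpower_Ropp Rpower_pow.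
have -> : exp (Re ((1 - s) * RtoC (ln t))%C) = Rpower t (1 - Re s).
  by rewrite /Rpower; congr exp; case: (s) => a b /=; ring.
rewrite -Rmult_assoc (Rmult_comm (Rpower _ _)) Rmult_assoc -Rpower_plus.
by congr (_ * Rpower _ _); ring.
Qed.

Lemma csumS f K : csum f K.+1 = (csum f K + f K)%C.
Proof. by []. Qed.

(** The two expressions differ by the term of index [K], which is of size [M ^ (1 - K - Re s)]. *)
Lemma EM_partial_step K x s : 1 < INR K + Re s ->
  Clim (fun M => EM_partial K x (fun k t => Pt t k s) M - EM_partial K.+1 x (fun k t => Pt t k s) M)%C 0.
Proof.
move=> hK.
have hl : is_lim_seq (fun M => Rabs (beta K x) * Cmod (ffC (1 - s) K) * Rpower (INR M) (- (INR K + Re s - 1))) 0.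
  by apply: lim_scal0; apply: lim_Rpower_0; lra.
apply/Clim_S; move/is_lim_seq_incr_1: hl => hl; rewrite /Clim; apply: lim0_le hl => M.
split; first exact: Cmod_ge_0.
rewrite /EM_partial (csumS _ K).
set u := csum _ _; set v := csum _ K; set w := (RtoC _ * _)%C.
have -> : (u - v - (u - (v + w)) - 0 = w)%C by ring.
rewrite /w Cmod_mult Cmod_R Cmod_Pt; last by have := INR_ge1 M; lra.
lra.
Qed.

Lemma archi_nat (y : R) : exists K : nat, y <= INR K.
Proof.
have [K hK] := INR_unbounded y; exists K; lra.
Qed.

(* hz x s = (1 - s) * zeta(s, x), an entire function of s. *)
Definition hz (x : R) (s : C) : C :=
  epsilon (inhabits (RtoC 0)) (fun L => exists K : nat, 1 < INR K + Re s /\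
    Clim (EM_partial K x (fun k t => Pt t k s)) L).

Lemma EM_partial_lim_S K x s L : 1 < INR K + Re s ->
  Clim (EM_partial K x (fun k t => Pt t k s)) L <-> Clim (EM_partial K.+1 x (fun k t => Pt t k s)) L.
Proof.
move=> hK; have h := EM_partial_step x hK; split=> hL.
  have := Clim_minus hL h; rewrite (_ : L - 0 = L)%C; last ring.
  by apply: Clim_ext => n; ring.
have := Clim_plus hL h; rewrite (_ : L + 0 = L)%C; last ring.
by apply: Clim_ext => n; ring.
Qed.

Lemma EM_partial_lim_add K j x s L : 1 < INR K + Re s ->
  Clim (EM_partial K x (fun k t => Pt t k s)) L <-> Clim (EM_partial (K + j) x (fun k t => Pt t k s)) L.
Proof.
move=> hK; elim: j => [|j IH]; first by rewrite addn0.
rewrite IH addnS; apply: EM_partial_lim_S.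
have : INR (K + j) = INR K + INR j by exact: plus_INR.
have := pos_INR j; lra.
Qed.

(** Both orders can be raised to [K + K']. This makes the value chosen in [hz] independent of the
    order. *)
Lemma EM_partial_lim_any K K' x s L : 1 < INR K + Re s -> 1 < INR K' + Re s ->
  Clim (EM_partial K x (fun k t => Pt t k s)) L -> Clim (EM_partial K' x (fun k t => Pt t k s)) L.
Proof.
move=> h1 h2; rewrite (EM_partial_lim_add K' x L h1) addnC.
by rewrite -(EM_partial_lim_add K x L h2).
Qed.

Lemma hz_spec x s K : 0 < x <= 1 -> 1 < INR K + Re s ->
  Clim (EM_partial K x (fun k t => Pt t k s)) (hz x s).
Proof.
move=> hx hK.
have [K1 hK1] := archi_nat (2 - Re s).
have [|col [_ H]] := @EM_partial_analytic K1 x s hx; first lra.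
have [|L [hL _]] := H s.
  by rewrite (_ : s - s = 0)%C; [rewrite Cmod_0; lra | ring].
have [|K2 [h2 hL2]] := epsilon_spec (inhabits (RtoC 0)) (fun L => exists K : nat, 1 < INR K + Re s /\
    Clim (EM_partial K x (fun k t => Pt t k s)) L).
  by exists L, K1; split=> //; lra.
exact: EM_partial_lim_any h2 hK hL2.
Qed.

Lemma hz_analytic x a K : 0 < x <= 1 -> 2 <= INR K + Re a ->
  exists col : nat -> C,
    (forall i, Clim (EM_partial K x (fun k t => Acoef a t k i)) (col i)) /\
    forall s, Cmod (s - a) <= 1 / 2 -> Cps col (s - a) (hz x s).
Proof.
move=> hx hK; have [col [h1 h2]] := EM_partial_analytic hx hK.
exists col; split=> // s hs; have [L [hL1 hL2]] := h2 s hs.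
suff -> : hz x s = L by [].
apply: Clim_unique hL1; apply: hz_spec => //.
have := Rle_trans _ _ _ (re_le_Cmod (s - a)) hs.
rewrite (_ : Re (s - a)%C = Re s - Re a) // => h.
have := Rabs_def2 _ _ (Rle_lt_trans _ _ (3 / 4) h ltac:(lra)); lra.
Qed.

(** * Operations on analytic functions through their power series *)

Lemma Cps_at0 c l : Cps c 0 l -> l = c 0%N.
Proof.
move=> h; apply: (Clim_unique h); apply/Clim_S.
apply: (Clim_ext (u := fun _ => c 0%N)); last exact: Clim_const.
move=> n; rewrite csum_recl (_ : csum _ n = RtoC 0); first by rewrite /=; ring.
by elim: n => //= n ->; ring.
Qed.

(** The derivative is carried as the Taylor coefficient of index 1, so that sums, translates and
    quotients are treated on coefficients alone; [an_deriv_C_derive] converts the result. *)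
Definition an_deriv (f : C -> C) (a v : C) : Prop :=
  exists (c : nat -> C) (r : R), 0 < r /\ c 1%N = v /\
    forall s, Cmod (s - a) < r -> Cps c (s - a) (f s).

Lemma an_deriv_plus f g a v w : an_deriv f a v -> an_deriv g a w -> an_deriv (fun s => f s + g s)%C a (v + w).
Proof.
move=> [c [r [hr [<- h]]]] [d [r' [hr' [<- h']]]]; exists (fun k => c k + d k)%C, (Rmin r r').
split; first exact: Rmin_pos.
split=> // s hs; apply: Cps_plus; [apply: h | apply: h'].
  exact: Rlt_le_trans hs (Rmin_l _ _).
exact: Rlt_le_trans hs (Rmin_r _ _).
Qed.

Lemma an_deriv_scal b f a v : an_deriv f a v -> an_deriv (fun s => b * f s)%C a (b * v).
Proof.
move=> [c [r [hr [<- h]]]]; exists (fun k => b * c k)%C, r; split=> //; split=> // s hs.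
by apply: Cps_scal; exact: h.
Qed.

Lemma an_deriv_ext f g a v : (forall s, f s = g s) -> an_deriv f a v -> an_deriv g a v.
Proof.
move=> e [c [r [hr [<- h]]]]; exists c, r; split=> //; split=> // s hs; rewrite -e; exact: h.
Qed.

Lemma an_deriv_translate f a b v : an_deriv f (a - b) v -> an_deriv (fun s => f (s - b)%C) a v.
Proof.
move=> [c [r [hr [<- h]]]]; exists c, r; split=> //; split=> // s.
rewrite (_ : s - a = s - b - (a - b))%C; last by ring.
exact: h.
Qed.

Lemma an_deriv_0 a : an_deriv (fun _ => RtoC 0) a 0.
Proof. by exists (fun _ => RtoC 0), 1; split; [lra | split=> // s _; exact: Cps_0]. Qed.

Lemma an_deriv_csum f a v n : (forall j, (j < n)%N -> an_deriv (f j) a (v j)) ->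
  an_deriv (fun s => csum (fun j => f j s) n) a (csum v n).
Proof.
elim: n => [|n IH] h /=; first exact: an_deriv_0.
by apply: an_deriv_plus; [apply: IH => j hj; apply: h; exact: ltnW | exact: h].
Qed.

Definition an_at (f : C -> C) (a : C) : Prop := exists v, an_deriv f a v.

Lemma an_atE f a : an_at f a <-> analytic_at f a.
Proof.
split=> [[v [c [r [hr [_ h]]]]] | [c [r [hr h]]]].
  by exists c, r; split=> // s hs; apply/Cps_pseries; exact: h.
by exists (c 1%N), c, r; do 2 split=> //; move=> s hs; apply/Cps_pseries; exact: h.
Qed.

Lemma an_plus f g a : an_at f a -> an_at g a -> an_at (fun s => f s + g s)%C a.
Proof. by move=> [v hv] [w hw]; exists (v + w)%C; exact: an_deriv_plus. Qed.

Lemma an_scal b f a : an_at f a -> an_at (fun s => b * f s)%C a.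
Proof. by move=> [v hv]; exists (b * v)%C; exact: an_deriv_scal. Qed.

Lemma an_ext f g a : (forall s, f s = g s) -> an_at f a -> an_at g a.
Proof. by move=> e [v hv]; exists v; exact: an_deriv_ext hv. Qed.

Lemma an_0 a : an_at (fun _ => RtoC 0) a.
Proof. by exists (RtoC 0); exact: an_deriv_0. Qed.

Lemma an_translate f a b : an_at f (a - b) -> an_at (fun s => f (s - b)%C) a.
Proof. by move=> [v hv]; exists v; exact: an_deriv_translate. Qed.

Lemma an_mul_sub f a b : an_at f a -> an_at (fun s => (s - b) * f s)%C a.
Proof.
move=> [_ [c [r [hr [_ h]]]]].
pose d k := ((if k is j.+1 then c j else RtoC 0) + (a - b) * c k)%C.
exists (d 1%N), d, r; do 2 split=> //; move=> s hs.
have -> : ((s - b) * f s = (s - a) * f s + (a - b) * f s)%C by ring.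
by apply: Cps_plus; [apply: Cps_shift; exact: h | apply: Cps_scal; exact: h].
Qed.

Lemma Cps_terms_bounded c z l : Cps c z l ->
  exists B, 0 <= B /\ forall k, Cmod (c k) * Cmod z ^ k <= B.
Proof.
move=> h.
have h2 : Clim (fun k => c k * Cpow z k)%C 0.
  rewrite (_ : RtoC 0 = l - l)%C; last ring.
  apply: Clim_ext (Clim_minus ((Clim_S _ _).2 h) h) => n /=; ring.
have [N hN] := (Clim_eps _ _).1 h2 1 Rlt_0_1.
have [B hB] : exists B, 0 <= B /\ forall k, (k < N)%N -> Cmod (c k) * Cmod z ^ k <= B.
  elim: (N) => [|n [B [B0 hB]]]; first by exists 0; split; [lra | ].
  exists (Rmax B (Cmod (c n) * Cmod z ^ n)); split; first exact: Rle_trans B0 (Rmax_l _ _).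
  move=> k; rewrite ltnS leq_eqVlt => /orP [/eqP -> | hk]; first exact: Rmax_r.
  exact: Rle_trans (hB k hk) (Rmax_l _ _).
exists (Rmax B 1); split; first exact: Rle_trans hB.1 (Rmax_l _ _).
move=> k; case: (ltnP k N) => hk; first exact: Rle_trans (hB.2 k hk) (Rmax_l _ _).
apply: Rle_trans (Rmax_r _ _); have := hN k hk.
rewrite (_ : _ - 0 = c k * Cpow z k)%C; last ring.
rewrite Cmod_mult Cmod_pow; lra.
Qed.

Lemma Cps_conv (e : nat -> C) r B z : 0 < r -> (forall k, Cmod (e k) * r ^ k <= B) ->
  Cmod z <= r / 2 -> exists l, Cps e z l.
Proof.
move=> hr hB hz'.
apply: (@csum_abs_conv _ (fun k => B * (/ 2) ^ k)).
  move=> k; rewrite Cmod_mult Cmod_pow.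
  apply: (Rle_trans _ (Cmod (e k) * (r / 2) ^ k)).
    apply: Rmult_le_compat_l; first exact: Cmod_ge_0.
    by apply: pow_incr; split=> //; exact: Cmod_ge_0.
  rewrite /Rdiv Rpow_mult_distr -Rmult_assoc; apply: Rmult_le_compat_r; last exact: hB.
  by apply: pow_le; lra.
apply: ex_series_scal_l; apply: ex_series_geom; rewrite Rabs_pos_eq; lra.
Qed.

(** With [d = w - a] the divisor is [d - (s - a)], so the coefficients of the quotient solve
    [d * e k = c k + e (k - 1)]. The explicit [e 1] is what later combines the two first Taylor
    coefficients of [hz] into a derivative of [zeta1]. *)
Lemma Cps_div f a w c r : a <> w -> 0 < r ->
  (forall s, Cmod (s - a) < r -> Cps c (s - a) (f s)) ->
  exists e r', [/\ 0 < r', e 1%N = (c 1%N / (w - a) + c 0%N / (w - a) / (w - a))%C &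
    forall s, Cmod (s - a) < r' -> Cps e (s - a) (f s / (w - s))%C].
Proof.
move=> haw hr h.
pose d := (w - a)%C.
have hd : d <> RtoC 0.
  by move=> hd; apply: haw; rewrite (_ : w = d + a)%C; [rewrite hd; ring | rewrite /d; ring].
have hmd : 0 < Cmod d by apply/Cmod_gt_0.
pose q := Rmin (r / 2) (Cmod d / 2).
have hq : 0 < q by apply: Rmin_pos; lra.
have hqr : q <= r / 2 by exact: Rmin_l.
have hqd : q <= Cmod d / 2 by exact: Rmin_r.
have [B [B0 hB]] : exists B, 0 <= B /\ forall k, Cmod (c k) * q ^ k <= B.
  have [|B [hB0 hB]] := @Cps_terms_bounded c (RtoC q) (f (a + RtoC q)%C).
    have := h (a + RtoC q)%C; rewrite (_ : a + RtoC q - a = RtoC q)%C; last ring.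
    by apply; rewrite Cmod_R Rabs_pos_eq; lra.
  by exists B; split=> // k; have := hB k; rewrite Cmod_R Rabs_pos_eq //; lra.
pose e := fix e k := (if k is j.+1 then (c k + e j) / d else c k / d)%C.
(* The fixed point of the recursion for the bound: [B + q * B' = Cmod d * B']. *)
pose B' := B / (Cmod d - q).
have hB' : B = B' * (Cmod d - q) by rewrite /B'; field; lra.
have hB'0 : 0 <= B' by apply: Rmult_le_pos => //; apply: Rlt_le; apply: Rinv_0_lt_compat; lra.
have he k : Cmod (e k) * q ^ k <= B'.
  apply: (Rmult_le_reg_l (Cmod d)) => //.
  elim: k => [|k IH].
    rewrite /= Cmod_div // Rmult_1_r.
    have -> : Cmod d * (Cmod (c 0%N) / Cmod d) = Cmod (c 0%N) by field; lra.
    have := hB 0%N; rewrite /= Rmult_1_r => hc; apply: Rle_trans hc _; nra.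
  rewrite -[e k.+1]/((c k.+1 + e k) / d)%C Cmod_div //.
  have -> : Cmod d * (Cmod (c k.+1 + e k) / Cmod d * q ^ k.+1) = Cmod (c k.+1 + e k) * q ^ k.+1.
    by field; lra.
  have hqk : 0 <= q ^ k.+1 by apply: pow_le; lra.
  apply: Rle_trans (Rmult_le_compat_r _ _ _ hqk (Cmod_triangle _ _)) _.
  rewrite Rmult_plus_distr_r.
  have h1 := hB k.+1.
  have h2 : Cmod (e k) * q ^ k.+1 <= q * B'.
    have -> : Cmod (e k) * q ^ k.+1 = q * (Cmod (e k) * q ^ k) by rewrite /=; ring.
    apply: Rmult_le_compat_l; first lra.
    exact: Rmult_le_reg_l hmd IH.
  nra.
exists e, (q / 2); split; first lra.
  by rewrite /= -/d; field.
move=> s hs; set z := (s - a)%C in hs *.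
have [l hl] := Cps_conv hq he (Rlt_le _ _ hs).
have hc : Cps c z (f s) by apply: h; rewrite -/z; lra.
have hc' : Cps c z (d * l - z * l).
  apply: (Cps_ext (c := fun k => d * e k - (if k is j.+1 then e j else RtoC 0))%C).
    by case=> [|k] /=; field.
  by apply: Cps_minus; [exact: Cps_scal | exact: Cps_shift].
have hfl := Clim_unique hc hc'.
have hws : (w - s <> RtoC 0)%C.
  move=> e0; have : d = z.
    by rewrite /d /z (_ : w = w - s + s)%C; [rewrite e0; ring | ring].
  move=> edz; move: hs; rewrite -edz; lra.
suff -> : (f s / (w - s) = l)%C by [].
by rewrite hfl (_ : d * l - z * l = l * (w - s))%C; [field | rewrite /d /z; ring].
Qed.

Lemma an_div f a w : a <> w -> an_at f a -> an_at (fun s => f s / (w - s))%C a.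
Proof.
move=> haw [_ [c [r [hr [_ h]]]]]; have [e [r' [hr' _ h']]] := Cps_div haw hr h.
by exists (e 1%N), e, r'.
Qed.

Lemma hz_an_at x a : 0 < x <= 1 -> an_at (hz x) a.
Proof.
move=> hx; have [K hK] := archi_nat (2 - Re a).
have [|c [_ h]] := @hz_analytic x a K hx; first lra.
by exists (c 1%N), c, (1 / 2); split; [lra | split=> // s hs; apply: h; lra].
Qed.

Lemma Cpower_0 t : Cpower t 0 = RtoC 1.
Proof.
by rewrite /Cpower Cmult_0_l /Cexp /= exp_0 cos_0 sin_0 Rmult_1_l Rmult_0_r.
Qed.

Lemma Cpower_S t z : 0 < t -> Cpower t (1 + z) = (RtoC t * Cpower t z)%C.
Proof.
move=> ht; rewrite /Cpower Cmult_plus_distr_r Cexp_plus; congr (_ * _)%C.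
by rewrite Cmult_1_l /Cexp /= cos_0 sin_0 exp_ln // Rmult_1_r Rmult_0_r.
Qed.

Lemma Pt_1 t s : 0 < t -> Pt t 1 s = ((1 - s) * Cpower t (- s))%C.
Proof.
move=> ht; rewrite /Pt /= Rmult_1_r (_ : 1 - s = 1 + - s)%C; last ring.
rewrite Cpower_S // RtoC_inv; last lra.
field; move=> /RtoC_inj; lra.
Qed.

(** At [s = 1] every summand carries the factor [1 - s = 0], and only the asymptotic term [- t ^ 0]
    of order 1 is left. The value being nonzero, [zeta1] has a genuine pole at 1. *)
Lemma hz_1 x : 0 < x <= 1 -> hz x 1 = RtoC (- 1).
Proof.
move=> hx.
apply: (Clim_unique (@hz_spec x 1 1 hx _)); first by rewrite /=; lra.
apply/Clim_S; apply: (Clim_ext (u := fun _ => RtoC (-1))); last exact: Clim_const.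
move=> n; rewrite /EM_partial (@csum_ext _ (fun _ => RtoC 0)).
  rewrite (_ : csum (fun _ => RtoC 0) _ = RtoC 0); last by elim: n.+1 => //= k ->; ring.
  rewrite /Pt [csum _ 1]/= (_ : 1 - 1 = 0)%C; last ring.
  by rewrite Cpower_0 Rinv_1; apply: injective_projections; rewrite /=; ring.
move=> k _; rewrite Pt_1; last by have := pos_INR k; lra.
rewrite (_ : 1 - 1 = 0)%C; ring.
Qed.

Definition zeta1 (x : R) (s : C) : C := (hz x s / (1 - s))%C.

Lemma zeta1_series x s : 0 < x <= 1 -> 1 < Re s ->
  Clim (csum (fun n => Cpower (INR n + x) (- s))) (zeta1 x s).
Proof.
move=> hx hs.
have h1 : (1 - s <> RtoC 0)%C.
  move=> e; have : Re (1 - s)%C = 0 by rewrite e.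
  rewrite (_ : Re (1 - s)%C = 1 - Re s) //; lra.
(* Order 0 is admissible for [1 < Re s]: the partial sums converge without correction. *)
have := Clim_scal (/ (1 - s)) (@hz_spec x s 0 hx _).
rewrite /= Rplus_0_l => /(_ hs).
rewrite Cmult_comm -/(zeta1 x s); apply: Clim_ext => M.
rewrite /EM_partial [csum _ 0]/= (_ : forall u, u - 0 = u)%C; last by move=> u; ring.
rewrite -csum_scal; apply: csum_ext => n _.
rewrite Pt_1; first by field.
have := pos_INR n; lra.
Qed.

Lemma zeta1_an_at x a : 0 < x <= 1 -> a <> RtoC 1 -> an_at (zeta1 x) a.
Proof. by move=> hx ha; apply: an_div => //; exact: hz_an_at. Qed.

Lemma Csub0_eq (a b : C) : (a - b)%C = RtoC 0 -> a = b.
Proof. by move=> e; rewrite (_ : a = a - b + b)%C; [rewrite e; ring | ring]. Qed.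

(** * Identity theorem along the real axis *)

Lemma geom_half_le n : rsum (fun k => (/ 2) ^ k) n <= 2.
Proof.
have -> : rsum (fun k => (/ 2) ^ k) n = 2 - 2 * (/ 2) ^ n.
  by elim: n => /= [|n ->]; field.
have : 0 < (/ 2) ^ n by apply: pow_lt; lra.
lra.
Qed.

Lemma Cps_near0 c z l q B : 0 < q -> (forall k, Cmod (c k) * q ^ k <= B) ->
  Cmod z <= q / 2 -> Cps c z l -> Cmod (l - c 0%N) <= Cmod z * (2 * B / q).
Proof.
move=> hq hB hz h.
have h2 : Clim (fun n => csum (fun k => c k * Cpow z k)%C n.+1 - c 0%N)%C (l - c 0%N).
  by apply: Clim_minus; [exact/Clim_S | exact: Clim_const].
apply: (Clim_bound h2) => n.
rewrite csum_recl (_ : _ - c 0%N = csum (fun k => c k.+1 * Cpow z k.+1)%C n)%C; last first.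
  by rewrite /=; ring.
apply: Rle_trans (Cmod_csum _ _) _.
apply: (Rle_trans _ (Cmod z * (B / q) * rsum (fun k => (/ 2) ^ k) n)).
  rewrite -rsum_scal; apply: rsum_le => k _.
  rewrite Cmod_mult Cmod_pow.
  have -> : Cmod z * (B / q) * (/ 2) ^ k = Cmod z * ((q / 2) ^ k * (B / q ^ k.+1)).
    by rewrite /Rdiv Rpow_mult_distr /=; field; split; [apply: pow_nonzero; lra | lra].
  have -> : Cmod (c k.+1) * Cmod z ^ k.+1 = Cmod z * (Cmod z ^ k * Cmod (c k.+1)).
    by rewrite /=; ring.
  apply: Rmult_le_compat_l; first exact: Cmod_ge_0.
  apply: Rmult_le_compat; [by apply: pow_le; exact: Cmod_ge_0 | exact: Cmod_ge_0 | | ].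
    by apply: pow_incr; split=> //; exact: Cmod_ge_0.
  have hqk : 0 < q ^ k.+1 by exact: pow_lt.
  apply: (Rmult_le_reg_r (q ^ k.+1)) => //.
  rewrite /Rdiv Rmult_assoc Rinv_l; last lra.
  by rewrite Rmult_1_r; exact: hB.
have B0 : 0 <= B.
  apply: Rle_trans (hB 0%N); rewrite /= Rmult_1_r; exact: Cmod_ge_0.
have : Cmod z * (B / q) * rsum (fun k => (/ 2) ^ k) n <= Cmod z * (B / q) * 2.
  apply: Rmult_le_compat_l; last exact: geom_half_le.
  apply: Rmult_le_pos; first exact: Cmod_ge_0.
  by apply: Rmult_le_pos => //; apply: Rlt_le; apply: Rinv_0_lt_compat.
move=> h3; apply: Rle_trans h3 _; rewrite /Rdiv; lra.
Qed.

Lemma Cps_disc_bounded c r F : 0 < r ->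
  (forall z, 0 < Cmod z < r -> Cps c z (F z)) ->
  exists B, 0 <= B /\ forall k, Cmod (c k) * (r / 2) ^ k <= B.
Proof.
move=> hr h.
have hr2 : Cmod (RtoC (r / 2)) = r / 2 by rewrite Cmod_R Rabs_pos_eq; lra.
have [|B [hB0 hB]] := @Cps_terms_bounded c (RtoC (r / 2)) (F (RtoC (r / 2))).
  by apply: h; rewrite hr2; lra.
by exists B; split=> // k; have := hB k; rewrite hr2.
Qed.

Lemma Cps_acc_zero0 c r F : 0 < r ->
  (forall z, 0 < Cmod z < r -> Cps c z (F z)) ->
  (forall eps, 0 < eps -> exists z, 0 < Cmod z < eps /\ F z = RtoC 0) ->
  c 0%N = RtoC 0.
Proof.
move=> hr h hz.
have [B [hB0 hB]] := Cps_disc_bounded hr h.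
apply: Cmod_eq_0; apply: Rle_antisym; last exact: Cmod_ge_0.
apply: Rnot_lt_le => hc.
pose D := 2 * B / (r / 2).
have hD : 0 <= D.
  by apply: Rmult_le_pos; [lra | apply: Rlt_le; apply: Rinv_0_lt_compat; lra].
have [|z [hz1 hz2]] := hz (Rmin (r / 4) (Cmod (c 0%N) / (D + 1))).
  by apply: Rmin_pos; [lra | apply: Rmult_lt_0_compat => //; apply: Rinv_0_lt_compat; lra].
have hza : Cmod z < r / 4 by apply: Rlt_le_trans hz1.2 (Rmin_l _ _).
have hzb : Cmod z < Cmod (c 0%N) / (D + 1) by apply: Rlt_le_trans hz1.2 (Rmin_r _ _).
have hr2 : 0 < r / 2 by lra.
have h3 : Cmod (F z - c 0%N) <= Cmod z * D.
  apply: (Cps_near0 hr2 hB); [lra | apply: h; lra].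
move: h3; rewrite hz2 (_ : RtoC 0 - c 0%N = - c 0%N)%C; last ring.
rewrite Cmod_opp => h3.
have h4 : Cmod z * (D + 1) < Cmod (c 0%N).
  have -> : Cmod (c 0%N) = Cmod (c 0%N) / (D + 1) * (D + 1) by field; lra.
  by apply: Rmult_lt_compat_r; lra.
lra.
Qed.

(** Once [c 0] is known to vanish, division by [z] shifts the coefficients and keeps the zeros. [F]
    is constrained off 0 only, so the lemma applies at poles and removable points alike. *)
Lemma Cps_acc_zero c r F : 0 < r ->
  (forall z, 0 < Cmod z < r -> Cps c z (F z)) ->
  (forall eps, 0 < eps -> exists z, 0 < Cmod z < eps /\ F z = RtoC 0) ->
  forall k, c k = RtoC 0.
Proof.
move=> hr h hz k; elim: k c F h hz => [|k IH] c F h hz.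
  exact: Cps_acc_zero0 hr h hz.
have c0 : c 0%N = RtoC 0 by exact: Cps_acc_zero0 hr h hz.
apply: (IH (fun j => c j.+1) (fun z => F z / z)%C).
  move=> z hz1; have hz0 : z <> RtoC 0 by apply/Cmod_gt_0; exact: hz1.1.
  have := Clim_scal (/ z) ((Clim_S _ _).2 (h z hz1)).
  rewrite Cmult_comm; apply: Clim_ext => n.
  rewrite csum_recl c0 Cmult_0_l Cplus_0_l -csum_scal; apply: csum_ext => j _ /=.
  by field.
move=> eps he; have [z [hz1 hz2]] := hz eps he; exists z; split=> //.
by rewrite hz2 /Cdiv Cmult_0_l.
Qed.

(** Weaker than the alternative in [meromorphic]: the order may be 0, the leading coefficient may
    vanish and the value at [a] is free. This makes the notion stable under differences. *)
Definition merom_at (f : C -> C) (a : C) : Prop :=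
  exists (m : nat) (c : nat -> C) (r : R), 0 < r /\
    forall s, 0 < Cmod (s - a) < r -> Cps c (s - a) (Cpow (s - a) m * f s).

Lemma meromorphic_at f a : meromorphic f -> merom_at f a.
Proof.
move=> /(_ a) [[c [r [hr h]]] | [m [c [r [_ [hr [_ h]]]]]]].
  exists 0%N, c, r; split=> // s hs; rewrite Cmult_1_l; apply/Cps_pseries; apply: h; lra.
by exists m, c, r; split=> // s hs; apply/Cps_pseries; exact: h.
Qed.

Lemma Cps_shiftn m c :
  exists d, forall z l, Cps c z l -> Cps d z (Cpow z m * l).
Proof.
elim: m => [|m [d hd]]; first by exists c => z l; rewrite Cmult_1_l.
exists (fun k => if k is j.+1 then d j else RtoC 0) => z l hl.
rewrite Cpow_S -Cmult_assoc; apply: Cps_shift; exact: hd.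
Qed.

Lemma merom_minus f g a : merom_at f a -> merom_at g a ->
  merom_at (fun s => f s - g s)%C a.
Proof.
move=> [m [c [r [hr h]]]] [m' [c' [r' [hr' h']]]].
have [d hd] := Cps_shiftn m' c; have [d' hd'] := Cps_shiftn m c'.
exists (m + m')%N, (fun k => d k - d' k)%C, (Rmin r r'); split; first exact: Rmin_pos.
move=> s hs.
have -> : (Cpow (s - a) (m + m') * (f s - g s) =
   Cpow (s - a) m' * (Cpow (s - a) m * f s) - Cpow (s - a) m * (Cpow (s - a) m' * g s))%C.
  by rewrite Cpow_add_r; ring.
apply: Cps_minus; [apply: hd; apply: h | apply: hd'; apply: h'].
  split; [exact: hs.1 | exact: Rlt_le_trans hs.2 (Rmin_l _ _)].
split; [exact: hs.1 | exact: Rlt_le_trans hs.2 (Rmin_r _ _)].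
Qed.

Lemma merom_acc_zero f a : merom_at f a ->
  (forall eps, 0 < eps -> exists s, 0 < Cmod (s - a) < eps /\ f s = RtoC 0) ->
  exists r, 0 < r /\ forall s, 0 < Cmod (s - a) < r -> f s = RtoC 0.
Proof.
move=> [m [c [r [hr h]]]] hz; exists r; split=> // s hs.
pose F z := (Cpow z m * f (a + z))%C.
have hF z : 0 < Cmod z < r -> Cps c z (F z).
  move=> hz1; have := h (a + z)%C; rewrite (_ : a + z - a = z)%C; [exact | ring].
have c0 := Cps_acc_zero hr hF.
have {}c0 k : c k = RtoC 0.
  apply: c0 => eps he; have [u [hu1 hu2]] := hz eps he.
  exists (u - a)%C; split=> //; rewrite /F (_ : a + (u - a) = u)%C; last ring.
  by rewrite hu2 Cmult_0_r.
have e : (Cpow (s - a) m * f s)%C = RtoC 0.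
  by apply: Clim_unique (h s hs) _; apply: Cps_ext (Cps_0 _) => k; rewrite c0.
have hsa : (s - a <> RtoC 0)%C by apply/Cmod_gt_0; exact: hs.1.
have hp := Cpow_nz _ m hsa.
have -> : f s = (/ Cpow (s - a) m * (Cpow (s - a) m * f s))%C by field.
by rewrite e Cmult_0_r.
Qed.

Lemma Cmod_RtoC_sub (s t : R) : Cmod (RtoC s - RtoC t) = Rabs (s - t).
Proof. by rewrite -RtoC_minus Cmod_R. Qed.

(* Analytic continuation along the real axis: the punctured neighbourhoods
   step over the poles. *)
Lemma merom_continuation f g b t : (forall a, merom_at f a) -> (forall a, merom_at g a) ->
  (forall s, b < Re s -> f s = g s) ->
  exists r, 0 < r /\ forall s, 0 < Cmod (s - RtoC t) < r -> f s = g s.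
Proof.
move=> hf hg hfg.
pose W s := (f s - g s)%C.
pose P (t : R) := exists r, 0 < r /\ forall s, 0 < Cmod (s - RtoC t) < r -> W s = RtoC 0.
suff [r [hr h]] : P t.
  exists r; split=> // s hs; have := h s hs => e.
  by rewrite (_ : f s = W s + g s)%C; [rewrite e; ring | rewrite /W; ring].
apply: NNPP => hn.
have hub u : ~ P u -> u <= b.
  move=> hu; apply: Rnot_lt_le => hbu; apply: hu.
  exists (u - b); split; first lra.
  move=> s hs; rewrite /W hfg; first ring.
  have := Rle_lt_trans _ _ _ (re_le_Cmod _) hs.2.
  rewrite (_ : Re (s - RtoC u)%C = Re s - u) // => h; have := Rabs_def2 _ _ h; lra.
(* [t0] is the supremum of the real points around which no punctured disc of zeros of [W] exists.
   Points to its right supply zeros accumulating at [t0], so [W] vanishes on a punctured disc about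
   [t0]; that disc contains punctured discs about the points just left of [t0], which contradicts
   the choice of [t0]. *)
have [t0 [h1 h2]] : { m : R | is_lub (fun u => ~ P u) m }.
  by apply: completeness; [exists b => u; exact: hub | exists t].
have hP u : t0 < u -> P u.
  by move=> hu; apply: NNPP => hnu; have := h1 u hnu; lra.
have [|r [hr h]] := @merom_acc_zero W (RtoC t0) (merom_minus (hf _) (hg _)).
  move=> eps he.
  have [|r [hr h]] := hP (t0 + eps / 2); first lra.
  pose d := Rmin r (eps / 2) / 2.
  have hd0 : 0 < Rmin r (eps / 2) by apply: Rmin_pos; lra.
  have hd1 := Rmin_l r (eps / 2); have hd2 := Rmin_r r (eps / 2).
  exists (RtoC (t0 + eps / 2 + d)); split.
    rewrite Cmod_RtoC_sub Rabs_pos_eq /d; lra.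
  apply: h; rewrite Cmod_RtoC_sub Rabs_pos_eq /d; lra.
have := h2 (t0 - r / 2); suff hh : is_upper_bound (fun u => ~ P u) (t0 - r / 2).
  by move=> /(_ hh); lra.
move=> u hu; apply: Rnot_lt_le => hlt; apply: hu.
case: (Rle_dec t0 u) => h0.
  have [e | hlt2] : u = t0 \/ t0 < u by lra.
    by rewrite e; exists r.
  exact: hP.
have hu : u < t0 by lra.
exists (Rmin (t0 - u) (r - (t0 - u))); split; first by apply: Rmin_pos; lra.
move=> s hs; apply: h.
have h3 := Rlt_le_trans _ _ _ hs.2 (Rmin_l _ _).
have h4 := Rlt_le_trans _ _ _ hs.2 (Rmin_r _ _).
have h5 := Cmod_tri3 s (RtoC u) (RtoC t0).
have h6 := Cmod_tri3 (RtoC t0) s (RtoC u).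
rewrite Cmod_RtoC_sub Rabs_left in h5; last lra.
rewrite Cmod_RtoC_sub Rabs_pos_eq in h6; last lra.
rewrite (Cmod_sub_sym _ s) in h6; lra.
Qed.

(** The difference quotient is a power series in [s - a] with constant term [c 1], and [Cps_near0]
    bounds its distance from that term linearly. *)
Lemma an_deriv_C_derive f a v : an_deriv f a v -> C_derive f a = v.
Proof.
move=> [c [r [hr [<- h]]]].
apply: is_C_lim_unique; apply/filterlim_locally => eps.
have f_a : f a = c 0%N.
  by apply: Cps_at0; have := h a; rewrite (_ : a - a = 0)%C; [rewrite Cmod_0; exact | ring].
have hq z : 0 < Cmod z < r -> Cps (fun k => c k.+1) z ((f (a + z)%C - f a) / z)%C.
  move=> hz1; have hz0 : z <> RtoC 0 by apply/Cmod_gt_0; exact: hz1.1.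
  have := h (a + z)%C; rewrite (_ : a + z - a = z)%C; last ring.
  move=> /(_ hz1.2) hc.
  have := Clim_scal (/ z) (Clim_minus ((Clim_S _ _).2 hc) (Clim_const (c 0%N))).
  rewrite Cmult_comm f_a; apply: Clim_ext => n.
  rewrite csum_recl (_ : c 0%N * Cpow z 0 + _ - c 0%N = csum (fun k => c k.+1 * Cpow z k.+1) n)%C; last first.
    by rewrite /=; ring.
  rewrite -csum_scal; apply: csum_ext => j _ /=; by field.
have [B [hB0 hB]] := Cps_disc_bounded hr hq.
pose D := 2 * B / (r / 2).
have hD : 0 <= D.
  by apply: Rmult_le_pos; [lra | apply: Rlt_le; apply: Rinv_0_lt_compat; lra].
pose d := Rmin (r / 4) (eps / (D + 1)) / 2.
have hd0 : 0 < Rmin (r / 4) (eps / (D + 1)).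
  by apply: Rmin_pos; [lra | apply: Rmult_lt_0_compat; [exact: cond_pos | apply: Rinv_0_lt_compat; lra]].
have hd1 := Rmin_l (r / 4) (eps / (D + 1)); have hd2 := Rmin_r (r / 4) (eps / (D + 1)).
have hd : 0 < d by rewrite /d; lra.
exists (mkposreal d hd) => s hs hne.
apply: C_NormedModule_mixin_compat1.
have h1 : Cmod (s - a) < Rmin (r / 4) (eps / (D + 1)).
  have h2 := C_NormedModule_mixin_compat2 _ _ _ hs.
  have h3 := sqrt2_le; apply: Rlt_le_trans h2 _ => /=.
  by have := Rmult_le_compat_r d _ _ (Rlt_le _ _ hd) h3; rewrite /d; lra.
have hsa : 0 < Cmod (s - a).
  apply/Cmod_gt_0 => e; apply: hne.
  exact: Csub0_eq e.
have hr2 : 0 < r / 2 by lra.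
have := Cps_near0 hr2 hB _ (hq (s - a)%C _).
rewrite (_ : a + (s - a) = s)%C; last ring.
move=> H; have {}H : Cmod ((f s - f a) / (s - a) - c 1%N) <= Cmod (s - a) * D by apply: H; lra.
apply: Rle_lt_trans H _.
have h4 : Cmod (s - a) * (D + 1) < eps.
  have -> : pos eps = eps / (D + 1) * (D + 1) by field; lra.
  by apply: Rmult_lt_compat_r; lra.
lra.
Qed.

(** A function that is analytic or has a pole at [a] and agrees with an analytic one on a punctured
    disc shares its whole expansion, value at [a] included. Here the exclusion of wrongly filled
    removable singularities is decisive. *)
Lemma an_deriv_transfer f g a v : (analytic_at f a \/ pole_at f a) -> an_deriv g a v ->
  (exists r, 0 < r /\ forall s, 0 < Cmod (s - a) < r -> f s = g s) -> an_deriv f a v.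
Proof.
move=> hf [d [r [hr [<- h]]]] [r1 [hr1 hfg]].
case: hf => [/an_atE [_ [c [r2 [hr2 [_ hc]]]]] | [m [c [r2 [hm [hr2 [c0 hc]]]]]]].
  exists c, r2; split=> //; split=> //.
  pose r3 := Rmin r (Rmin r1 r2).
  have hr3 : 0 < r3 by do 2 apply: Rmin_pos => //.
  have [l1 [l2 l3]] : r3 <= r /\ r3 <= r1 /\ r3 <= r2.
    split; first exact: Rmin_l.
    split; apply: Rle_trans (Rmin_r _ _) _; [exact: Rmin_l | exact: Rmin_r].
  have e k : (c k - d k = 0)%C.
    apply: (@Cps_acc_zero (fun k => c k - d k)%C r3 (fun _ => RtoC 0)) => // [z hz|eps he].
      rewrite (_ : RtoC 0 = f (a + z) - g (a + z))%C; last first.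
        rewrite hfg; first ring.
        rewrite (_ : a + z - a = z)%C; [lra | ring].
      apply: Cps_minus.
        have := hc (a + z)%C; rewrite (_ : a + z - a = z)%C; [apply; lra | ring].
      have := h (a + z)%C; rewrite (_ : a + z - a = z)%C; [apply; lra | ring].
    exists (RtoC (eps / 2)); split=> //; rewrite Cmod_R Rabs_pos_eq; lra.
  by rewrite (_ : c 1%N = c 1%N - d 1%N + d 1%N)%C; [rewrite e; ring | ring].
(* After multiplication by [z ^ m.+1] the analytic [g] has constant coefficient 0, whereas that of
   [f] is the nonzero [c 0]. *)
exfalso.
case: m hm hc => // m _ hc.
pose r3 := Rmin r (Rmin r1 r2).
have hr3 : 0 < r3 by do 2 apply: Rmin_pos => //.
have [l1 [l2 l3]] : r3 <= r /\ r3 <= r1 /\ r3 <= r2.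
  split; first exact: Rmin_l.
  split; apply: Rle_trans (Rmin_r _ _) _; [exact: Rmin_l | exact: Rmin_r].
have [d' hd'] := Cps_shiftn m d.
have e k : (c k - (if k is j.+1 then d' j else RtoC 0) = 0)%C.
  apply: (@Cps_acc_zero (fun k => c k - (if k is j.+1 then d' j else RtoC 0))%C r3 (fun _ => RtoC 0)) => // [z hz|eps he].
    have hz' : 0 < Cmod (a + z - a) < r3 by rewrite (_ : a + z - a = z)%C; [ | ring].
    have e0 : (Cpow z m.+1 * f (a + z) - z * (Cpow z m * g (a + z)) = 0)%C.
      by rewrite hfg; [rewrite Cpow_S; ring | lra].
    rewrite -[X in Cps _ _ X]e0; apply: Cps_minus.
      have := hc (a + z)%C; rewrite -Cps_pseries (_ : a + z - a = z)%C; [apply; lra | ring].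
    apply: Cps_shift; apply: hd'.
    have := h (a + z)%C; rewrite (_ : a + z - a = z)%C; [apply; lra | ring].
  exists (RtoC (eps / 2)); split=> //; rewrite Cmod_R Rabs_pos_eq; lra.
apply: c0; have := e 0%N => <-; ring.
Qed.

(** * Multiple Hurwitz zeta functions *)

HB.instance Definition _ := Monoid.isComLaw.Build C (RtoC 0) Cplus
  Cplus_assoc Cplus_comm Cplus_0_l.
HB.instance Definition _ := Monoid.isComLaw.Build R 0 Rplus (fun a b c => esym (Rplus_assoc a b c))
  Rplus_comm Rplus_0_l.

(* With S the shift of sequences, Vop x u m = (S + m - x) ... (S + 1 - x) u. *)
Fixpoint Vop (x : R) (u : nat -> C) (m k : nat) : C :=
  if m is m'.+1 then (Vop x u m' k.+1 + RtoC (INR m - x) * Vop x u m' k)%C else u k.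

Lemma Vop_S x u m k :
  Vop x u m.+1 k = (Vop x u m k.+1 + RtoC (INR m.+1 - x) * Vop x u m k)%C.
Proof. by []. Qed.

(** The coefficients [q] depend neither on [u] nor on [k], so limits, analyticity and derivatives
    pass through [Vop] as through a fixed finite linear combination. *)
Lemma Vop_expand x m : exists q : nat -> C, forall u k,
  Vop x u m k = csum (fun j => q j * u (j + k)%N)%C m.+1.
Proof.
elim: m => [|m [q IH]]; first by exists (fun _ => RtoC 1) => u k /=; rewrite add0n; ring.
(* The induction hypothesis says nothing about [q] past the index [m], so it is cut off there. *)
exists (fun j => (if j is i.+1 then q i else RtoC 0) +
   RtoC (INR m.+1 - x) * (if (j <= m)%N then q j else RtoC 0))%C => u k.
rewrite Vop_S !IH.
rewrite [RHS](@csum_ext _ (fun j => (if j is i.+1 then q i else RtoC 0) * u (j + k)%N +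
   RtoC (INR m.+1 - x) * ((if (j <= m)%N then q j else RtoC 0) * u (j + k)%N))%C); last first.
  by move=> j _; ring.
rewrite csum_plus csum_scal; congr (_ + _ * _)%C.
  rewrite [RHS]csum_recl Cmult_0_l Cplus_0_l; apply: csum_ext => j _.
  by rewrite addnS addSn.
rewrite [RHS](csumS _ m.+1) ltnn Cmult_0_l Cplus_0_r; apply: csum_ext => j.
by rewrite ltnS => ->.
Qed.

Fixpoint rising (t : R) (m : nat) : R :=
  if m is m'.+1 then rising t m' * (t + INR m) else 1.

(** On a geometric sequence the shift acts as its ratio [y + x], so each factor [S + i - x] becomes
    [y + i]. For [y = INR n] the product is the polynomial that counts tuples of sum [n], up to a
    factorial. *)
Lemma Vop_geom x (y : R) u m k : (forall j, u j.+1 = RtoC (y + x) * u j)%C ->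
  Vop x u m k = (RtoC (rising y m) * u k)%C.
Proof.
move=> hu; elim: m k => [|m IH] k; first by rewrite /=; ring.
rewrite Vop_S !IH hu -[rising y m.+1]/(rising y m * (y + INR m.+1)).
rewrite RtoC_mult !RtoC_plus RtoC_opp; ring.
Qed.

Lemma rising_bin n m : rising (INR n) m = INR 'C(n + m, m) * INR m`!.
Proof.
elim: m => [|m IH]; first by rewrite addn0 bin0 /=; ring.
rewrite -[rising _ m.+1]/(rising (INR n) m * (INR n + INR m.+1)) IH.
have := mul_bin_diag (n + m.+1) m; rewrite addnS /= => e.
have {}e : INR (n + m).+1 * INR 'C(n + m, m) = INR m.+1 * INR 'C((n + m).+1, m.+1).
  by rewrite -!mult_INR; congr INR.
rewrite factS mult_INR.
have -> : INR n + INR m.+1 = INR (n + m).+1 by rewrite -plus_INR; congr INR; lia.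
rewrite -Rmult_assoc (Rmult_comm (INR _) (INR m.+1)) -e; ring.
Qed.

(* The number 'C(n + m, m) of (m+1)-tuples of sum n is a polynomial in n + x, so the
   multiple zeta function is a combination of shifted Hurwitz zeta functions. *)
Definition zetaM (x : R) (m : nat) (s : C) : C :=
  (RtoC (/ INR m`!) * Vop x (fun j => zeta1 x (s - RtoC (INR j))) m 0)%C.

Lemma fact_pos m : 0 < INR m`!.
Proof. by apply: lt_0_INR; apply/ltP; exact: fact_gt0. Qed.

Lemma an_csum (F : nat -> C -> C) a n : (forall j, (j < n)%N -> an_at (F j) a) ->
  an_at (fun s => csum (fun j => F j s) n) a.
Proof.
elim: n => [|n IH] h; first exact: an_0.
by apply: an_plus; [apply: IH => j hj; apply: h; exact: ltnW | exact: h].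
Qed.

(** The shift by [j] is singular at [1 + j] only, so at most one term is singular at a given point.
    If its coefficient is 0 the term vanishes identically, also at the junk value of [zeta1] at its
    pole, and the sum is analytic; otherwise the pole is genuine. *)
Lemma zeta1_span_meromorphic x q n : 0 < x <= 1 ->
  meromorphic (fun s => csum (fun j => q j * zeta1 x (s - RtoC (INR j)))%C n).
Proof.
move=> hx a.
case: (classic (exists j0, (j0 < n)%N /\ a = (1 + RtoC (INR j0))%C /\ q j0 <> RtoC 0)); last first.
  move=> hno; left; apply/an_atE; apply: an_csum => j hj.
  case: (classic (q j = RtoC 0)) => hq.
    by apply: an_ext (an_0 a) => s; rewrite hq Cmult_0_l.
  apply: an_scal; apply: (an_translate (f := zeta1 x)); apply: zeta1_an_at => // e.
  by apply: hno; exists j; split=> //; split=> //; rewrite -e; ring.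
move=> [j0 [hj0 [ha hq]]]; right.
(* The sum times [s - a], with the singular term [j0] rewritten through [hz] as an analytic one. Its
   value at [a] is [q j0], because [hz x 1] is -1. *)
have [_ [c [r [hr [_ h]]]]] : an_at (fun s => csum (fun j => (s - a) *
    (if j == j0 then RtoC 0 else q j * zeta1 x (s - RtoC (INR j))))%C n + - q j0 * hz x (s - RtoC (INR j0)))%C a.
  apply: an_plus.
    apply: (an_csum (F := fun j s => ((s - a) *
      (if j == j0 then RtoC 0 else q j * zeta1 x (s - RtoC (INR j))))%C)) => j hj.
    apply: an_mul_sub; case: eqP => hjj; first exact: an_0.
    apply: an_scal; apply: (an_translate (f := zeta1 x)); apply: zeta1_an_at => // e.
    apply: hjj; apply: INR_eq; apply: RtoC_inj.
    by rewrite (_ : RtoC (INR j) = a - (a - RtoC (INR j)))%C; [rewrite e ha; ring | ring].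
  by apply: an_scal; apply: (an_translate (f := hz x)); exact: hz_an_at.
exists 1%N, c, r; split=> //; split=> //; split.
  have := h a; rewrite (_ : a - a = 0)%C; last ring.
  rewrite Cmod_0 => /(_ hr) /Cps_at0 <-.
  rewrite (_ : csum _ n = 0)%C.
    rewrite ha (_ : 1 + RtoC (INR j0) - RtoC (INR j0) = 1)%C; last ring.
    rewrite hz_1 // (_ : 0 + _ = q j0)%C //.
    by case: (q j0) => u v; apply: injective_projections; rewrite /=; ring.
  elim: (n) => //= k ->; rewrite Cmult_0_l; ring.
move=> s hs; apply/Cps_pseries.
suff -> : (Cpow (s - a) 1 * csum (fun j => q j * zeta1 x (s - RtoC (INR j))) n)%C =
  (csum (fun j => (s - a) * (if j == j0 then RtoC 0 else q j * zeta1 x (s - RtoC (INR j)))) n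
    + - q j0 * hz x (s - RtoC (INR j0)))%C by apply: h; lra.
have hsa : (s - a <> RtoC 0)%C by apply/Cmod_gt_0; lra.
have key : (- q j0 * hz x (s - RtoC (INR j0)) = (s - a) * (q j0 * zeta1 x (s - RtoC (INR j0))))%C.
  rewrite /zeta1 (_ : 1 - (s - RtoC (INR j0)) = - (s - a))%C; last by rewrite ha; ring.
  by field.
rewrite key Cpow_1_r -csum_scal.
have split_sum (F : nat -> C) : csum F n = (csum (fun j => if j == j0 then RtoC 0 else F j) n + F j0)%C.
  elim: n hj0 {h} => // n IH; rewrite ltnS leq_eqVlt => /orP [/eqP e | hlt].
    rewrite /= e eqxx; rewrite -e (_ : csum (fun j => _) j0 = csum F j0); first ring.
    by apply: csum_ext => j hj; rewrite ltn_eqF.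
  rewrite /= (IH hlt) gtn_eqF //; ring.
rewrite [LHS]split_sum; congr (_ + _)%C; apply: csum_ext => j _.
by case: ifP => // _; rewrite Cmult_0_r.
Qed.

Lemma meromorphic_ext f g : (forall s, f s = g s) -> meromorphic f -> meromorphic g.
Proof.
move=> e h a; case: (h a) => [[c [r [hr H]]] | [m [c [r [hm [hr [h0 H]]]]]]]; [left | right].
  by exists c, r; split=> // s hs; rewrite -e; exact: H.
by exists m, c, r; do 3 split=> //; move=> s hs; rewrite -e; exact: H.
Qed.

Lemma zetaM_meromorphic x m : 0 < x <= 1 -> meromorphic (zetaM x m).
Proof.
move=> hx; have [q hq] := Vop_expand x m.
apply: meromorphic_ext (zeta1_span_meromorphic (fun j => RtoC (/ INR m`!) * q j)%C m.+1 hx) => s.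
rewrite /zetaM hq -csum_scal; apply: csum_ext => j _.
by rewrite addn0; ring.
Qed.

Lemma Cpower_shift t s j : 0 < t ->
  Cpower t (- (s - RtoC (INR j))) = (RtoC (t ^ j) * Cpower t (- s))%C.
Proof.
move=> ht; elim: j => [|j IH].
  by rewrite Cmult_1_l; congr Cpower; rewrite /=; ring.
rewrite (_ : - (s - RtoC (INR j.+1)) = 1 + - (s - RtoC (INR j)))%C; last first.
  by rewrite S_INR RtoC_plus; ring.
by rewrite Cpower_S // IH -[t ^ j.+1]/(t * t ^ j) RtoC_mult; ring.
Qed.

Lemma zetaM_series x m s : 0 < x <= 1 -> INR m.+1 < Re s ->
  Clim (csum (fun n => RtoC (INR 'C(n + m, m)) * Cpower (INR n + x) (- s))%C) (zetaM x m s).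
Proof.
move=> hx hs; have [q hq] := Vop_expand x m.
have hz j : (j < m.+1)%N ->
    Clim (csum (fun n => Cpower (INR n + x) (- (s - RtoC (INR j))))) (zeta1 x (s - RtoC (INR j))).
  move=> hj; apply: zeta1_series => //.
  rewrite (_ : Re (s - RtoC (INR j))%C = Re s - INR j) //.
  have : INR j <= INR m by apply: le_INR; apply/leP.
  rewrite S_INR in hs; lra.
apply: (Clim_ext (u := fun M => (RtoC (/ INR m`!) *
   csum (fun j => q j * csum (fun n => Cpower (Rplus (INR n) x) (- (s - RtoC (INR j)))) M) m.+1)%C)).
  move=> M.
  rewrite (@csum_ext (fun j => q j * _)%C
    (fun j => csum (fun n => q j * Cpower (Rplus (INR n) x) (- (s - RtoC (INR j)))) M)%C); last first.
    by move=> j _; rewrite csum_scal.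
  rewrite csum_exch -csum_scal; apply: csum_ext => n _.
  have hn : 0 < INR n + x by have := pos_INR n; lra.
  pose u j := Cpower (INR n + x) (- (s - RtoC (INR j))).
  have -> : csum (fun j => q j * Cpower (Rplus (INR n) x) (- (s - RtoC (INR j))))%C m.+1 = Vop x u m 0.
    by rewrite hq; apply: csum_ext => j _; rewrite addn0.
  rewrite (@Vop_geom x (INR n)); last first.
    move=> j; rewrite /u !Cpower_shift // -[(INR n + x) ^ j.+1]/((INR n + x) * (INR n + x) ^ j).
    by rewrite RtoC_mult; ring.
  rewrite /u Cpower_shift // rising_bin RtoC_mult RtoC_inv; last by have := fact_pos m; lra.
  rewrite /= ; field; move=> /RtoC_inj; have := fact_pos m; lra.
rewrite /zetaM; apply: Clim_scal; rewrite hq.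
rewrite (@csum_ext (fun j => q j * zeta1 x (s - RtoC (INR (j + 0))))%C
  (fun j => q j * zeta1 x (s - RtoC (INR j)))%C); last by move=> j _; rewrite addn0.
apply: (Clim_csum (f := fun j M => (q j * csum (fun n => Cpower (Rplus (INR n) x) (- (s - RtoC (INR j)))) M)%C)).
by move=> j hj; apply: Clim_scal; exact: hz.
Qed.

(** * Tuples of given sum and the unordered summation *)

Fixpoint comps (M n : nat) : seq (seq nat) :=
  if M is M'.+1 then flatten [seq [seq i :: c | c <- comps M' (n - i)] | i <- seq.iota 0%N n.+1]
  else if n is 0%N then [:: [::]] else [::].

Lemma mem_comps M n c : (c \in comps M n) = (size c == M) && (sumn c == n).
Proof.
elim: M n c => [|M IH] n c.
  by case: n => [|n]; case: c => [|i c] //=; rewrite in_nil ?andbF.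
apply/flattenP/idP.
  move=> [l /mapP [i hi ->] /mapP [d hd ->]].
  move: hi hd; rewrite mem_iota IH /= add0n ltnS => hi /andP [/eqP -> /eqP ->].
  by rewrite eqxx /= subnKC.
case: c => [|i c]; first by [].
rewrite [size _]/= [sumn _]/= => /andP [hs /eqP hn].
exists [seq i :: d | d <- comps M (n - i)].
  by apply/mapP; exists i => //; rewrite mem_iota leq0n /= add0n ltnS -hn leq_addr.
apply/mapP; exists c => //; rewrite IH; move: hs; rewrite eqSS => -> /=.
by rewrite -hn addKn.
Qed.

Lemma uniq_comps M n : uniq (comps M n).
Proof.
elim: M n => [|M IH] n; first by case: n.
rewrite /comps -/comps.
elim: (seq.iota 0%N n.+1) (iota_uniq 0%N n.+1) => //= i l IHl /andP [hi hl].
rewrite cat_uniq IHl // andbT map_inj_uniq; last by move=> c d [].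
rewrite IH /=; apply/hasPn => c /flattenP [s /mapP [j hj ->] /mapP [d _ ->]].
by apply/mapP => -[e _ [eij _]]; rewrite -eij hj in hi.
Qed.

Lemma size_compsS M n :
  size (comps M.+1 n) = (\sum_(i <- seq.iota 0%N n.+1) size (comps M (n - i)))%N.
Proof.
rewrite -[comps M.+1 n]/(flatten [seq [seq i :: c | c <- comps M (n - i)] | i <- seq.iota 0%N n.+1]).
rewrite size_flatten /shape -map_comp sumnE big_map; apply: eq_bigr => i _.
by rewrite [LHS]size_map.
Qed.

(** Pascal's rule: the first entry is either 0 or can be lowered by one. *)
Lemma size_comps_rec M n :
  size (comps M.+1 n.+1) = (size (comps M n.+1) + size (comps M.+1 n))%N.
Proof.
rewrite !size_compsS -[seq.iota 0%N n.+2]/(0%N :: seq.iota (1 + 0)%N n.+1).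
rewrite (iotaDl 1%N 0%N) big_cons big_map subn0; congr (_ + _)%N.
Qed.

Lemma size_comps m n : size (comps m.+1 n) = 'C(n + m, m).
Proof.
have base M : size (comps M 0%N) = 1%N.
  by elim: M => //= M IH; rewrite cats0 size_map.
elim: m n => [|m IH] n.
  elim: n => [|n IHn]; first by rewrite base bin0.
  by rewrite size_comps_rec IHn !bin0.
elim: n => [|n IHn]; first by rewrite base binn.
by rewrite size_comps_rec IHn IH (addSnnS n m) [in RHS]addSn binS addnC.
Qed.

Definition tcomps (M n : nat) : seq (M.-tuple nat) := pmap insub (comps M n).

Lemma mem_tcomps M n (t : M.-tuple nat) : (t \in tcomps M n) = (sumn t == n).
Proof. by rewrite mem_pmap_sub mem_comps size_tuple eqxx. Qed.

Lemma uniq_tcomps M n : uniq (tcomps M n).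
Proof. by apply: pmap_sub_uniq; exact: uniq_comps. Qed.

Lemma size_tcomps m n : size (tcomps m.+1 n) = 'C(n + m, m).
Proof.
rewrite size_pmap_sub -size_comps; apply/eqP; rewrite -all_count; apply/allP => c.
by rewrite mem_comps => /andP [].
Qed.

Definition tupto (M B k : nat) : seq (M.-tuple nat) :=
  flatten [seq tcomps M n | n <- seq.iota B k].

Lemma mem_tupto M B k (t : M.-tuple nat) : (t \in tupto M B k) = (B <= sumn t < B + k)%N.
Proof.
apply/flattenP/idP => [[l /mapP [n hn ->]]|ht].
  by rewrite mem_tcomps => /eqP ->; move: hn; rewrite mem_iota.
exists (tcomps M (sumn t)); last by rewrite mem_tcomps.
by apply/mapP; exists (sumn t) => //; rewrite mem_iota.
Qed.

Lemma uniq_tupto M B k : uniq (tupto M B k).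
Proof.
rewrite /tupto; elim: (seq.iota B k) (iota_uniq B k) => //= n l IH /andP [hn hl].
rewrite cat_uniq uniq_tcomps IH // andbT /=; apply/hasPn => t /flattenP [s /mapP [j hj ->]].
rewrite !mem_tcomps => /eqP ->; apply/eqP => e; by rewrite -e hj in hn.
Qed.

Lemma sum_const_C (T : eqType) (l : seq T) (f : T -> C) v : (forall t, t \in l -> f t = v) ->
  \big[Cplus/RtoC 0]_(t <- l) f t = (RtoC (INR (size l)) * v)%C.
Proof.
elim: l => [|t l IH] h; first by rewrite big_nil Cmult_0_l.
rewrite big_cons h ?mem_head // IH; last by move=> u hu; apply: h; rewrite in_cons hu orbT.
by rewrite -[size (t :: l)]/(size l).+1 S_INR RtoC_plus; ring.
Qed.

Lemma sum_const_R (T : eqType) (l : seq T) (f : T -> R) v : (forall t, t \in l -> f t = v) ->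
  \big[Rplus/0]_(t <- l) f t = INR (size l) * v.
Proof.
elim: l => [|t l IH] h; first by rewrite big_nil Rmult_0_l.
rewrite big_cons h ?mem_head // IH; last by move=> u hu; apply: h; rewrite in_cons hu orbT.
by rewrite -[size (t :: l)]/(size l).+1 S_INR; ring.
Qed.

Lemma sum_iota_C (F : nat -> C) B k :
  \big[Cplus/RtoC 0]_(n <- seq.iota B k) F n = csum (fun n => F (B + n)%N) k.
Proof.
elim: k => [|k IH]; first by rewrite big_nil.
by rewrite -addn1 iotaD big_cat big_seq1 IH addn1.
Qed.

Lemma sum_iota_R (F : nat -> R) B k :
  \big[Rplus/0]_(n <- seq.iota B k) F n = rsum (fun n => F (B + n)%N) k.
Proof.
elim: k => [|k IH]; first by rewrite big_nil.
by rewrite -addn1 iotaD big_cat big_seq1 IH addn1.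
Qed.

Lemma sum_tupto_C m B k (f : m.+1.-tuple nat -> C) (F : nat -> C) :
  (forall t, f t = F (sumn t)) ->
  \big[Cplus/RtoC 0]_(t <- tupto m.+1 B k) f t =
  csum (fun n => RtoC (INR 'C((B + n) + m, m)) * F (B + n)%N)%C k.
Proof.
move=> h; rewrite /tupto big_flatten big_map -(sum_iota_C (fun n => RtoC (INR 'C(n + m, m)) * F n)%C).
apply: eq_bigr => n _; rewrite (@sum_const_C _ _ _ (F n)) ?size_tcomps // => t.
by rewrite mem_tcomps h => /eqP ->.
Qed.

Lemma sum_tupto_R m B k (f : m.+1.-tuple nat -> R) (F : nat -> R) :
  (forall t, f t = F (sumn t)) ->
  \big[Rplus/0]_(t <- tupto m.+1 B k) f t =
  rsum (fun n => INR 'C((B + n) + m, m) * F (B + n)%N) k.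
Proof.
move=> h; rewrite /tupto big_flatten big_map -(sum_iota_R (fun n => INR 'C(n + m, m) * F n)).
apply: eq_bigr => n _; rewrite (@sum_const_R _ _ _ (F n)) ?size_tcomps // => t.
by rewrite mem_tcomps h => /eqP ->.
Qed.

Lemma Cmod_bigsum (T : eqType) (l : seq T) (f : T -> C) :
  Cmod (\big[Cplus/RtoC 0]_(t <- l) f t) <= \big[Rplus/0]_(t <- l) Cmod (f t).
Proof.
elim: l => [|t l IH]; first by rewrite !big_nil Cmod_0; lra.
rewrite !big_cons; apply: Rle_trans (Cmod_triangle _ _) _; lra.
Qed.

Lemma bigsum_ge0 (T : eqType) (l : seq T) (f : T -> R) : (forall t, 0 <= f t) ->
  0 <= \big[Rplus/0]_(t <- l) f t.
Proof.
move=> h; elim: l => [|t l IH]; first by rewrite big_nil; lra.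
by rewrite big_cons; have := h t; lra.
Qed.

Lemma bigsum_sub (T : eqType) (l l' : seq T) (f : T -> R) : (forall t, 0 <= f t) ->
  uniq l -> {subset l <= l'} ->
  \big[Rplus/0]_(t <- l) f t <= \big[Rplus/0]_(t <- l') f t.
Proof.
elim: l l' => [|t l IH] l' h0 hu hs; first by rewrite big_nil; exact: bigsum_ge0.
have ht : t \in l' by apply: hs; rewrite mem_head.
rewrite big_cons (perm_big _ (perm_to_rem ht)) big_cons.
apply: Rplus_le_compat_l; move: hu => /= /andP [htl hu].
apply: IH => // u hul; have := hs u; rewrite in_cons hul orbT => /(_ isT).
rewrite (perm_mem (perm_to_rem ht)) in_cons => /orP [/eqP e | //].
by rewrite -e hul in htl.
Qed.

Lemma Cmod_Cpower t s : Cmod (Cpower t s) = Rpower t (Re s).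
Proof.
rewrite /Cpower Cmod_Cexp /Rpower; congr exp.
by case: s => a b /=; ring.
Qed.

Lemma Cpower_real t (p : R) : Cpower t (RtoC p) = RtoC (Rpower t p).
Proof.
rewrite /Cpower /Cexp /Rpower -RtoC_mult [Re _]/= [Im _]/=.
by rewrite cos_0 sin_0 Rmult_1_r Rmult_0_r.
Qed.

(** The finite set to reach consists of the tuples of sum below [B]. A larger finite set adds tuples
    of sum at least [B], whose moduli are controlled by a tail of the series grouped by the sum. *)
Lemma zetaM_unordered x m s : 0 < x <= 1 -> INR m.+1 < Re s ->
  is_unordered_sum (fun n : m.+1.-tuple nat => Cpower (x + INR (sumn n)) (- s)) (zetaM x m s).
Proof.
move=> hx hs eps.
pose g n := INR 'C(n + m, m) * Rpower (INR n + x) (- Re s).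
have hg0 n : 0 <= g n by apply: Rmult_le_pos; [exact: pos_INR | exact: Rlt_le (exp_pos _)].
(* Absolute convergence at [s] is convergence at the real point [Re s], to which [zetaM_series]
   applies. *)
have hg : ex_series g.
  have hs' : INR m.+1 < Re (RtoC (Re s)) by [].
  have [h _] := (Clim_components _ _).1 (zetaM_series hx hs').
  exists (Re (zetaM x m (RtoC (Re s)))); apply/lim_rsum.
  apply: is_lim_seq_ext h => n; rewrite Re_csum; apply: rsum_ext => k _.
  by rewrite -RtoC_opp Cpower_real -RtoC_mult.
have he2 : 0 < eps / 2 by have := cond_pos eps; lra.
have [B1 hB1] := rsum_tail hg0 hg he2.
have [B2 hB2] := (Clim_eps _ _).1 (zetaM_series hx hs) _ he2.
pose B := maxn B1 B2.
exists (tupto m.+1 0%N B) => l hu hsub.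
pose F n := Cpower (x + INR n) (- s).
pose f := fun t : m.+1.-tuple nat => Cpower (x + INR (sumn t)) (- s).
rewrite -/f.
pose rest := [seq t : m.+1.-tuple nat <- l | (B <= sumn t)%N].
have hperm : perm_eq l (tupto m.+1 0%N B ++ rest).
  apply: uniq_perm => //.
    rewrite cat_uniq uniq_tupto filter_uniq // andbT /=; apply/hasPn => t.
    by rewrite mem_filter mem_tupto => /andP [h _]; rewrite /= add0n ltnNge h.
  move=> t; rewrite mem_cat mem_filter; apply/idP/idP.
    by move=> ht; rewrite ht mem_tupto /= add0n andbT; case: ltnP.
  by case/orP => [/hsub | /andP []].
rewrite (perm_big _ hperm) big_cat /=.
rewrite (@sum_tupto_C _ _ _ f F) //.
set S1 := csum _ _; set S2 := \big[_/_]_(t <- rest) _.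
have h1 : Cmod (S1 - zetaM x m s) < eps / 2.
  have := hB2 B (leq_maxr _ _); rewrite /S1 (@csum_ext _ (fun n => RtoC (INR 'C(0 + n + m, m)) * F (0 + n)%N)%C) //.
  by move=> n _; rewrite /F add0n Rplus_comm.
have h2 : Cmod S2 < eps / 2.
  apply: Rle_lt_trans (Cmod_bigsum _ _) _.
  pose k := (\max_(t <- l) sumn (tval t))%N.
  apply: Rle_lt_trans (@bigsum_sub _ rest (tupto m.+1 B k.+1) (fun t => Cmod (f t)) _ _ _) _.
  - by move=> t; exact: Cmod_ge_0.
  - exact: filter_uniq.
  - move=> t; rewrite mem_filter mem_tupto => /andP [-> ht] /=.
    have : (sumn t <= k)%N by exact: (@leq_bigmax_seq _ l xpredT (fun t : m.+1.-tuple nat => sumn t) t).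
    by rewrite addnS ltnS => hk; apply: leq_trans hk (leq_addl _ _).
  rewrite (@sum_tupto_R _ _ _ _ (fun n => Cmod (F n))) //.
  have := hB1 B (B + k.+1)%N (leq_maxl _ _) (leq_addr _ _).
  rewrite rsum_shift (@rsum_ext (fun n => INR 'C(B + n + m, m) * Cmod (F (B + n)%N)) (fun n => g (B + n)%N)); first lra.
  by move=> n _; rewrite /F Cmod_Cpower /g (Rplus_comm x).
rewrite (_ : S1 + S2 - _ = (S1 - zetaM x m s) + S2)%C; last ring.
have := Cmod_triangle (S1 - zetaM x m s) S2; lra.
Qed.

Lemma unordered_sum_unique (T : eqType) (f : T -> C) l1 l2 :
  is_unordered_sum f l1 -> is_unordered_sum f l2 -> l1 = l2.
Proof.
move=> h1 h2; apply: Csub0_eq; apply: Cmod_eq_0; apply: Rle_antisym; last exact: Cmod_ge_0.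
apply: Rnot_lt_le => hpos.
have he : 0 < Cmod (l1 - l2) / 2 by lra.
have [s1 H1] := h1 (mkposreal _ he); have [s2 H2] := h2 (mkposreal _ he).
have a1 := H1 (undup (s1 ++ s2)) (undup_uniq _) _.
have a2 := H2 (undup (s1 ++ s2)) (undup_uniq _) _.
have b1 : {subset s1 <= undup (s1 ++ s2)} by move=> t ht; rewrite mem_undup mem_cat ht.
have b2 : {subset s2 <= undup (s1 ++ s2)} by move=> t ht; rewrite mem_undup mem_cat ht orbT.
move: (a1 b1) (a2 b2); set u := \big[_/_]_(_ <- _) _ => c1 c2.
rewrite /= in c1 c2.
have := Cmod_tri3 l1 u l2; rewrite (Cmod_sub_sym l1 u); lra.
Qed.

Lemma hurwitz_zeta_spec x m : 0 < x <= 1 -> is_hurwitz_zeta m.+1 x (hurwitz_zeta m.+1 x).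
Proof.
move=> hx; apply: epsilon_spec; exists (zetaM x m); split; first exact: zetaM_meromorphic.
by move=> s hs; exact: zetaM_unordered.
Qed.

(** [hurwitz_zeta] and [zetaM] represent the same unordered sum to the right of [m.+1], hence agree
    on a punctured disc about 0; analyticity of [zetaM] at 0 then carries the derivative over. *)
Lemma log_multiple_gamma_an_deriv x m v : 0 < x <= 1 -> an_deriv (zetaM x m) 0 v ->
  log_multiple_gamma m.+1 x = v.
Proof.
move=> hx hv; apply: an_deriv_C_derive.
have [h1 h2] := hurwitz_zeta_spec m hx.
apply: (an_deriv_transfer (h1 _) hv).
apply: (@merom_continuation _ _ (INR m.+1)) => [a|a|s hs].
- exact: meromorphic_at.
- by apply: meromorphic_at; exact: zetaM_meromorphic.
apply: unordered_sum_unique (h2 s hs) _; exact: zetaM_unordered.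
Qed.

Lemma zetaM_an_deriv x m (v : nat -> C) : (forall j, an_deriv (zeta1 x) (- RtoC (INR j)) (v j)) ->
  an_deriv (zetaM x m) 0 (RtoC (/ INR m`!) * Vop x v m 0).
Proof.
move=> hv; apply: an_deriv_scal; have [q hq] := Vop_expand x m.
apply: (an_deriv_ext (f := fun s => csum (fun j => q j * zeta1 x (s - RtoC (INR j)))%C m.+1)).
  by move=> s; rewrite hq; apply: csum_ext => j _; rewrite addn0.
rewrite hq (@csum_ext _ (fun j => q j * v j)%C); last by move=> j _; rewrite addn0.
apply: (an_deriv_csum (f := fun j s => (q j * zeta1 x (s - RtoC (INR j)))%C)) => j _.
apply: an_deriv_scal; apply: (an_deriv_translate (f := zeta1 x)).
by rewrite (_ : 0 - RtoC (INR j) = - RtoC (INR j))%C; [exact: hv | ring].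
Qed.

HB.instance Definition _ := Monoid.isComLaw.Build R 1 Rmult (fun a b c => esym (Rmult_assoc a b c))
  Rmult_comm Rmult_1_l.

(** * Reduction of L_N to the derivative of the Hurwitz zeta function *)

(* The complete homogeneous symmetric polynomial of degree l in
   1 - x, ..., m - x. *)
Fixpoint hsym (x : R) (l : nat) : nat -> R :=
  if l is l'.+1 then
    fix g m := if m is m'.+1 then g m' + (INR m - x) * hsym x l' m else 0
  else fun _ => 1.

(** The weakly increasing sequences of length [l] with entries below [m], split by whether the last
    entry is [m - 1], in step with the recursion of [hsym]. *)
Fixpoint wseqs (l : nat) : nat -> seq (seq nat) :=
  if l is l'.+1 then
    fix g m := if m is m'.+1 then g m' ++ [seq rcons c m' | c <- wseqs l' m] else [::]
  else fun _ => [:: [::]].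

Lemma wseqsS l m : wseqs l.+1 m.+1 = wseqs l.+1 m ++ [seq rcons c m | c <- wseqs l m.+1].
Proof. by []. Qed.

Lemma hsymS x l m : hsym x l.+1 m.+1 = hsym x l.+1 m + (INR m.+1 - x) * hsym x l m.+1.
Proof. by []. Qed.

Lemma mem_wseqs l m c :
  (c \in wseqs l m) = [&& size c == l, all (fun i => i < m)%N c & path.sorted leq c].
Proof.
have sorted_rc (d : seq nat) k :
    path.sorted leq (rcons d k) = path.sorted leq d && all (fun i => i <= k)%N d.
  rewrite -cats1 !(sorted_pairwise leq_trans) pairwise_cat /= andbT.
  by rewrite allrel1r andbC.
elim: l m c => [|l IHl] m c.
  by rewrite mem_seq1; case: c.
elim: m c => [|m IHm] c; first by case: c => [|i c] //=; rewrite andbF.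
rewrite wseqsS mem_cat IHm.
case: (lastP c) => [|d k] //; first by apply/negbTE/mapP => -[[|? ?] _].
rewrite !size_rcons !eqSS !all_rcons sorted_rc.
have -> : (rcons d k \in [seq rcons c m | c <- wseqs l m.+1]) = (k == m) && (d \in wseqs l m.+1).
  apply/mapP/andP => [[e he /rcons_inj [-> ->]]|[/eqP -> hd]]; first by rewrite eqxx.
  by exists d.
rewrite IHl; case: (size d =P l) => //= _; last by rewrite andbF.
case: (path.sorted leq d) => /=; last by rewrite !andbF.
rewrite !andbT; case: (ltngtP k m) => hk.
- rewrite orbF ltnS (ltnW hk) /=; apply/andP/andP => -[h1 h2]; split=> //.
    by apply: sub_all h1 => i /= hi; exact: ltnW.
  by apply: sub_all h2 => i /= hi; exact: leq_ltn_trans hi hk.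
- by rewrite /= ltnS leqNgt hk.
by rewrite /= hk ltnSn /=; apply/idP/andP => [h|[]].
Qed.

Lemma uniq_wseqs l m : uniq (wseqs l m).
Proof.
elim: l m => // l IHl; elim=> // m IHm.
rewrite wseqsS cat_uniq IHm (map_inj_uniq (@rcons_injl _ m)) IHl andbT /=.
apply/hasPn => c /mapP [d _ ->].
change (rcons d m \notin wseqs l.+1 m).
by rewrite mem_wseqs all_rcons ltnn /= andbF.
Qed.

Lemma sum_wseqs x l m :
  \big[Rplus/0]_(c <- wseqs l m) (\big[Rmult/1]_(i <- c) (INR i.+1 - x)) = hsym x l m.
Proof.
have prod_rcons c k : \big[Rmult/1]_(i <- rcons c k) (INR i.+1 - x) =
   (INR k.+1 - x) * \big[Rmult/1]_(i <- c) (INR i.+1 - x).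
  elim: c => [|i c IH]; first by rewrite big_cons !big_nil.
  by rewrite rcons_cons !big_cons IH; ring.
elim: l m => [|l IHl] m; first by rewrite big_seq1 big_nil.
elim: m => [|m IHm]; first by rewrite big_nil.
rewrite wseqsS big_cat IHm hsymS big_map -IHl; congr (_ + _).
elim: (wseqs l m.+1) => [|c s IH]; first by rewrite !big_nil; ring.
by rewrite !big_cons prod_rcons IH; symmetry; exact: Rmult_plus_distr_l.
Qed.

Lemma shifted_sum_hsym l m x : shifted_sum l m x = hsym x l m.
Proof.
rewrite -sum_wseqs /shifted_sum.
pose P := [pred a : l.-tuple 'I_m | path.sorted leq [seq val i | i <- a]].
transitivity (\big[Rplus/0]_(a in P) \big[Rmult/1]_(i <- tval a) (INR i.+1 - x)).
  by apply: eq_bigl => a; rewrite inE.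
rewrite -big_enum /=.
have hp : perm_eq [seq [seq val i | i <- tval a] | a <- enum P] (wseqs l m).
  apply: uniq_perm; [ | exact: uniq_wseqs | ].
    rewrite map_inj_uniq ?enum_uniq // => a b /(inj_map val_inj) e.
    exact: val_inj.
  move=> c; rewrite mem_wseqs; apply/mapP/and3P => [[a ha ->]|[/eqP hs ha hso]].
    move: ha; rewrite mem_enum inE => ha; split=> //.
      by rewrite size_map size_tuple.
    by apply/allP => k /mapP [i _ ->] /=.
  have e : [seq val i | i <- pmap (insub : nat -> option 'I_m) c] = c.
    rewrite (pmap_filter (@insubK _ _ _)); apply/all_filterP.
    by apply: sub_all ha => i hi; rewrite insubT.
  have hs' : size (pmap (insub : nat -> option 'I_m) c) == l by rewrite -(size_map val) e hs.
  exists (Tuple hs'); last by rewrite /= e.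
  by rewrite mem_enum inE /= e.
rewrite -(perm_big _ hp) big_map; apply: eq_bigr => a _.
by rewrite big_map.
Qed.

(* Newton interpolation: hsym inverts the triangular system defining Vop. *)
Lemma newton_Vop x v n k :
  csum (fun l => RtoC ((-1) ^ l * hsym x l (n.+1 - l)) * Vop x v (n - l) k)%C n.+1 = v (k + n)%N.
Proof.
elim: n k => [|n IH] k.
  by rewrite /= addn0 !Rmult_1_r; ring.
(* The recursion of [hsym] splits the sum into [A] and a shifted [B]; [A n.+1] vanishes because
   [hsym] of positive degree in no variables is 0. By the recursion of [Vop], [A l - B l] is the
   term of index [l] of the induction hypothesis at [k.+1]. *)
pose A l := (RtoC ((-1) ^ l * hsym x l (n.+1 - l)) * Vop x v (n.+1 - l) k)%C.
pose B l := (RtoC ((-1) ^ l * hsym x l (n.+1 - l) * (INR (n.+1 - l) - x)) * Vop x v (n - l) k)%C.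
have e : csum (fun l => RtoC ((-1) ^ l * hsym x l (n.+2 - l)) * Vop x v (n.+1 - l) k)%C n.+2 =
   (csum A n.+1 - csum B n.+1)%C.
  rewrite csum_recl (csum_recl A).
  rewrite (@csum_ext _ (fun l => A l.+1 - B l)%C).
    rewrite csum_minus (csumS (fun l => A l.+1) n).
    have -> : A n.+1 = RtoC 0 by rewrite /A subnn /= Rmult_0_r Cmult_0_l.
    rewrite /A !subn0 /=; ring.
  move=> l; rewrite ltnS => hl.
  rewrite /A /B !subSS (subSn hl) hsymS.
  have -> : (-1) ^ l.+1 = - (-1) ^ l by rewrite /=; ring.
  move: (INR (n - l).+1 - x) => y; rewrite !RtoC_mult !RtoC_plus !RtoC_mult RtoC_opp; ring.
rewrite e addnS -addSn -IH -csum_minus; apply: csum_ext => l; rewrite ltnS => hl.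
rewrite /A /B (subSn hl) Vop_S !RtoC_mult; ring.
Qed.

(** The product of the integers below [N - l] cancels the inverse factorial in [zetaM], and what
    remains is the sum evaluated by [newton_Vop]. Only the derivative at [1 - N] survives. *)
Lemma L_sum_an_deriv x N v : 0 < x <= 1 -> (0 < N)%N ->
  (forall j, an_deriv (zeta1 x) (- RtoC (INR j)) (v j)) -> L_sum N x = v N.-1.
Proof.
move=> hx hN hv; case: N hN => // n _.
rewrite /L_sum /index_iota subn0 sum_iota_C [_.-1]/= -[in RHS](add0n n) -(newton_Vop x).
apply: csum_ext => l; rewrite ltnS => hl; rewrite add0n shifted_sum_hsym.
rewrite (subSn hl) (log_multiple_gamma_an_deriv hx (zetaM_an_deriv (n - l) hv)).
have -> : \big[Rmult/1]_(1 <= i < (n - l).+1) INR i = INR (n - l)`!.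
  elim: (n - l)%N => [|k IH]; first by rewrite big_geq.
  rewrite big_nat_recr // IH factS mult_INR; exact: Rmult_comm.
rewrite !RtoC_mult RtoC_inv; last by have := fact_pos (n - l); lra.
field; move=> /RtoC_inj; have := fact_pos (n - l); lra.
Qed.

(** * Uniqueness of Fourier series *)

Definition cont (f : R -> R) : Prop := forall x, continuous f x.

Lemma cont_plus f g : cont f -> cont g -> cont (fun x => f x + g x).
Proof. by move=> hf hg x; apply: (continuous_plus (V := R_NormedModule)). Qed.
Lemma cont_minus f g : cont f -> cont g -> cont (fun x => f x - g x).
Proof. by move=> hf hg x; apply: (continuous_minus (V := R_NormedModule)). Qed.
Lemma cont_mult f g : cont f -> cont g -> cont (fun x => f x * g x).
Proof. by move=> hf hg x; apply: (continuous_mult (K := R_AbsRing)). Qed.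
Lemma cont_const c : cont (fun _ => c).
Proof. by move=> x; exact: continuous_const. Qed.
Lemma cont_id : cont (fun x => x).
Proof. by move=> x; exact: continuous_id. Qed.
Lemma cont_deriv f : (forall x, ex_derive f x) -> cont f.
Proof. by move=> h x; apply: (ex_derive_continuous (V := R_NormedModule)). Qed.
Lemma cont_ext f g : (forall x, f x = g x) -> cont f -> cont g.
Proof. by move=> e h x; apply: continuous_ext (h x). Qed.
Lemma cont_pow f n : cont f -> cont (fun x => f x ^ n).
Proof.
by move=> h; elim: n => [|n IH]; [exact: cont_const | exact: cont_mult].
Qed.
Lemma cont_cos w : cont (fun x => cos (w * x)).
Proof. by apply: cont_deriv => x; auto_derive. Qed.
Lemma cont_sin w : cont (fun x => sin (w * x)).
Proof. by apply: cont_deriv => x; auto_derive. Qed.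
Lemma cont_rsum f n : (forall k, (k < n)%N -> cont (f k)) -> cont (fun x => rsum (fun k => f k x) n).
Proof.
elim: n => [|n IH] h; first exact: cont_const.
by apply: cont_plus; [apply: IH => k hk; apply: h; exact: ltnW | exact: h].
Qed.

Create HintDb cont.
#[local] Hint Resolve cont_plus cont_minus cont_mult cont_const cont_id cont_pow cont_cos cont_sin
  cont_rsum : cont.
Ltac prove_cont := intros;
  try match goal with |- continuous ?f ?t => cut (cont f); [exact (fun h => h t) | ] end;
  auto 10 with cont.

(* Restates at type R an equation typed in the carrier of R_NormedModule. *)
Lemma eq_at_R (a b : R) : a = b -> a = b.
Proof. by []. Qed.

Lemma RIntR_ext (f g : R -> R) a b : (forall x, f x = g x) -> RInt f a b = RInt g a b.
Proof. by move=> h; apply: RInt_ext => x _; exact: h. Qed.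
Lemma RIntR_plus f g a b : cont f -> cont g ->
  RInt (fun x => f x + g x) a b = RInt f a b + RInt g a b.
Proof.
by move=> hf hg; apply: (RInt_plus (V := R_CompleteNormedModule)); exact: RInt_cont_ex.
Qed.
Lemma RIntR_minus f g a b : cont f -> cont g ->
  RInt (fun x => f x - g x) a b = RInt f a b - RInt g a b.
Proof.
by move=> hf hg; apply: (RInt_minus (V := R_CompleteNormedModule)); exact: RInt_cont_ex.
Qed.
Lemma RIntR_scal c f a b : cont f -> RInt (fun x => c * f x) a b = c * RInt f a b.
Proof.
by move=> hf; apply: (RInt_scal (V := R_CompleteNormedModule)); exact: RInt_cont_ex.
Qed.
Lemma RIntR_const (c a b : R) : RInt (fun _ => c) a b = c * (b - a).
Proof. by rewrite RInt_const /scal /= /mult /= Rmult_comm. Qed.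
Lemma RIntR_Chasles f a b c : cont f -> RInt f a b + RInt f b c = RInt f a c.
Proof.
by move=> hf; apply: (RInt_Chasles (V := R_CompleteNormedModule)); exact: RInt_cont_ex.
Qed.
Lemma RIntR_rsum (f : nat -> R -> R) a b n : (forall k, (k < n)%N -> cont (f k)) ->
  RInt (fun x => rsum (fun k => f k x) n) a b = rsum (fun k => RInt (f k) a b) n.
Proof.
elim: n => [|n IH] h.
  by rewrite /= RInt_const /scal /= /mult /= Rmult_0_r.
rewrite /= RIntR_plus; last exact: h.
  by rewrite IH // => k hk; apply: h; exact: ltnW.
by apply: cont_rsum => k hk; apply: h; exact: ltnW.
Qed.
Lemma RIntR_ge_const f a b c : a <= b -> cont f -> (forall x, a < x < b -> c <= f x) ->
  c * (b - a) <= RInt f a b.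
Proof.
move=> hab hf h.
have e : RInt (fun _ => c) a b = c * (b - a).
  by rewrite RInt_const /scal /= /mult /= Rmult_comm.
rewrite -e; apply: RInt_le => //; [exact: ex_RInt_const | exact: RInt_cont_ex].
Qed.

Lemma is_lim_lin u v a b : is_lim_seq u 0 -> is_lim_seq v 0 ->
  is_lim_seq (fun n => a * u n + b * v n) 0.
Proof. by move=> hu hv; apply: lim_plus0; exact: lim_scal0. Qed.

Lemma cos2pi_far d u : 0 < d <= 1 / 2 -> d <= Rabs u <= 1 - d ->
  cos (2 * PI * u) <= cos (2 * PI * d).
Proof.
move=> hd hu; have hpi := PI_RGT_0.
have -> : cos (2 * PI * u) = cos (2 * PI * Rabs u).
  rewrite /Rabs; case: Rcase_abs => h //.
  by rewrite -cos_neg; congr cos; ring.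
case: (Rle_dec (Rabs u) (1 / 2)) => h.
  apply: cos_decr_1; nra.
have -> : cos (2 * PI * Rabs u) = cos (2 * PI * (1 - Rabs u)).
  rewrite -(cos_neg (2 * PI * (1 - _))) -(cos_period (- _) 1); congr cos.
  by rewrite /=; ring.
apply: cos_decr_1; nra.
Qed.

Lemma cos2pi_near d u : 0 <= d <= 1 / 2 -> Rabs u <= d ->
  cos (2 * PI * d) <= cos (2 * PI * u).
Proof.
move=> hd hu; have hpi := PI_RGT_0; have h0 := Rabs_pos u.
have -> : cos (2 * PI * u) = cos (2 * PI * Rabs u).
  rewrite /Rabs; case: Rcase_abs => h //.
  by rewrite -cos_neg; congr cos; ring.
apply: cos_decr_1; nra.
Qed.

(** Continuity of [phi] is part of the notion so that integrals of linear combinations can be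
    split. *)
Definition null_against (d : nat -> R -> R) (phi : R -> R) : Prop :=
  cont phi /\ is_lim_seq (fun M => RInt (fun x => d M x * phi x) 0 1) 0.

Lemma null_against_lin d phi psi a b : (forall M, cont (d M)) -> null_against d phi -> null_against d psi ->
  null_against d (fun x => a * phi x + b * psi x).
Proof.
move=> d_cont [c1 h1] [c2 h2]; split.
  by prove_cont.
apply: is_lim_seq_ext (is_lim_lin a b h1 h2) => M.
have c1' := cont_mult (d_cont M) c1; have c2' := cont_mult (d_cont M) c2.
rewrite -RIntR_scal // -RIntR_scal // -RIntR_plus; last by prove_cont.
  by apply: RIntR_ext => x; ring.
by prove_cont.
Qed.

Lemma null_against_ext d phi psi : (forall x, phi x = psi x) -> null_against d phi -> null_against d psi.
Proof.
move=> e [c h]; split; first exact: cont_ext e c.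
by apply: is_lim_seq_ext h => M; apply: RIntR_ext => x; rewrite e.
Qed.

Definition trig_null (d : nat -> R -> R) : Prop := forall m : nat,
  null_against d (fun x => cos (2 * PI * INR m * x)) /\ null_against d (fun x => sin (2 * PI * INR m * x)).

(** Integer frequencies are closed under adding and subtracting 1, as the product formulas for the
    powers of [bump] require. *)
Lemma null_against_Z d (z : Z) : (forall M, cont (d M)) -> trig_null d ->
  null_against d (fun x => cos (2 * PI * IZR z * x)) /\ null_against d (fun x => sin (2 * PI * IZR z * x)).
Proof.
move=> dc dn; case: (ZArith_dec.Z_le_dec 0 z) => hz.
  have [m ->] : exists m, z = Z.of_nat m by exists (Z.to_nat z); rewrite Znat.Z2Nat.id.
  by rewrite -INR_IZR_INZ; exact: dn.
have [m ->] : exists m, z = Z.opp (Z.of_nat m).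
  by exists (Z.to_nat (- z)); rewrite Znat.Z2Nat.id; lia.
rewrite opp_IZR -INR_IZR_INZ; have [d_cos d_sin] := dn m; split.
  by apply: null_against_ext d_cos => x; rewrite -cos_neg; congr cos; ring.
apply: null_against_ext (null_against_lin (-1) 0 dc d_sin d_sin) => x.
rewrite (_ : 2 * PI * - INR m * x = - (2 * PI * INR m * x)); last ring.
by rewrite sin_neg; ring.
Qed.

(* A trigonometric polynomial whose powers concentrate at x0. *)
Definition bump (del x0 x : R) : R := 1 - cos (2 * PI * del) + cos (2 * PI * (x - x0)).

(** The product formulas trade one factor [bump] at frequency [z] for the frequencies [z], [z + 1]
    and [z - 1], so the induction never expands the power. *)
Lemma null_against_bump d del x0 n (z : Z) : (forall M, cont (d M)) -> trig_null d ->
  null_against d (fun x => bump del x0 x ^ n * cos (2 * PI * IZR z * x)) /\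
  null_against d (fun x => bump del x0 x ^ n * sin (2 * PI * IZR z * x)).
Proof.
move=> dc dn; elim: n z => [|n IH] z.
  by have [h1 h2] := null_against_Z z dc dn; split; [apply: null_against_ext h1 | apply: null_against_ext h2] => x /=; ring.
have [c0 s0] := IH z; have [c1 s1] := IH (z + 1)%Z; have [c2 s2] := IH (z - 1)%Z.
pose a := 1 - cos (2 * PI * del); pose p := cos (2 * PI * x0); pose q := sin (2 * PI * x0).
have eb x : bump del x0 x = a + (p * cos (2 * PI * x) + q * sin (2 * PI * x)).
  rewrite /bump /a /p /q (_ : 2 * PI * (x - x0) = 2 * PI * x - 2 * PI * x0); last ring.
  by rewrite cos_minus; ring.
have ep x : 2 * PI * IZR (z + 1) * x = 2 * PI * IZR z * x + 2 * PI * x.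
  by rewrite plus_IZR; ring.
have em x : 2 * PI * IZR (z - 1) * x = 2 * PI * IZR z * x - 2 * PI * x.
  by rewrite minus_IZR; ring.
split.
  apply: null_against_ext (null_against_lin 1 1 dc (null_against_lin a 0 dc c0 c0)
    (null_against_lin 1 1 dc (null_against_lin (p / 2) (p / 2) dc c1 c2) (null_against_lin (q / 2) (- (q / 2)) dc s1 s2))) => x.
  rewrite -[bump _ _ _ ^ n.+1]/(bump del x0 x * bump del x0 x ^ n).
  set b := bump del x0 x ^ n; rewrite eb ep em cos_plus cos_minus sin_plus sin_minus; field.
apply: null_against_ext (null_against_lin 1 1 dc (null_against_lin a 0 dc s0 s0)
    (null_against_lin 1 1 dc (null_against_lin (p / 2) (p / 2) dc s1 s2) (null_against_lin (q / 2) (- (q / 2)) dc c2 c1))) => x.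
rewrite -[bump _ _ _ ^ n.+1]/(bump del x0 x * bump del x0 x ^ n).
set b := bump del x0 x ^ n; rewrite eb ep em cos_plus cos_minus sin_plus sin_minus; field.
Qed.

Lemma bump_cont del x0 : cont (bump del x0).
Proof. by apply: cont_deriv => x; rewrite /bump; auto_derive. Qed.
#[local] Hint Resolve bump_cont : cont.

Definition unif_lim (d : nat -> R -> R) (l : R -> R) : Prop :=
  forall eps, 0 < eps -> exists M0, forall M x, (M0 <= M)%N ->
  0 <= x <= 1 -> Rabs (d M x - l x) <= eps.

(* Otherwise the integrals of d M against the powers of a bump at x0, which tend to 0
   as M grows, would eventually exceed a positive constant. *)
Lemma trig_le0 d l x0 : (forall M, cont (d M)) -> trig_null d -> unif_lim d l ->
  0 < x0 < 1 -> l x0 <= 0.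
Proof.
move=> d_cont dn d_unif hx0; apply: Rnot_lt_le => he; set e := l x0 in he.
have hpi := PI_RGT_0.
have [|M0 hM0] := d_unif (e / 8); first lra.
have [d1 [hd1 hcd1]] : exists d1, 0 < d1 /\ forall x, Rabs (x - x0) < d1 -> Rabs (d M0 x - d M0 x0) < e / 8.
  have he8 : 0 < e / 8 by lra.
  have [d1 h] := (filterlim_locally _ _).1 (d_cont M0 x0) (mkposreal _ he8).
  by exists d1; split; [exact: cond_pos | move=> x hx; apply: h].
have [S hS] : exists S, forall M x, (M0 <= M)%N -> 0 <= x <= 1 -> Rabs (d M x) <= S.
  have [||xm [hm _]] := continuity_ab_maj (fun x => Rabs (d M0 x)) 0 1; first lra.
    move=> c _; apply: (continuity_pt_comp (d M0) Rabs); last exact: Rcontinuity_abs.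
    by apply/continuity_pt_filterlim; exact: d_cont.
  exists (Rabs (d M0 xm) + e) => M x hM hx.
  have := hM0 M x hM hx; have := hM0 M0 x (leqnn _) hx => /Rabs_le_between' h2 /Rabs_le_between' h3.
  have := hm x hx => /Rabs_le_between h1; apply: Rabs_le; lra.
have hS0 : 0 <= S by apply: Rle_trans (hS M0 0 (leqnn _) ltac:(lra)); exact: Rabs_pos.
have hpos M x : (M0 <= M)%N -> 0 <= x <= 1 -> Rabs (x - x0) < d1 -> e / 2 <= d M x.
  move=> hM hx hxd.
  have := hM0 M x hM hx; have := hM0 M0 x (leqnn _) hx => /Rabs_le_between' h2 /Rabs_le_between' h3.
  have := hM0 M0 x0 (leqnn _) ltac:(lra) => /Rabs_le_between' h4.
  have := Rabs_def2 _ _ (hcd1 x hxd); rewrite -/e in h4; lra.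
(* The interval of radius [2 * del] about [x0] stays inside [0,1] and in the region where [d M] is
   at least [e / 2], and [del] is small enough for the cosine to be monotone. *)
pose del := Rmin (Rmin d1 (1 / 4)) (Rmin x0 (1 - x0)) / 2.
have l1 := Rmin_l (Rmin d1 (1 / 4)) (Rmin x0 (1 - x0)).
have l2 := Rmin_r (Rmin d1 (1 / 4)) (Rmin x0 (1 - x0)).
have l3 := Rmin_l d1 (1 / 4); have l4 := Rmin_r d1 (1 / 4).
have l5 := Rmin_l x0 (1 - x0); have l6 := Rmin_r x0 (1 - x0).
have hdel : 0 < del.
  by have : 0 < Rmin (Rmin d1 (1 / 4)) (Rmin x0 (1 - x0)); [do 2 apply: Rmin_pos; lra | rewrite /del; lra].
have [hdd1 [hdx [hdx1 hd4]]] : 2 * del <= d1 /\ 2 * del <= x0 /\ 2 * del <= 1 - x0 /\ 2 * del <= 1 / 4.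
  by rewrite /del; lra.
pose eta := cos (2 * PI * (del / 2)) - cos (2 * PI * del).
have heta : 0 < eta.
  have := cos_decreasing_1 (2 * PI * (del / 2)) (2 * PI * del); rewrite /eta; nra.
pose T := bump del x0.
have Tin x : Rabs (x - x0) <= del / 2 -> 1 + eta <= T x.
  move=> hx; have := @cos2pi_near (del / 2) (x - x0) ltac:(lra) hx.
  rewrite /T /bump /eta; lra.
have Tmid x : Rabs (x - x0) <= del -> 0 <= T x.
  move=> hx; have := @cos2pi_near del (x - x0) ltac:(lra) hx.
  rewrite /T /bump; lra.
have Tout x : 0 <= x <= 1 -> del <= Rabs (x - x0) -> Rabs (T x) <= 1.
  move=> hx hxd.
  have hab : Rabs (x - x0) <= 1 - del by apply: Rabs_le; lra.
  have := @cos2pi_far del (x - x0) ltac:(lra) (conj hxd hab).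
  have := COS_bound (2 * PI * del); have := COS_bound (2 * PI * (x - x0)).
  move=> h1 h2 h3; apply: Rabs_le; rewrite /T /bump; lra.
(* Beyond distance [del] from [x0] the powers of [T] are bounded by 1; within it, where they may be
   large, both factors are nonnegative. *)
have low M x n : (M0 <= M)%N -> 0 <= x <= 1 -> - S <= d M x * T x ^ n.
  move=> hM hx; case: (Rle_dec (Rabs (x - x0)) del) => hxd.
    have h1 := hpos M x hM hx ltac:(lra).
    have h2 : 0 <= T x ^ n by apply: pow_le; exact: Tmid.
    have := Rmult_le_pos (d M x) _ ltac:(lra) h2; lra.
  have h1 : Rabs (T x ^ n) <= 1.
    rewrite -RPow_abs -(pow1 n); apply: pow_incr; split; first exact: Rabs_pos.
    by apply: Tout => //; lra.
  have : Rabs (d M x * T x ^ n) <= S * 1.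
    by rewrite Rabs_mult; apply: Rmult_le_compat; try exact: Rabs_pos; [exact: hS | ].
  by move=> /Rabs_le_between; lra.
have hcT n M : cont (fun x => d M x * T x ^ n).
  by apply: cont_mult => //; apply: cont_pow; exact: bump_cont.
have key n M : (M0 <= M)%N -> - S + e / 2 * (1 + eta) ^ n * del <= RInt (fun x => d M x * T x ^ n) 0 1.
  move=> hM.
  rewrite -(@RIntR_Chasles _ 0 (x0 - del / 2) 1) // -(@RIntR_Chasles _ (x0 - del / 2) (x0 + del / 2) 1) //.
  have h1 := @RIntR_ge_const (fun x => d M x * T x ^ n) 0 (x0 - del / 2) (- S) ltac:(lra) (hcT n M)
     (fun x hx => low M x n hM ltac:(lra)).
  have h3 := @RIntR_ge_const (fun x => d M x * T x ^ n) (x0 + del / 2) 1 (- S) ltac:(lra) (hcT n M)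
     (fun x hx => low M x n hM ltac:(lra)).
  have h2 := @RIntR_ge_const (fun x => d M x * T x ^ n) (x0 - del / 2) (x0 + del / 2) (e / 2 * (1 + eta) ^ n) ltac:(lra) (hcT n M).
  have {}h2 : e / 2 * (1 + eta) ^ n * (x0 + del / 2 - (x0 - del / 2)) <=
       RInt (fun x => d M x * T x ^ n) (x0 - del / 2) (x0 + del / 2).
    apply: h2 => x hx.
    have hxd : Rabs (x - x0) <= del / 2 by apply: Rabs_le; lra.
    apply: Rmult_le_compat; [lra | by apply: pow_le; lra | | ].
      by apply: hpos => //; lra.
    by apply: pow_incr; split; [lra | exact: Tin].
  have hS2 : 0 <= S * del by apply: Rmult_le_pos; lra.
  nra.
(* For fixed [n] let [M] grow: the integral tends to 0. The resulting bound fails for large [n] by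
   Bernoulli's inequality. *)
have key2 n : - S + e / 2 * (1 + eta) ^ n * del <= 0.
  have [[_ h] _] := null_against_bump del x0 n 0 d_cont dn.
  apply: Rnot_lt_le => hlt.
  have [M1 hM1] := (lim_seq_eps _ _).1 h _ hlt.
  have := hM1 (maxn M0 M1) (leq_maxr _ _); rewrite Rminus_0_r.
  have := key n (maxn M0 M1) (leq_maxl _ _).
  rewrite (@RIntR_ext _ (fun x => d (maxn M0 M1) x * T x ^ n)).
    move=> k1 k2; have := Rle_abs (RInt (fun x => d (maxn M0 M1) x * T x ^ n) 0 1); lra.
  by move=> x; rewrite Rmult_0_r Rmult_0_l cos_0 Rmult_1_r.
have c0 : 0 < e / 2 * del * eta by do 2 apply: Rmult_lt_0_compat => //; lra.
have [n hn] := archi_nat ((S + 1) / (e / 2 * del * eta)).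
have hb : 1 + INR n * eta <= (1 + eta) ^ n by apply: poly; lra.
have := key2 n.
have h1 : (S + 1) <= INR n * (e / 2 * del * eta).
  have := Rmult_le_compat_r _ _ _ (Rlt_le _ _ c0) hn.
  by rewrite /Rdiv (Rmult_assoc (S + 1)) Rinv_l; lra.
have c1 : 0 < e / 2 * del by apply: Rmult_lt_0_compat; lra.
have := Rmult_le_compat_l _ _ _ (Rlt_le _ _ c1) hb; nra.
Qed.

(** [trig_le0] for [d] and for [- d] settles the open interval. At 1 no interval around the point
    lies in [0,1], so the value is carried over by continuity of [d M] and uniform convergence. *)
Lemma trig_unique d l x0 : (forall M, cont (d M)) -> trig_null d -> unif_lim d l ->
  0 < x0 <= 1 -> l x0 = 0.
Proof.
move=> d_cont dn du.
have inner x : 0 < x < 1 -> l x = 0.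
  move=> hx; apply: Rle_antisym; first exact: trig_le0 d_cont dn du hx.
  suff : - l x <= 0 by lra.
  apply: (@trig_le0 (fun M y => -1 * d M y + 0 * d M y) (fun y => - l y)) => //.
  - by move=> M; apply: cont_plus; apply: cont_mult => //; exact: cont_const.
  - have neg phi : null_against d phi -> null_against (fun M y => -1 * d M y + 0 * d M y) phi.
      move=> [c h]; split=> //.
      apply: is_lim_seq_ext (lim_scal0 (-1) h) => M.
      rewrite -RIntR_scal; last exact: cont_mult.
      by apply: RIntR_ext => y; ring.
    by move=> m; have [h1 h2] := dn m; split; exact: neg.
  - move=> eps he; have [M0 h] := du eps he; exists M0 => M y hM hy.
    rewrite (_ : _ - - l y = - (d M y - l y)); last ring.
    by rewrite Rabs_Ropp; exact: h.
move=> hx; have [h1 | ->] : x0 < 1 \/ x0 = 1 by lra.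
  by apply: inner; lra.
apply: Rabs_eq_0; apply: Rle_antisym; last exact: Rabs_pos.
apply: Rnot_lt_le => he; set e := Rabs (l 1) in he.
have he4 : 0 < e / 4 by lra.
have [M hM] := du _ he4.
have [dl hd] := (filterlim_locally _ _).1 (d_cont M 1) (mkposreal _ he4).
have hdl := cond_pos dl.
pose y := 1 - Rmin dl 1 / 2.
have m1 := Rmin_l dl 1; have m2 := Rmin_r dl 1.
have m3 : 0 < Rmin dl 1 by apply: Rmin_pos; lra.
have hy : 0 < y < 1 by rewrite /y; lra.
have a1 := hM M 1 (leqnn _) ltac:(lra); have a2 := hM M y (leqnn _) ltac:(lra).
have a3 : Rabs (d M y - d M 1) < e / 4.
  apply: (hd y); rewrite /ball /= /AbsRing_ball /abs /minus /plus /opp /= /y.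
  rewrite Rabs_left; lra.
rewrite (inner y hy) in a2.
have /Rabs_le_between b1 := a1; have /Rabs_le_between b2 := a2; have b3 := Rabs_def2 _ _ a3.
have : e <= 3 / 4 * e by rewrite {1}/e; apply: Rabs_le; lra.
lra.
Qed.

(** * Two trigonometric integrals *)

Lemma ln_le_sub1 x : 0 < x -> ln x <= x - 1.
Proof.
move=> hx; rewrite -[X in _ <= X]ln_exp; apply: ln_le => //.
have := exp_ineq1_le (x - 1); lra.
Qed.

Lemma harmonicS n : harmonic n.+1 = harmonic n + / INR n.+1.
Proof. by rewrite /harmonic big_nat_recr. Qed.

Lemma ln_step n : / INR n.+2 <= ln (INR n.+2) - ln (INR n.+1) <= / INR n.+1.
Proof.
have h1 := INR_ge1 n; have e : INR n.+2 = INR n.+1 + 1 by rewrite S_INR.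
have a : ln (INR n.+1 / INR n.+2) <= INR n.+1 / INR n.+2 - 1.
  by apply: ln_le_sub1; apply: Rdiv_lt_0_compat; lra.
have b : ln (INR n.+2 / INR n.+1) <= INR n.+2 / INR n.+1 - 1.
  by apply: ln_le_sub1; apply: Rdiv_lt_0_compat; lra.
rewrite ln_div in a; [|lra|lra]; rewrite ln_div in b; [|lra|lra].
have ea : INR n.+1 / INR n.+2 - 1 = - / INR n.+2 by rewrite e; field; lra.
have eb : INR n.+2 / INR n.+1 - 1 = / INR n.+1 by rewrite e; field; lra.
lra.
Qed.

Lemma euler_gamma_lim : is_lim_seq (fun n => harmonic n - ln (INR n)) euler_gamma.
Proof.
have [g hg] : ex_finite_lim_seq (fun n => harmonic n.+1 - ln (INR n.+1)).
  apply: (ex_finite_lim_seq_decr _ 0) => n.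
    by rewrite (harmonicS n.+1); have := ln_step n; lra.
  suff : ln (INR n.+2) <= harmonic n.+1 by have := ln_step n; have : 0 < / INR n.+2; [apply: Rinv_0_lt_compat; have := INR_ge1 n.+1; lra | lra].
  elim: n => [|n IH].
    by rewrite harmonicS /harmonic big_geq //; have := ln_step 0; rewrite /= ln_1; lra.
  by rewrite (harmonicS n.+1); have := ln_step n.+1; lra.
have h : is_lim_seq (fun n => harmonic n - ln (INR n)) g.
  by apply/(is_lim_seq_incr_1 (fun n => harmonic n - ln (INR n))).
by rewrite /euler_gamma (is_lim_seq_unique _ _ h).
Qed.

Lemma sin_abs_le w : 0 <= w -> Rabs (sin w) <= w.
Proof.
move=> hw.
have := @mvt_bound sin cos 0 w 1 hw.
rewrite sin_0 !Rminus_0_r Rmult_1_l; apply.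
  by move=> t _; apply: is_derive_sin.
by move=> t _; apply: Rabs_le; have := COS_bound t; lra.
Qed.

Lemma one_sub_cos v : 0 <= v -> 0 <= 1 - cos v <= v ^ 2 / 2.
Proof.
move=> hv.
have e : 1 - cos v = 2 * (sin (v / 2) * sin (v / 2)).
  rewrite {1}(_ : v = 2 * (v / 2)); last field.
  by rewrite cos_2a_sin; ring.
have h2 : 0 <= v / 2 by lra.
have /Rabs_le_between h := sin_abs_le h2.
rewrite e; split; nra.
Qed.

Lemma sub_sin v : 0 <= v -> Rabs (v - sin v) <= v ^ 3 / 6.
Proof.
move=> hv.
have := @deriv_dominate (fun v => v - sin v) (fun v => 1 - cos v) (fun v => v ^ 3 / 6)
  (fun v => v ^ 2 / 2) 0 v hv.
rewrite sin_0 !Rminus_0_r (_ : 0 ^ 3 / 6 = 0); last field.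
rewrite Rminus_0_r; apply.
- by move=> t _; auto_derive => //; ring.
- by move=> t _; auto_derive => //; field.
move=> t ht; have := @one_sub_cos t ltac:(lra) => h; rewrite Rabs_pos_eq; lra.
Qed.

Lemma sin_lower v : 0 <= v <= PI / 2 -> v / 3 <= sin v.
Proof.
move=> hv; have /Rabs_le_between h := @sub_sin v ltac:(lra).
have hp := PI_4.
have : v ^ 3 / 6 <= 2 / 3 * v.
  have : v * v <= 4 by nra.
  move=> h4; have -> : v ^ 3 / 6 = v * (v * v) / 6 by field.
  nra.
lra.
Qed.

(** The projection of R onto [0, 1/2], written with absolute values so that continuity follows from
    the closure rules. *)
Definition clamp (u : R) : R := (Rabs u - Rabs (u - 1 / 2) + 1 / 2) / 2.

Lemma clamp_id u : 0 <= u <= 1 / 2 -> clamp u = u.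
Proof. by move=> h; rewrite /clamp Rabs_pos_eq ?Rabs_left1; lra. Qed.

Lemma clamp_range u : 0 <= clamp u <= 1 / 2.
Proof.
rewrite /clamp /Rabs; case: Rcase_abs => h1; case: Rcase_abs => h2; lra.
Qed.

Lemma clamp_cont : cont clamp.
Proof.
have habs c : cont (fun u => Rabs (u - c)).
  move=> x; apply: (continuous_comp (fun u => u - c) Rabs); last exact: continuous_Rabs.
  by apply: (ex_derive_continuous (V := R_NormedModule)); auto_derive.
have habs0 : cont Rabs by move=> x; exact: continuous_Rabs.
apply: (cont_ext (f := fun u => / 2 * (Rabs u - Rabs (u - 1 / 2) + 1 / 2))).
  by move=> u; rewrite /clamp; field.
by prove_cont.
Qed.

(* 1/u - pi cot(pi u); its value at 0 is 0, the limit there. *)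
Definition cotdiff (u : R) : R := / u - PI * (cos (PI * u) / sin (PI * u)).

Lemma PIu_range u : 0 < u <= 1 / 2 -> 0 < PI * u <= PI / 2.
Proof. by move=> h; have := PI_RGT_0; nra. Qed.

Lemma sinPI_pos u : 0 < u <= 1 / 2 -> 0 < sin (PI * u).
Proof. by move=> h; apply: sin_gt_0; have := PIu_range h; lra. Qed.

Lemma cotdiff_0 : cotdiff 0 = 0.
Proof. by rewrite /cotdiff Rmult_0_r sin_0 /Rdiv Rinv_0; ring. Qed.

(** With [v = PI * u] the function is [PI * (sin v - v * cos v) / (v * sin v)]; the numerator of the
    fraction is at most [2 / 3 * v ^ 3] and the denominator at least [v ^ 2 / 3]. *)
Lemma cotdiff_small u : 0 <= u <= 1 / 2 -> Rabs (cotdiff u) <= 2 * PI ^ 2 * u.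
Proof.
move=> hu; have hpi := PI_RGT_0.
have [-> | hu0] : u = 0 \/ 0 < u by lra.
  by rewrite cotdiff_0 Rabs_R0; lra.
have hu1 : 0 < u <= 1 / 2 by lra.
have hv := PIu_range hu1; have hs := sinPI_pos hu1.
set v := PI * u in hv hs *.
have e : cotdiff u = PI * ((sin v - v * cos v) / (v * sin v)).
  by rewrite /cotdiff -/v (_ : / u = PI / v); [field; split; lra | rewrite /v; field; lra].
have h1 : Rabs (sin v - v * cos v) <= 2 / 3 * v ^ 3.
  have /Rabs_le_between a := @sub_sin v ltac:(lra).
  have b := @one_sub_cos v ltac:(lra).
  have c : 0 <= v * (1 - cos v) <= v * (v ^ 2 / 2).
    by split; [apply: Rmult_le_pos; lra | apply: Rmult_le_compat_l; lra].
  apply: Rabs_le; split; lra.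
have h2 : v / 3 <= sin v by apply: sin_lower; lra.
rewrite e Rabs_mult Rabs_pos_eq; last lra.
have -> : 2 * PI ^ 2 * u = PI * (2 * v) by rewrite /v; ring.
apply: Rmult_le_compat_l; first lra.
have hvs : 0 < v * sin v by apply: Rmult_lt_0_compat; lra.
rewrite /Rdiv Rabs_mult Rabs_inv (Rabs_pos_eq (v * sin v)); last lra.
apply: (Rmult_le_reg_r (v * sin v)) => //.
rewrite Rmult_assoc Rinv_l; last lra.
rewrite Rmult_1_r; apply: Rle_trans h1 _.
have : v * v * (v / 3) <= v * v * sin v by apply: Rmult_le_compat_l; nra.
nra.
Qed.

Lemma cotdiff_derive u : 0 < u <= 1 / 2 ->
  is_derive cotdiff u (PI ^ 2 / sin (PI * u) ^ 2 - / u ^ 2).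
Proof.
move=> hu; have hs := sinPI_pos hu.
rewrite /cotdiff; auto_derive; first by split; [lra | split => //; lra].
have := sin2_cos2 (PI * u); rewrite /Rsqr => e.
have {}e : cos (PI * u) * cos (PI * u) = 1 - sin (PI * u) * sin (PI * u) by lra.
field_simplify_eq; last by split; lra.
have -> : cos (PI * u) ^ 2 = 1 - sin (PI * u) * sin (PI * u) by rewrite -e; ring.
ring.
Qed.

Lemma cotdiff_derive_bound u : 0 < u <= 1 / 2 ->
  Rabs (PI ^ 2 / sin (PI * u) ^ 2 - / u ^ 2) <= 3 * PI ^ 2.
Proof.
move=> hu; have hpi := PI_RGT_0; have hv := PIu_range hu; have hs := sinPI_pos hu.
set v := PI * u in hv hs *.
have -> : / u ^ 2 = PI ^ 2 / v ^ 2 by rewrite /v; field; lra.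
have -> : PI ^ 2 / sin v ^ 2 - PI ^ 2 / v ^ 2 = PI ^ 2 * ((v - sin v) * (v + sin v) / (v ^ 2 * sin v ^ 2)).
  by field; split; lra.
have /Rabs_le_between a := @sub_sin v ltac:(lra).
have /Rabs_le_between b := @sin_abs_le v ltac:(lra).
have h2 : v / 3 <= sin v by apply: sin_lower; lra.
have hsv : sin v <= v by lra.
rewrite Rabs_mult Rabs_pos_eq; last by apply: pow2_ge_0.
rewrite (Rmult_comm 3); apply: Rmult_le_compat_l; first exact: pow2_ge_0.
have hd : 0 < v ^ 2 * sin v ^ 2 by apply: Rmult_lt_0_compat; apply: pow_lt; lra.
have hn : 0 <= (v - sin v) * (v + sin v) by apply: Rmult_le_pos; lra.
rewrite Rabs_pos_eq; last by apply: Rmult_le_pos => //; apply: Rlt_le; apply: Rinv_0_lt_compat.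
apply: (Rmult_le_reg_r (v ^ 2 * sin v ^ 2)) => //.
rewrite /Rdiv Rmult_assoc Rinv_l; last lra.
rewrite Rmult_1_r.
have h3 : (v - sin v) * (v + sin v) <= v ^ 3 / 6 * (2 * v) by apply: Rmult_le_compat; lra.
have h4 : (v / 3) ^ 2 <= sin v ^ 2 by apply: pow_incr; lra.
have h5 : v ^ 2 * (v / 3) ^ 2 <= v ^ 2 * sin v ^ 2 by apply: Rmult_le_compat_l => //; exact: pow2_ge_0.
have e : v ^ 2 * (v / 3) ^ 2 = v ^ 4 / 9 by field.
have e2 : v ^ 3 / 6 * (2 * v) = v ^ 4 / 3 by field.
lra.
Qed.

(* The clamping makes the integrand of the Riemann-Lebesgue argument continuous on R. *)
Definition cq (u : R) : R := cotdiff (clamp u).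

Lemma cq_cont : cont cq.
Proof.
move=> u; have hr := clamp_range u.
have [h0 | h0] : 0 < clamp u \/ clamp u = 0 by lra.
  apply: (continuous_comp clamp cotdiff); first exact: clamp_cont.
  apply: (ex_derive_continuous (V := R_NormedModule)); eexists; apply: cotdiff_derive; lra.
apply/filterlim_locally => eps; rewrite /cq h0 cotdiff_0.
have hpi := PI_RGT_0.
have hc : 0 < 2 * PI ^ 2 by have := pow_lt PI 2 hpi; lra.
have he : 0 < eps / (2 * PI ^ 2) by apply: Rdiv_lt_0_compat => //; exact: cond_pos.
have [dl hd] := (filterlim_locally _ _).1 (@clamp_cont u) (mkposreal _ he).
exists dl => y hy; have := hd y hy; rewrite h0 => hb.
have {}hb : Rabs (clamp y - 0) < eps / (2 * PI ^ 2) by exact: hb.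
have hry := clamp_range y.
suff : Rabs (cotdiff (clamp y) - 0) < eps by [].
rewrite Rminus_0_r; apply: Rle_lt_trans (cotdiff_small hry) _.
rewrite Rminus_0_r Rabs_pos_eq in hb; last lra.
have := Rmult_lt_compat_l _ _ _ hc hb.
by rewrite (_ : 2 * PI ^ 2 * (eps / _) = eps) //; field; lra.
Qed.
#[local] Hint Resolve cq_cont : cont.

Lemma cq_id u : 0 <= u <= 1 / 2 -> cq u = cotdiff u.
Proof. by move=> h; rewrite /cq clamp_id. Qed.

Lemma cq_derive u : 0 < u < 1 / 2 ->
  is_derive cq u (PI ^ 2 / sin (PI * u) ^ 2 - / u ^ 2).
Proof.
move=> hu; apply: (is_derive_ext_loc cotdiff); last by apply: cotdiff_derive; lra.
have hm : 0 < Rmin u (1 / 2 - u) by apply: Rmin_pos; lra.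
exists (mkposreal _ hm) => y hy.
have {}hy : Rabs (y - u) < Rmin u (1 / 2 - u) by exact: hy.
have h1 := Rmin_l u (1 / 2 - u); have h2 := Rmin_r u (1 / 2 - u).
have := Rabs_def2 _ _ hy => h3; rewrite cq_id //; lra.
Qed.

(* Integration by parts; since the derivative of cq is only known inside the interval,
   it takes the form of the mean value theorem for Phi. *)
Lemma cq_Fourier_bound (g dg : R -> R) w : 0 < w -> cont g -> cont dg ->
  (forall t, is_derive g t (w * dg t)) -> (forall t, Rabs (g t) <= 1) ->
  Rabs (RInt (fun t => cq t * dg t) 0 (1 / 2)) <= / w * (2 * Rabs (cq (1 / 2)) + 3 * PI ^ 2).
Proof.
move=> hw cg cdg hdg hg.
have cI : cont (fun t => cq t * dg t) by prove_cont.
pose Phi u := / w * (cq u * g u) - RInt (fun t => cq t * dg t) 0 u.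
(* The mean value theorem places its point in the closed interval; the value 0 given at the ends
   respects the bound proved for [dPhi]. *)
pose dPhi u := if Rlt_dec 0 u then (if Rlt_dec u (1 / 2) then
   / w * ((PI ^ 2 / sin (PI * u) ^ 2 - / u ^ 2) * g u) else 0) else 0.
have hpi2 : 0 <= PI ^ 2 by exact: pow2_ge_0.
have hiw : 0 < / w by exact: Rinv_0_lt_compat.
have [||c [hc e]] := @MVT_gen Phi 0 (1 / 2) dPhi.
- rewrite Rmin_left ?Rmax_right; try lra; move=> u hu.
  rewrite /dPhi; case: Rlt_dec => // h1; last lra; case: Rlt_dec => // h2; last lra.
  have -> : / w * ((PI ^ 2 / sin (PI * u) ^ 2 - / u ^ 2) * g u) =
    / w * ((PI ^ 2 / sin (PI * u) ^ 2 - / u ^ 2) * g u + cq u * (w * dg u)) - cq u * dg u.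
    by move: (PI ^ 2 / _ - / u ^ 2) => A; field; lra.
  apply: derive_minus; last exact: is_derive_prim.
  by apply: derive_scal; apply: derive_mult => //; exact: cq_derive.
- rewrite Rmin_left ?Rmax_right; try lra; move=> u hu.
  apply/continuity_pt_filterlim; apply: (cont_minus (f := fun u => / w * (cq u * g u))).
    by apply: cont_mult; [exact: cont_const | apply: cont_mult => //; exact: cq_cont].
  by apply: cont_deriv => x; exists (cq x * dg x); exact: is_derive_prim.
have hdP : Rabs (dPhi c) <= / w * (3 * PI ^ 2).
  have h0 : 0 <= / w * (3 * PI ^ 2) by apply: Rmult_le_pos; lra.
  rewrite /dPhi; case: Rlt_dec => h1; last by rewrite Rabs_R0.
  case: Rlt_dec => h2; last by rewrite Rabs_R0.
  rewrite Rabs_mult (Rabs_pos_eq (/ w)); last lra.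
  apply: Rmult_le_compat_l; first lra.
  rewrite Rabs_mult -[X in _ <= X]Rmult_1_r.
  apply: Rmult_le_compat; try exact: Rabs_pos; last exact: hg.
  by apply: cotdiff_derive_bound; lra.
have e0 : cq 0 = 0 by rewrite cq_id ?cotdiff_0 //; lra.
have eR : RInt (fun t => cq t * dg t) 0 (1 / 2) = / w * (cq (1 / 2) * g (1 / 2)) - dPhi c * (1 / 2).
  move: e; rewrite /Phi RInt_point e0 /zero /=; lra.
rewrite eR; apply: Rle_trans (Rabs_triang _ _) _.
rewrite Rabs_Ropp (Rabs_mult (/ w)) (Rabs_mult (cq _)) (Rabs_mult (dPhi c)).
rewrite (Rabs_pos_eq (/ w)); last lra.
rewrite (Rabs_pos_eq (1 / 2)); last lra.
have a1 : Rabs (cq (1 / 2)) * Rabs (g (1 / 2)) <= Rabs (cq (1 / 2)) * 1.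
  by apply: Rmult_le_compat_l; [exact: Rabs_pos | exact: hg].
have a2 := Rmult_le_compat_l _ _ _ (Rlt_le _ _ hiw) a1.
have a3 : 0 <= / w * Rabs (cq (1 / 2)) by apply: Rmult_le_pos; [lra | exact: Rabs_pos].
have a4 := Rabs_pos (dPhi c).
lra.
Qed.

Lemma lim_invINR c : is_lim_seq (fun k => / (freq k) * c) 0.
Proof.
have hpi := PI_RGT_0.
have h : is_lim_seq (fun k => / INR k.+1) 0.
  apply/(is_lim_seq_incr_1 (fun k => / INR k)).
  have := is_lim_seq_inv INR p_infty is_lim_seq_INR; exact.
have := lim_scal0 (/ (2 * PI) * c) h; apply: is_lim_seq_ext => k.
by field; split; [have := INR_ge1 k; lra | lra].
Qed.

Lemma cq_cos_lim : is_lim_seq (fun k => RInt (fun t => cq t * cos (freq k * t)) 0 (1 / 2)) 0.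
Proof.
have hpi := PI_RGT_0.
apply: lim0_abs (lim_invINR (2 * Rabs (cq (1 / 2)) + 3 * PI ^ 2)) => k.
have hk := INR_ge1 k.
apply: (@cq_Fourier_bound (fun t => sin (freq k * t))).
- by nra.
- exact: cont_sin.
- exact: cont_cos.
- by move=> t; move: (freq k) => w; auto_derive => //; ring.
- by move=> t; apply: Rabs_le; have := SIN_bound (freq k * t); lra.
Qed.

Lemma cq_sin_lim : is_lim_seq (fun k => RInt (fun t => cq t * sin (freq k * t)) 0 (1 / 2)) 0.
Proof.
have hpi := PI_RGT_0.
apply: lim0_abs (lim_invINR (2 * Rabs (cq (1 / 2)) + 3 * PI ^ 2)) => k.
have hk := INR_ge1 k.
apply: (@cq_Fourier_bound (fun t => - cos (freq k * t))).
- by nra.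
- by apply: (cont_ext (f := fun t => -1 * cos (freq k * t))) => [t|];
    [ring | apply: cont_mult; [exact: cont_const | exact: cont_cos]].
- exact: cont_sin.
- by move=> t; move: (freq k) => w; auto_derive => //; ring.
- by move=> t; apply: Rabs_le; have := COS_bound (freq k * t); lra.
Qed.

(** Modified Dirichlet kernels, [dsin] being the conjugate one: the last frequency has half the
    weight, which turns the closed forms into a cotangent times [1 - cos] or [sin] of that same
    frequency. *)
Definition dsin (n : nat) (u : R) : R :=
  rsum (fun i => 2 * sin (freq i * u)) n + sin (freq n * u).
Definition dcos (n : nat) (u : R) : R :=
  1 + rsum (fun i => 2 * cos (freq i * u)) n + cos (freq n * u).

Lemma dirichlet_kernels n u :
  dsin n u * sin (PI * u) = (1 - cos (freq n * u)) * cos (PI * u) /\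
  dcos n u * sin (PI * u) = sin (freq n * u) * cos (PI * u).
Proof.
have hsc : sin (PI * u) * sin (PI * u) = 1 - cos (PI * u) * cos (PI * u).
  by have := sin2_cos2 (PI * u); rewrite /Rsqr; lra.
have step k : freq k * u = 2 * PI * INR k * u + 2 * (PI * u).
  by rewrite S_INR; ring.
rewrite /dsin /dcos; elim: n => [|n [IH1 IH2]].
  rewrite (_ : 2 * PI * INR 1 * u = 2 * (PI * u)); last by rewrite /=; ring.
  rewrite sin_2a cos_2a [rsum _ 0]/= [rsum (fun _ => 2 * cos _) 0]/=.
  set sb := sin (PI * u) in hsc *; set cb := cos (PI * u) in hsc *.
  split; last by rewrite hsc; ring.
  by rewrite (_ : (0 + 2 * sb * cb) * sb = 2 * (sb * sb) * cb); [rewrite hsc; ring | ring].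
have c2 : cos (2 * (PI * u)) = 2 * (cos (PI * u) * cos (PI * u)) - 1 by rewrite cos_2a; lra.
have s2 := sin_2a (PI * u).
rewrite (step n.+1) sin_plus cos_plus c2 s2.
set a := freq n * u in IH1 IH2 *.
rewrite -[rsum (fun i => 2 * sin _) n.+1]/(rsum (fun i => 2 * sin (freq i * u)) n + 2 * sin a).
rewrite -[rsum (fun i => 2 * cos _) n.+1]/(rsum (fun i => 2 * cos (freq i * u)) n + 2 * cos a).
move: IH1 IH2; set P1 := rsum _ n; set P2 := rsum _ n => IH1 IH2.
set sb := sin (PI * u) in hsc IH1 IH2 *; set cb := cos (PI * u) in hsc IH1 IH2 *.
split.
  have -> : (P1 + 2 * sin a + (sin a * (2 * (cb * cb) - 1) + cos a * (2 * sb * cb))) * sb =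
     (P1 + sin a) * sb + (sin a * (2 * (cb * cb)) * sb + 2 * cos a * cb * (sb * sb)) by ring.
  by rewrite IH1 hsc; ring.
have -> : (1 + (P2 + 2 * cos a) + (cos a * (2 * (cb * cb) - 1) - sin a * (2 * sb * cb))) * sb =
     (1 + P2 + cos a) * sb + (cos a * (2 * (cb * cb)) * sb - 2 * sin a * cb * (sb * sb)) by ring.
by rewrite IH2 hsc; ring.
Qed.

Lemma RInt_cos_w w a b : w <> 0 -> RInt (fun t => cos (w * t)) a b = (sin (w * b) - sin (w * a)) / w.
Proof.
move=> hw; apply: is_RInt_unique.
have -> : (sin (w * b) - sin (w * a)) / w = minus (/ w * sin (w * b)) (/ w * sin (w * a)).
  by rewrite /minus /plus /opp /=; field.
apply: (is_RInt_derive (fun t => / w * sin (w * t))) => t _; last exact: cont_cos.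
by auto_derive => //; field.
Qed.

Lemma RInt_sin_w w a b : w <> 0 -> RInt (fun t => sin (w * t)) a b = (cos (w * a) - cos (w * b)) / w.
Proof.
move=> hw; apply: is_RInt_unique.
have -> : (cos (w * a) - cos (w * b)) / w = minus (- / w * cos (w * b)) (- / w * cos (w * a)).
  by rewrite /minus /plus /opp /=; field.
apply: (is_RInt_derive (fun t => - / w * cos (w * t))) => t _; last exact: cont_sin.
by auto_derive => //; field.
Qed.

Lemma sin_PI_INR n : sin (PI * INR n) = 0.
Proof.
elim: n => [|n IH]; first by rewrite Rmult_0_r sin_0.
by rewrite S_INR Rmult_plus_distr_l Rmult_1_r neg_sin IH Ropp_0.
Qed.

Lemma cos_2PI_INR n : cos (2 * PI * INR n) = 1.
Proof.
have := cos_period 0 n; rewrite cos_0 => <-; congr cos; ring.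
Qed.

Lemma sin_2PI_INR n : sin (2 * PI * INR n) = 0.
Proof.
have := sin_period 0 n; rewrite sin_0 => <-; congr sin; ring.
Qed.

Lemma w_neq0 n : freq n <> 0.
Proof.
have := PI_RGT_0; have := INR_ge1 n => h1 h2; apply: Rmult_integral_contrapositive_currified; lra.
Qed.

Lemma cont_dsin n : cont (dsin n).
Proof. by rewrite /dsin; prove_cont. Qed.
#[local] Hint Resolve cont_dsin : cont.

Lemma cont_dcos n : cont (dcos n).
Proof. by rewrite /dcos; prove_cont. Qed.
#[local] Hint Resolve cont_dcos : cont.

Lemma RInt_dcos n : RInt (dcos n) 0 (1 / 2) = 1 / 2.
Proof.
have half k : RInt (fun u => cos (freq k * u)) 0 (1 / 2) = 0.
  rewrite RInt_cos_w; last exact: w_neq0.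
  rewrite Rmult_0_r sin_0 (_ : freq k * (1 / 2) = PI * INR k.+1); last field.
  by rewrite sin_PI_INR; apply: eq_at_R; rewrite /Rdiv; ring.
rewrite RIntR_plus; [|by prove_cont..].
rewrite RIntR_plus; [|by prove_cont..].
rewrite (@RIntR_rsum (fun i u => 2 * cos (freq i * u))); last by prove_cont.
rewrite half RIntR_const.
rewrite (@rsum_ext _ (fun _ => 0)); last first.
  by move=> i _; rewrite RIntR_scal ?half ?Rmult_0_r //; exact: cont_cos.
have -> : rsum (fun _ => 0) n = 0 by elim: (n) => //= k ->; ring.
apply: eq_at_R; field.
Qed.

(** Over half a period even frequencies integrate to 0 and an odd [k] contributes [2 / k]; the sum
    over the odd [k] is a difference of harmonic numbers. The index [(2 * p).+1] makes the last,
    half-weighted frequency even. *)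
Lemma RInt_dsin p : PI * RInt (dsin (2 * p).+1) 0 (1 / 2) = 2 * harmonic (2 * p.+1) - harmonic p.+1.
Proof.
have hpi := PI_RGT_0.
have half k : RInt (fun u => sin (freq k * u)) 0 (1 / 2) = (1 - cos (PI * INR k.+1)) / (freq k).
  rewrite RInt_sin_w; last exact: w_neq0.
  by rewrite Rmult_0_r cos_0 (_ : freq k * (1 / 2) = PI * INR k.+1); last field.
have cs i : cont (fun u => 2 * sin (freq i * u)).
  by prove_cont.
have cr n : cont (fun u => rsum (fun i => 2 * sin (freq i * u)) n).
  by prove_cont.
have gen n : PI * RInt (dsin n) 0 (1 / 2) = rsum (fun i => (1 - cos (PI * INR i.+1)) / INR i.+1) n
    + (1 - cos (PI * INR n.+1)) / (2 * INR n.+1).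
  rewrite RIntR_plus; [|exact: cr|exact: cont_sin].
  rewrite (@RIntR_rsum (fun i u => 2 * sin (freq i * u))) // half Rmult_plus_distr_l.
  congr (_ + _); last by field; split; [have := INR_ge1 n; lra | lra].
  rewrite -rsum_scal; apply: rsum_ext => i _; rewrite RIntR_scal; last exact: cont_sin.
  by rewrite half; field; split; [have := INR_ge1 i; lra | lra].
have ce k : cos (PI * INR (2 * k)) = 1.
  by rewrite mult_INR -(cos_2PI_INR k); congr cos; rewrite /=; ring.
have co k : cos (PI * INR (2 * k).+1) = -1.
  by rewrite S_INR Rmult_plus_distr_l Rmult_1_r neg_cos ce.
have e2 : (2 * p).+2 = (2 * p.+1)%N by lia.
rewrite gen e2 ce (_ : forall y, (1 - 1) / y = 0); last by move=> y; rewrite /Rdiv; ring.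
rewrite Rplus_0_r -e2.
elim: p {e2} => [|p IH].
  have h0 : harmonic 0 = 0 by rewrite /harmonic big_geq.
  rewrite muln0 (harmonicS 1) (harmonicS 0) h0 /= Rmult_1_r cos_PI; field.
have -> : (2 * p.+1).+1 = (2 * p).+3 by lia.
rewrite -[rsum _ (2 * p).+3]/(rsum (fun i => (1 - cos (PI * INR i.+1)) / INR i.+1) (2 * p).+1
   + (1 - cos (PI * INR (2 * p).+2)) / INR (2 * p).+2 + (1 - cos (PI * INR (2 * p).+3)) / INR (2 * p).+3).
rewrite IH.
have -> : cos (PI * INR (2 * p).+2) = 1 by rewrite (_ : (2 * p).+2 = (2 * p.+1)%N); [exact: ce | lia].
have -> : cos (PI * INR (2 * p).+3) = -1 by rewrite (_ : (2 * p).+3 = (2 * p.+1).+1); [exact: co | lia].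
rewrite !(harmonicS (2 * p).+3) (harmonicS (2 * p).+2) (harmonicS p.+1).
have i1 : INR (2 * p).+3 = 2 * INR p + 3 by rewrite !S_INR mult_INR /=; ring.
have i2 : INR (2 * p).+4 = 2 * INR p + 4 by rewrite !S_INR mult_INR /=; ring.
have i3 : INR p.+2 = INR p + 2 by rewrite !S_INR; ring.
have i4 := INR_ge1 (2 * p).+1.
rewrite i1 i2 i3; have hp := pos_INR p; field; repeat split; lra.
Qed.

Definition sinc (v : R) : R := if Req_EM_T v 0 then 1 else sin v / v.

Lemma sinc_0 : sinc 0 = 1.
Proof. by rewrite /sinc; case: Req_EM_T. Qed.

Lemma sinc_neq v : v <> 0 -> sinc v = sin v / v.
Proof. by rewrite /sinc; case: Req_EM_T. Qed.

Lemma locally_neq0 (v : R) : v <> 0 -> locally v (fun y => y <> 0).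
Proof.
move=> hv; exists (mkposreal _ (Rabs_pos_lt v hv)) => y hy e.
have : Rabs (y - v) < Rabs v by exact: hy.
by rewrite e Rminus_0_l Rabs_Ropp; lra.
Qed.

Lemma cont_sinc : cont sinc.
Proof.
move=> v; case: (Req_EM_T v 0) => [->|hv].
  apply/filterlim_locally => eps; rewrite sinc_0.
  have /is_lim_spec/(_ eps) [d hd] := is_lim_sinc_0.
  exists d => y hy; suff : Rabs (sinc y - 1) < eps by [].
  rewrite /sinc; case: Req_EM_T => h; first by rewrite Rminus_diag Rabs_R0; exact: cond_pos.
  exact: hd.
apply: (continuous_ext_loc _ (fun v => sin v / v)).
  by apply: filter_imp (locally_neq0 hv) => y hy; rewrite sinc_neq.
by apply: (ex_derive_continuous (V := R_NormedModule)); auto_derive.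
Qed.
#[local] Hint Resolve cont_sinc : cont.

Lemma sinc_pos u : 0 <= u <= 1 / 2 -> 0 < sinc (PI * u).
Proof.
move=> hu; have hpi := PI_RGT_0.
have [-> | h] : u = 0 \/ 0 < u by lra.
  by rewrite Rmult_0_r sinc_0; lra.
have hv := @PIu_range u ltac:(lra); rewrite sinc_neq; last lra.
by apply: Rdiv_lt_0_compat; [apply: sinPI_pos; lra | lra].
Qed.

(** A primitive of [1/u - PI cot (PI u)] is [- ln (sin (PI u) / u)], and [sinc] extends it
    continuously to 0. *)
Lemma RInt_cq : RInt cq 0 (1 / 2) = ln (PI / 2).
Proof.
have hpi := PI_RGT_0.
pose f u := - ln (PI * sinc (PI * u)).
have -> : ln (PI / 2) = f (1 / 2) - f 0.
  rewrite /f Rmult_0_r sinc_0 Rmult_1_r sinc_neq; last lra.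
  rewrite (_ : PI * (1 / 2) = PI / 2); last field.
  rewrite sin_PI2 (_ : PI * (1 / (PI / 2)) = 2); last by field; lra.
  by rewrite ln_div; lra.
apply: is_RInt_unique; apply: FTC_open; [lra | | | exact: cq_cont].
  move=> u hu; apply: (is_derive_ext_loc (fun u => - ln (PI * (sin (PI * u) / (PI * u))))).
    have hu0 : u <> 0 by lra.
    apply: filter_imp (locally_neq0 hu0) => y hy; rewrite /f sinc_neq //.
    by apply: Rmult_integral_contrapositive_currified; lra.
  have hs := @sinPI_pos u ltac:(lra).
  have hpu : PI * u <> 0 by have := @PIu_range u ltac:(lra); lra.
  rewrite cq_id; last lra.
  rewrite /cotdiff; auto_derive.
    split=> //; split=> //.
    have := @PIu_range u ltac:(lra) => hv.
    by apply: Rmult_lt_0_compat => //; apply: Rmult_lt_0_compat => //; apply: Rinv_0_lt_compat; lra.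
  by field; repeat split; lra.
move=> u hu; apply: continuity_pt_opp.
have hc : continuity_pt (fun u => PI * sinc (PI * u)) u.
  have hc : cont (fun u => PI * sinc (PI * u)).
    apply: cont_mult; first exact: cont_const.
    move=> y; apply: (continuous_comp (fun y => PI * y) sinc); last exact: cont_sinc.
    by prove_cont.
  by apply/continuity_pt_filterlim; exact: hc.
apply: (continuity_pt_comp _ ln) => //.
have h0 : 0 < PI * sinc (PI * u) by apply: Rmult_lt_0_compat => //; exact: sinc_pos.
by apply: deriv_cont (is_derive_ln _ h0).
Qed.

Lemma one_sub_cos_gen v : 0 <= 1 - cos v <= v ^ 2 / 2.
Proof.
case: (Rle_dec 0 v) => h; first exact: one_sub_cos.
have := @one_sub_cos (- v) ltac:(lra); rewrite cos_neg; lra.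
Qed.

(* (1 - cos (w t)) / t; the value at 0, given by Rocq's division, is the limit 0. *)
Definition cosc (w t : R) : R := (1 - cos (w * t)) / t.

Lemma cont_cosc w : cont (cosc w).
Proof.
move=> t; case: (Req_EM_T t 0) => [->|ht]; last first.
  by apply: (ex_derive_continuous (V := R_NormedModule)); rewrite /cosc; auto_derive.
apply/filterlim_locally => eps.
have he := cond_pos eps.
have hw : 0 < w ^ 2 + 1 by have := pow2_ge_0 w; lra.
have hd : 0 < eps / (w ^ 2 + 1) by apply: Rdiv_lt_0_compat.
exists (mkposreal _ hd) => y hy.
have {}hy : Rabs (y - 0) < eps / (w ^ 2 + 1) by exact: hy.
rewrite Rminus_0_r in hy.
suff : Rabs (cosc w y - cosc w 0) < eps by [].
have -> : cosc w 0 = 0 by rewrite /cosc Rmult_0_r cos_0 /Rdiv; ring.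
rewrite Rminus_0_r; case: (Req_EM_T y 0) => [->|hy0].
  by rewrite /cosc Rmult_0_r cos_0 /Rdiv Rminus_diag Rmult_0_l Rabs_R0.
have hya : 0 < Rabs y by apply: Rabs_pos_lt.
have h1 := one_sub_cos_gen (w * y).
have h2 : Rabs (cosc w y) <= w ^ 2 * Rabs y.
  rewrite /cosc /Rdiv Rabs_mult Rabs_inv (Rabs_pos_eq (1 - _)); last lra.
  apply: (Rmult_le_reg_r (Rabs y)) => //.
  rewrite Rmult_assoc Rinv_l; last lra.
  have -> : w ^ 2 * Rabs y * Rabs y = (w * y) ^ 2.
    by rewrite Rmult_assoc -Rabs_mult Rabs_pos_eq; [ring | nra].
  have := pow2_ge_0 (w * y); lra.
apply: Rle_lt_trans h2 _.
have := Rmult_lt_compat_l _ _ _ hw hy.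
rewrite (_ : (w ^ 2 + 1) * (eps / (w ^ 2 + 1)) = eps); last by field; lra.
lra.
Qed.
#[local] Hint Resolve cont_cosc : cont.

Definition sinw (w t : R) : R := w * sinc (w * t).

Lemma cont_sinw w : cont (sinw w).
Proof.
apply: cont_mult; first exact: cont_const.
move=> y; apply: (continuous_comp (fun y => w * y) sinc); last exact: cont_sinc.
by prove_cont.
Qed.
#[local] Hint Resolve cont_sinw : cont.

Lemma sinw_neq w t : w <> 0 -> t <> 0 -> sinw w t = sin (w * t) / t.
Proof.
move=> hw ht; rewrite /sinw sinc_neq; first by field.
exact: Rmult_integral_contrapositive_currified.
Qed.

Lemma RIntR_ext_open (f g : R -> R) a b : a <= b -> (forall x, a < x < b -> f x = g x) ->
  RInt f a b = RInt g a b.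
Proof.
by move=> hab h; apply: RInt_ext => x; rewrite Rmin_left // Rmax_right //; exact: h.
Qed.

(** Writing [1/u] as [PI cot (PI u) + cotdiff u] turns the first part into a Dirichlet kernel and
    leaves [cq] times [1 - cos], to which the Riemann-Lebesgue estimate applies. The sine integral
    below is treated in the same way. *)
Lemma RInt_cosc_half n : RInt (cosc (freq n)) 0 (1 / 2) =
  PI * RInt (dsin n) 0 (1 / 2) + ln (PI / 2)
  - RInt (fun t => cq t * cos (freq n * t)) 0 (1 / 2).
Proof.
have hc : cont (fun t => cq t * cos (freq n * t)).
  by prove_cont.
have hd : cont (fun t => PI * dsin n t) by prove_cont.
rewrite -RInt_cq -RIntR_scal; last exact: cont_dsin.
rewrite -(RIntR_plus 0 (1 / 2) hd cq_cont) -(RIntR_minus 0 (1 / 2) (cont_plus hd cq_cont) hc).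
apply: RIntR_ext_open; first lra; move=> u hu.
have hs := @sinPI_pos u ltac:(lra).
have [h _] := dirichlet_kernels n u.
have -> : dsin n u = (1 - cos (freq n * u)) * cos (PI * u) / sin (PI * u).
  by rewrite -h; field; lra.
rewrite cq_id; last lra.
by rewrite /cosc /cotdiff; field; lra.
Qed.

Lemma RInt_sinw_half n : RInt (sinw (freq n)) 0 (1 / 2) =
  PI / 2 + RInt (fun t => cq t * sin (freq n * t)) 0 (1 / 2).
Proof.
have hc : cont (fun t => cq t * sin (freq n * t)).
  by prove_cont.
have hd : cont (fun t => PI * dcos n t) by prove_cont.
have -> : PI / 2 = PI * RInt (dcos n) 0 (1 / 2) by rewrite RInt_dcos; field.
rewrite -RIntR_scal; last exact: cont_dcos.
rewrite -RIntR_plus //.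
apply: RIntR_ext_open; first lra; move=> u hu.
have hs := @sinPI_pos u ltac:(lra).
have [_ h] := dirichlet_kernels n u.
have -> : dcos n u = sin (freq n * u) * cos (PI * u) / sin (PI * u).
  by rewrite -h; field; lra.
rewrite cq_id; last lra.
rewrite sinw_neq; [|exact: w_neq0|lra].
by rewrite /cotdiff; field; lra.
Qed.

Lemma lim_subseq (u : nat -> R) (l : R) (phi : nat -> nat) :
  (forall n, (n <= phi n)%N) -> is_lim_seq u l -> is_lim_seq (fun n => u (phi n)) l.
Proof.
move=> hphi /lim_seq_eps h; apply/lim_seq_eps => e he; have [N hN] := h e he.
by exists N => n hn; apply: hN; exact: leq_trans hn (hphi n).
Qed.

(** With [P = p.+1], [2 * harmonic (2 * P) - harmonic P - ln P] tends to [euler_gamma + 2 * ln 2],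
    and [ln (PI / 2)] completes [2 * ln 2] to [ln (2 * PI)]. *)
Lemma cosc_half_lim : is_lim_seq (fun p =>
  RInt (cosc (2 * PI * INR (2 * p.+1))) 0 (1 / 2) - ln (INR p.+1)) (euler_gamma + ln (2 * PI)).
Proof.
have hpi := PI_RGT_0.
have h1 := lim_subseq (phi := fun p => (2 * p.+1)%N) _ euler_gamma_lim.
have {}h1 : is_lim_seq (fun p => harmonic (2 * p.+1) - ln (INR (2 * p.+1))) euler_gamma by apply: h1 => n; lia.
have h2 := lim_subseq (phi := S) (fun n => leqnSn n) euler_gamma_lim.
have h3 := lim_subseq (phi := fun p => (2 * p).+1) _ cq_cos_lim.
have {}h3 := h3 (fun n => ltac:(lia)).
have h := is_lim_seq_minus' _ _ _ _ (is_lim_seq_plus' _ _ _ _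
  (is_lim_seq_minus' _ _ _ _ (is_lim_seq_scal_l _ 2 _ h1) h2) (is_lim_seq_const (2 * ln 2 + ln (PI / 2)))) h3.
have -> : euler_gamma + ln (2 * PI) = 2 * euler_gamma - euler_gamma + (2 * ln 2 + ln (PI / 2)) - 0.
  by rewrite ln_mult ?ln_div; lra.
apply: is_lim_seq_ext h => p.
have e : (2 * p.+1)%N = (2 * p).+2 by lia.
rewrite {3}e RInt_cosc_half RInt_dsin.
rewrite mult_INR ln_mult; [|rewrite /=; lra|have := INR_ge1 p; lra].
rewrite (_ : INR 2 = 2); last by rewrite /=; ring.
rewrite /=; ring.
Qed.

Lemma RInt_dilate (f : R -> R) c M : cont f ->
  RInt f 0 (c * M) = RInt (fun u => c * f (c * u)) 0 M.
Proof.
move=> hf.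
have := @RInt_comp_lin R_CompleteNormedModule f c 0 0 M.
rewrite Rmult_0_r !Rplus_0_r => <-; last exact: RInt_cont_ex.
by apply: RIntR_ext => u; rewrite Rplus_0_r.
Qed.

(** Dilating [0, M] to [0, 1/2] turns the frequency [m.+1] into the even number [2 * m.+1 * M], so
    this is a subsequence of [cosc_half_lim]; its logarithm exceeds [ln M] by [ln (m.+1)]. *)
Lemma cosc_lim m : is_lim_seq (fun M => RInt (cosc (freq m)) 0 (INR M) - ln (INR M))
  (euler_gamma + ln (freq m)).
Proof.
have hpi := PI_RGT_0; have hm := INR_ge1 m.
apply/is_lim_seq_incr_1.
have h := lim_subseq (phi := fun M => (m.+1 * M.+1).-1) _ cosc_half_lim.
have {}h := h (fun n => ltac:(lia)).
have := is_lim_seq_plus' _ _ _ _ h (is_lim_seq_const (ln (INR m.+1))).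
have -> : euler_gamma + ln (2 * PI) + ln (INR m.+1) = euler_gamma + ln (freq m).
  by rewrite (ln_mult (2 * PI)); lra.
apply: is_lim_seq_ext => M.
have hM := INR_ge1 M.
have -> : ((m.+1 * M.+1).-1.+1 = m.+1 * M.+1)%N by lia.
rewrite !mult_INR ln_mult; try lra.
have -> : INR M.+1 = 2 * INR M.+1 * (1 / 2) by field.
rewrite RInt_dilate; last exact: cont_cosc.
rewrite (_ : 2 * INR M.+1 * (1 / 2) = INR M.+1); last field.
have -> : RInt (cosc (2 * PI * (INR 2 * (INR m.+1 * INR M.+1)))) 0 (1 / 2) =
  RInt (fun u => 2 * INR M.+1 * cosc (freq m) (2 * INR M.+1 * u)) 0 (1 / 2).
  apply: RIntR_ext_open; first lra; move=> u hu; rewrite /cosc.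
  have -> : freq m * (2 * INR M.+1 * u) = 2 * PI * (INR 2 * (INR m.+1 * INR M.+1)) * u.
    by rewrite (_ : INR 2 = 2); [ring | rewrite /=; ring].
  by field; lra.
lra.
Qed.

Lemma sinw_lim m : is_lim_seq (fun M => RInt (sinw (freq m)) 0 (INR M)) (PI / 2).
Proof.
have hpi := PI_RGT_0; have hm := INR_ge1 m.
apply/is_lim_seq_incr_1.
have h := lim_subseq (phi := fun M => (2 * (m.+1 * M.+1)).-1) _ cq_sin_lim.
have {}h := h (fun n => ltac:(lia)).
have := is_lim_seq_plus' _ _ _ _ (is_lim_seq_const (PI / 2)) h.
rewrite Rplus_0_r; apply: is_lim_seq_ext => M.
have hM := INR_ge1 M.
rewrite -RInt_sinw_half.
have -> : ((2 * (m.+1 * M.+1)).-1.+1 = 2 * (m.+1 * M.+1))%N by lia.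
rewrite !mult_INR.
have -> : INR M.+1 = 2 * INR M.+1 * (1 / 2) by field.
rewrite RInt_dilate; last exact: cont_sinw.
rewrite (_ : 2 * INR M.+1 * (1 / 2) = INR M.+1); last field.
apply: RIntR_ext => u; rewrite /sinw.
rewrite (_ : INR 2 = 2); last by rewrite /=; ring.
rewrite (_ : 2 * PI * (2 * (INR m.+1 * INR M.+1)) * u = freq m * (2 * INR M.+1 * u)); last ring.
ring.
Qed.

(** * Fourier coefficients of the derivative of the Hurwitz zeta function *)

(* psi N j is the j-th derivative of t^N / N^2 - t^N ln t / N, whose first
   derivative is - t^(N-1) ln t. *)
Fixpoint pa (N j : nat) : R := if j is i.+1 then (INR N - INR i) * pa N i else - / INR N.
Fixpoint pd (N j : nat) : R :=
  if j is i.+1 then (INR N - INR i) * pd N i + pa N i else / INR N ^ 2.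

Lemma paS N j : pa N j.+1 = (INR N - INR j) * pa N j. Proof. by []. Qed.
Lemma pdS N j : pd N j.+1 = (INR N - INR j) * pd N j + pa N j. Proof. by []. Qed.

Definition psi (N j : nat) (t : R) : R := t ^ (N - j) * (pa N j * ln t + pd N j).

(** Differentiating the logarithm in [t ^ k * ln t] feeds [pa] into [pd], which therefore
    accumulates inverses of integers. This is the origin of the harmonic number in the theorem. *)
Lemma pa_pd_closed_form N j : (j < N)%N ->
  pa N j.+1 * INR (N - j.+1)`! = - INR (N.-1)`! /\
  pd N j.+1 = pa N j.+1 * (harmonic N.-1 - harmonic (N - j.+1)).
Proof.
move=> hj; have hN : 0 < INR N by apply: lt_0_INR; apply/ltP; lia.
elim: j hj => [|j IH] hj.
  rewrite subn1 /= Rminus_0_r; split; first by field; lra.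
  by rewrite /= ; field; lra.
have [|IH1 IH2] := IH; first lia.
have e : (N - j.+1 = (N - j.+2).+1)%N by lia.
have hNj : INR N - INR j.+1 = INR (N - j.+2).+1 by rewrite -e minus_INR //; apply/leP; lia.
split.
  by rewrite (paS N j.+1) hNj -IH1 e factS mult_INR; ring.
rewrite (pdS N j.+1) IH2 (paS N j.+1) hNj e harmonicS; have := INR_ge1 (N - j.+2) => h; field; lra.
Qed.

Lemma pa_N N : pa N.+1 N.+1 = - INR N`!.
Proof.
have [h _] := @pa_pd_closed_form N.+1 N (ltnSn N).
by move: h; rewrite subnn /= Rmult_1_r.
Qed.

Lemma pd_N N : pd N.+1 N.+1 = - INR N`! * harmonic N.
Proof.
have [_ h] := @pa_pd_closed_form N.+1 N (ltnSn N).
rewrite h pa_N subnn /harmonic (@big_geq _ _ _ 1 1) //=; ring.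
Qed.

Lemma pa_N1 N : pa N.+2 N.+1 = - INR (N.+1)`!.
Proof. by rewrite -(pa_N N.+1) (paS N.+2 N.+1) (S_INR N.+1); ring. Qed.

Lemma pow_derive k t : is_derive (fun t => t ^ k.+1) t (INR k.+1 * t ^ k).
Proof. by auto_derive => //; rewrite -[match k with 0%N => _ | _ => _ end]/(INR k.+1); ring. Qed.

Lemma psi_derive N j t : 0 < t -> (j < N)%N -> is_derive (psi N j) t (psi N j.+1 t).
Proof.
move=> ht hj; rewrite /psi.
have e : (N - j = (N - j.+1).+1)%N by lia.
have hNj : INR N - INR j = INR (N - j.+1).+1 by rewrite -e minus_INR //; apply/leP; lia.
have h1 := pow_derive (N - j.+1) t.
have h2 : is_derive (fun t => pa N j * ln t + pd N j) t (pa N j * / t) by auto_derive => //; ring.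
rewrite e; apply: derive_eq (derive_mult h1 h2).
rewrite paS pdS hNj -[t ^ (N - j.+1).+1]/(t * t ^ (N - j.+1)); field; lra.
Qed.

(* psiG extends psi to all orders, at the price of junk values at t = 0. *)
Definition psiG (N j : nat) (t : R) : R := t ^ N * / t ^ j * (pa N j * ln t + pd N j).

Lemma psiG_psi N j t : 0 < t -> (j <= N)%N -> psiG N j t = psi N j t.
Proof.
move=> ht hj; rewrite /psiG /psi -{1}(subnK hj) Rdef_pow_add.
by field; apply: pow_nonzero; lra.
Qed.

Lemma psiG_derive N j t : 0 < t -> is_derive (psiG N j) t (psiG N j.+1 t).
Proof.
move=> ht; rewrite /psiG.
have hp k : t ^ k <> 0 by apply: pow_nonzero; lra.
have h2 : is_derive (fun t => pa N j * ln t + pd N j) t (pa N j * / t) by auto_derive => //; ring.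
have h1 : is_derive (fun t => t ^ N * / t ^ j) t ((INR N - INR j) * (t ^ N * / t ^ j.+1)).
  have hpow k : is_derive (fun t => t ^ k) t (INR k * t ^ k / t).
    case: k => [|k]; first by rewrite /= !Rmult_0_l /Rdiv Rmult_0_l; exact: derive_const.
    by apply: derive_eq (pow_derive k t); rewrite -[t ^ k.+1]/(t * t ^ k); field; lra.
  have hi : is_derive (fun t => / t ^ j) t (- (INR j * t ^ j / t) / (t ^ j) ^ 2).
    by apply: is_derive_inv => //; exact: hpow.
  apply: derive_eq (derive_mult (hpow N) hi).
  rewrite -[t ^ j.+1]/(t * t ^ j); field; split; first [lra | exact: hp].
apply: derive_eq (derive_mult h1 h2).
rewrite paS pdS -[t ^ j.+1]/(t * t ^ j); field; split; first [lra | exact: hp].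
Qed.

(* Tends to zeta'(1 - N, x) as M grows. *)
Definition dzeta (N M : nat) (x : R) : R :=
  rsum (fun n => psi N 1 (INR n + x)) M - rsum (fun k => beta k x * psi N k (INR M)) N.+1.

Lemma dzeta_step N M x : (0 < N)%N -> 0 <= x <= 1 ->
  dzeta N M.+2 x - dzeta N M.+1 x = EM N.+1 (fun k t => psiG N k (INR M.+1 + t)) x.
Proof.
move=> hN hx; have hM := INR_ge1 M.
rewrite /dzeta /EM psiG_psi //; last lra.
rewrite -[rsum _ M.+2]/(rsum (fun n => psi N 1 (INR n + x)) M.+1 + psi N 1 (INR M.+1 + x)).
have -> : rsum (fun k => beta k x * (psiG N k (INR M.+1 + 1) - psiG N k (INR M.+1 + 0))) N.+1 =
  rsum (fun k => beta k x * psi N k (INR M.+2)) N.+1 - rsum (fun k => beta k x * psi N k (INR M.+1)) N.+1.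
  rewrite -rsum_minus; apply: rsum_ext => k hk.
  have hk' : (k <= N)%N by rewrite -ltnS.
  have h2 : 0 < INR M.+2 by have := INR_ge1 M.+1; lra.
  have h1 : 0 < INR M.+1 by lra.
  by rewrite Rplus_0_r -S_INR (psiG_psi h2 hk') (psiG_psi h1 hk'); ring.
ring.
Qed.

(** At order [N.+1] the remainder is governed by the derivative of order [N + 2], in which the
    logarithm has disappeared: it is a multiple of [t ^ (-2)]. The exponent is relaxed to 3/2, the
    one used for the other bounds. *)
Lemma dzeta_step_bound N : (0 < N)%N -> exists Cst, 0 <= Cst /\ forall M x, 0 <= x <= 1 ->
  Rabs (dzeta N M.+2 x - dzeta N M.+1 x) <= Cst * Rpower (INR M.+1) (- (3 / 2)).
Proof.
move=> hN; exists (Rabs (pd N N.+2)); split; first exact: Rabs_pos.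
move=> M x hx; have hM := INR_ge1 M.
rewrite dzeta_step //; apply: EM_bound => // [k t ht|t ht].
  by apply: (derive_shift (f := psiG N k)); apply: psiG_derive; lra.
set u := INR M.+1 + t; have hu : 1 <= u by rewrite /u; lra.
have ha : pa N N.+2 = 0 by rewrite paS paS Rminus_diag; ring.
have hup : 0 < u ^ N by apply: pow_lt; lra.
have -> : psiG N N.+2 u = pd N N.+2 * / u ^ 2.
  by rewrite /psiG ha -[u ^ N.+2]/(u * (u * u ^ N)) /=; field; split; lra.
rewrite Rabs_mult; apply: Rmult_le_compat_l; first exact: Rabs_pos.
rewrite Rabs_pos_eq; last by apply: Rlt_le; apply: Rinv_0_lt_compat; apply: pow_lt; lra.
apply: (Rle_trans _ (/ INR M.+1 ^ 2)).
  apply: Rinv_le_contravar; first by apply: pow_lt; lra.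
  by apply: pow_incr; rewrite /u; lra.
have -> : / INR M.+1 ^ 2 = Rpower (INR M.+1) (- INR 2) by rewrite Rpower_Ropp Rpower_pow //; lra.
apply: exp_le; apply: Rmult_le_compat_r; first exact: ln_ge0.
rewrite /=; lra.
Qed.

Lemma cont_comp_lin (f : R -> R) a b : cont f -> cont (fun x => f (a * x + b)).
Proof.
move=> hf x; apply: (continuous_comp (fun x => a * x + b) f); last exact: hf.
by apply: cont_deriv => y; auto_derive.
Qed.

Lemma cont_shift (f : R -> R) a : cont f -> cont (fun x => f (a + x)).
Proof.
move=> hf; apply: (cont_ext (f := fun x => f (1 * x + a))); last exact: cont_comp_lin.
by move=> x; congr f; ring.
Qed.
#[local] Hint Resolve cont_shift : cont.

(* ln vanishes on the nonpositive reals, hence continuity on all of R. *)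
Lemma cont_tlnt : cont (fun t => t * ln t).
Proof.
move=> t.
have ln_neg s : s <= 0 -> ln s = 0 by rewrite /ln; case: Rlt_dec => [h hs|//]; exfalso; lra.
case: (Rtotal_order t 0) => [ht | [-> | ht]].
- apply: (continuous_ext_loc _ (fun _ => 0)); last exact: continuous_const.
  have hp : 0 < - t by lra.
  exists (mkposreal _ hp) => y hy; have {}hy : Rabs (y - t) < - t by exact: hy.
  by have := Rabs_def2 _ _ hy => h; rewrite ln_neg ?Rmult_0_r //; lra.
- apply/filterlim_locally => eps.
  have he := cond_pos eps.
  (* With [s = sqrt y] one has [Rabs (y * ln y) = 2 * s * Rabs (s * ln s) <= 2 * s], the last step
     from [ln (/ s) <= / s - 1]; hence the square. *)
  pose d := Rmin 1 ((eps / 4) ^ 2).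
  have hd : 0 < d by apply: Rmin_pos; [lra | apply: pow_lt; lra].
  exists (mkposreal _ hd) => y hy; have {}hy : Rabs (y - 0) < d by exact: hy.
  suff : Rabs (y * ln y - 0 * ln 0) < eps by [].
  rewrite Rmult_0_l Rminus_0_r; rewrite Rminus_0_r in hy.
  case: (Rle_dec y 0) => hy0; first by rewrite ln_neg // Rmult_0_r Rabs_R0.
  have hy1 : 0 < y by lra.
  rewrite Rabs_pos_eq in hy; last lra.
  have d1 := Rmin_l 1 ((eps / 4) ^ 2); have d2 := Rmin_r 1 ((eps / 4) ^ 2).
  have hyd : y < 1 by rewrite /d in hy; lra.
  have hye : y < (eps / 4) ^ 2 by rewrite /d in hy; lra.
  pose s := sqrt y.
  have hs : 0 < s by exact: sqrt_lt_R0.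
  have es : y = s * s by rewrite /s sqrt_sqrt; lra.
  have hse : s < eps / 4.
    apply: Rnot_le_lt => hle; have : (eps / 4) ^ 2 <= s ^ 2 by apply: pow_incr; lra.
    by rewrite -[s ^ 2]/(s * (s * 1)); lra.
  have hs1 : s < 1 by apply: Rnot_le_lt => hle; nra.
  have hl : ln (/ s) <= / s - 1 by apply: ln_le_sub1; exact: Rinv_0_lt_compat.
  rewrite ln_Rinv // in hl.
  have hl0 : ln s <= 0 by rewrite -ln_1; apply: ln_le; lra.
  have ey : ln y = 2 * ln s by rewrite es ln_mult //; ring.
  have e1 : s * / s = 1 by field; lra.
  have h1 : - (s * ln s) <= 1.
    have := Rmult_le_compat_l _ _ _ (Rlt_le _ _ hs) hl; nra.
  rewrite ey Rabs_left1; last by nra.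
  have h2 : s * (- (s * ln s)) <= s * 1 by apply: Rmult_le_compat_l; lra.
  have -> : - (y * (2 * ln s)) = 2 * (s * - (s * ln s)) by rewrite es; ring.
  lra.
by apply: (ex_derive_continuous (V := R_NormedModule)); auto_derive.
Qed.
#[local] Hint Resolve cont_tlnt : cont.

Lemma psi_cont N j : (j < N)%N -> cont (psi N j).
Proof.
move=> hj; have e : (N - j = (N - j.+1).+1)%N by lia.
apply: (cont_ext (f := fun t => t ^ (N - j.+1) * (pa N j * (t * ln t) + pd N j * t))).
  by move=> t; rewrite /psi e -[t ^ (_).+1]/(t * t ^ (N - j.+1)); ring.
apply: cont_mult; first by apply: cont_pow; exact: cont_id.
by prove_cont.
Qed.

Lemma psi_0 N j : (j < N)%N -> psi N j 0 = 0.
Proof.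
by move=> hj; have e : (N - j = (N - j.+1).+1)%N by [lia]; rewrite /psi e /= !Rmult_0_l.
Qed.

(* The j-th derivative of dzeta N M. *)
Definition dzeta_deriv (N j M : nat) (x : R) : R :=
  rsum (fun n => psi N j.+1 (INR n + x)) M
  - rsum (fun k => beta k x * psi N (k + j) (INR M)) (N - j).+1.

Lemma dzeta_deriv0 N M x : dzeta N M x = dzeta_deriv N 0 M x.
Proof.
rewrite /dzeta /dzeta_deriv subn0; congr (_ - _); apply: rsum_ext => k _.
by rewrite addn0.
Qed.

Lemma beta_contf k : cont (beta k).
Proof. by move=> x; exact: beta_cont. Qed.
#[local] Hint Resolve beta_contf : cont.

Lemma dzeta_deriv_cont N j M : (j.+1 < N)%N -> cont (dzeta_deriv N j M).
Proof.
move=> hj; apply: cont_minus.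
  by apply: (cont_rsum (f := fun n x => psi N j.+1 (INR n + x))) => n _;
     apply: cont_shift; exact: psi_cont.
apply: (cont_rsum (f := fun k x => beta k x * psi N (k + j) (INR M))) => k _.
by prove_cont.
Qed.

Lemma derive_beta_sum (c : nat -> R) K x :
  is_derive (fun x => rsum (fun k => beta k x * c k) K.+1) x (rsum (fun k => beta k x * c k.+1) K).
Proof.
have -> : rsum (fun k => beta k x * c k.+1) K =
   rsum (fun k => (if k is i.+1 then beta i x else 0) * c k) K.+1 by rewrite rsum_recl; ring.
apply: (is_derive_rsum (f := fun k x => beta k x * c k)
   (df := fun k x => (if k is i.+1 then beta i x else 0) * c k)) => -[|k] _.
  rewrite Rmult_0_l; apply: (derive_ext (f := fun _ => c 0%N)) => [t|]; first by rewrite /=; ring.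
  exact: derive_const.
apply: (derive_ext (f := fun x => c k.+1 * beta k.+1 x)) => [t|]; first ring.
by rewrite Rmult_comm; apply: derive_scal; exact: beta_deriv.
Qed.

Lemma dzeta_deriv_derive N j M x : (j.+1 < N)%N -> 0 < x < 1 -> is_derive (dzeta_deriv N j M) x (dzeta_deriv N j.+1 M x).
Proof.
move=> hj hx; apply: derive_minus.
  apply: (is_derive_rsum (f := fun n x => psi N j.+1 (INR n + x))
    (df := fun n x => psi N j.+2 (INR n + x))) => n _.
  apply: (derive_shift (f := psi N j.+1)); apply: psi_derive => //.
  by have := pos_INR n; lra.
have e : (N - j = (N - j.+1).+1)%N by lia.
rewrite e (@rsum_ext (fun k => beta k x * psi N (k + j.+1) (INR M)) (fun k => beta k x * psi N (k.+1 + j) (INR M))).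
  exact: (derive_beta_sum (fun k => psi N (k + j) (INR M))).
by move=> k _; rewrite addnS addSn.
Qed.

Lemma rsum_telescope (u : nat -> R) n : rsum (fun k => u k.+1 - u k) n = u n - u 0%N.
Proof. by elim: n => /= [|n ->]; ring. Qed.

(** Passing from 0 to 1 shifts the sum over [n] by one step and changes it by the value of
    [psi N j.+1] at [M], the value at 0 being 0 for [j.+1 < N]. The jump of [beta 1] removes exactly
    this amount. *)
Lemma dzeta_deriv_periodic N j M : (j.+1 < N)%N -> dzeta_deriv N j M 1 = dzeta_deriv N j M 0.
Proof.
move=> hj; suff : dzeta_deriv N j M 1 - dzeta_deriv N j M 0 = 0 by lra.
rewrite /dzeta_deriv.
have -> (a b c d : R) : a - b - (c - d) = (a - c) - (b - d) by ring.
rewrite -!rsum_minus.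
rewrite (@rsum_ext _ (fun n => psi N j.+1 (INR n.+1) - psi N j.+1 (INR n))); last first.
  by move=> n _; rewrite S_INR Rplus_0_r.
rewrite (rsum_telescope (fun n => psi N j.+1 (INR n))) psi_0 //.
have e : ((N - j).+1 = (N - j.+2).+3)%N by lia.
rewrite e !rsum_recl !beta1 (@rsum_ext _ (fun _ => 0)).
  have -> : rsum (fun _ => 0) (N - j.+2) = 0 by elim: (N - j.+2)%N => //= k ->; ring.
  by rewrite (beta_per 0) [beta 0 1]/= [beta 0 0]/= add1n; field.
by move=> k _; rewrite beta_per; ring.
Qed.

(** The same cancellation, applied one order lower to an explicit primitive. *)
Lemma dzeta_deriv_mean N M : (1 < N)%N -> RInt (dzeta_deriv N 0 M) 0 1 = 0.
Proof.
move=> hN.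
pose f x := rsum (fun n => psi N 0 (INR n + x)) M - rsum (fun k => beta k.+1 x * psi N k (INR M)) N.+1.
have h : is_RInt (dzeta_deriv N 0 M) 0 1 (f 1 - f 0).
  apply: FTC_open; [lra | | | exact: dzeta_deriv_cont].
    move=> x hx; apply: derive_minus.
      apply: (is_derive_rsum (f := fun n x => psi N 0 (INR n + x))
        (df := fun n x => psi N 1 (INR n + x))) => n _.
      apply: (derive_shift (f := psi N 0)); apply: psi_derive; last lia.
      by have := pos_INR n; lra.
    rewrite subn0; apply: (is_derive_rsum (f := fun k x => beta k.+1 x * psi N k (INR M))
      (df := fun k x => beta k x * psi N (k + 0) (INR M))) => k _.
    rewrite addn0; apply: (derive_ext (f := fun x => psi N k (INR M) * beta k.+1 x)) => [t|]; first ring.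
    by rewrite Rmult_comm; apply: derive_scal; exact: beta_deriv.
  move=> x _; apply/continuity_pt_filterlim; apply: (cont_minus (f := fun x => rsum (fun n => psi N 0 (INR n + x)) M)).
    apply: (cont_rsum (f := fun n x => psi N 0 (INR n + x))) => n _.
    by apply: cont_shift; apply: psi_cont; lia.
  apply: (cont_rsum (f := fun k x => beta k.+1 x * psi N k (INR M))) => k _.
  by prove_cont.
rewrite (is_RInt_unique _ _ _ _ h); apply: eq_at_R.
rewrite /f (_ : forall a b c d, a - b - (c - d) = (a - c) - (b - d)); last by move=> *; ring.
rewrite -!rsum_minus.
rewrite (@rsum_ext _ (fun n => psi N 0 (INR n.+1) - psi N 0 (INR n))); last first.
  by move=> n _; rewrite S_INR Rplus_0_r.
rewrite (rsum_telescope (fun n => psi N 0 (INR n))) psi_0; last lia.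
rewrite rsum_recl !beta1 (@rsum_ext _ (fun _ => 0)).
  have -> : rsum (fun _ => 0) N = 0 by elim: (N) => //= k ->; ring.
  by field.
by move=> k _; rewrite beta_per; ring.
Qed.

(** * Fourier coefficients by integration by parts *)

Lemma ibp_periodic (f g : R -> R) m : cont f -> cont g ->
  (forall x, 0 < x < 1 -> is_derive f x (g x)) -> f 1 = f 0 ->
  let w := freq m in
  RInt (fun x => f x * cos (w * x)) 0 1 = - RInt (fun x => g x * sin (w * x)) 0 1 / w /\
  RInt (fun x => f x * sin (w * x)) 0 1 = RInt (fun x => g x * cos (w * x)) 0 1 / w.
Proof.
move=> hf hg hd hp w; have hw : w <> 0 by exact: w_neq0.
have cw1 : cos (w * 1) = 1 by rewrite Rmult_1_r /w cos_2PI_INR.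
have sw1 : sin (w * 1) = 0 by rewrite Rmult_1_r /w sin_2PI_INR.
have c1 : cont (fun x => f x * cos (w * x)) by prove_cont.
have c2 : cont (fun x => g x * sin (w * x)) by prove_cont.
have c3 : cont (fun x => f x * sin (w * x)) by prove_cont.
have c4 : cont (fun x => g x * cos (w * x)) by prove_cont.
have cs (h : R -> R) : cont h -> forall x, 0 <= x <= 1 -> continuity_pt h x.
  by move=> ch x _; apply/continuity_pt_filterlim; exact: ch.
split.
  have h : is_RInt (fun x => g x * sin (w * x) + w * (f x * cos (w * x))) 0 1
     (f 1 * sin (w * 1) - f 0 * sin (w * 0)).
    apply: (FTC_open (f := fun x => f x * sin (w * x))); [lra | | exact: cs | ].
      move=> x hx; have h2 : is_derive (fun x => sin (w * x)) x (w * cos (w * x)) by auto_derive => //; ring.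
      by apply: derive_eq (derive_mult (hd x hx) h2); ring.
    by prove_cont.
  have := is_RInt_unique _ _ _ _ h; rewrite RIntR_plus //; last by prove_cont.
  rewrite RIntR_scal // sw1 !Rmult_0_r sin_0 => e; apply: eq_at_R; move: e.
  set A := RInt _ 0 1; set B := RInt _ 0 1 => e.
  have {}e : A + w * B = 0 by rewrite e; ring.
  by apply: (Rmult_eq_reg_l w) => //; field_simplify_eq => //; lra.
have h : is_RInt (fun x => g x * cos (w * x) - w * (f x * sin (w * x))) 0 1
     (f 1 * cos (w * 1) - f 0 * cos (w * 0)).
  apply: (FTC_open (f := fun x => f x * cos (w * x))); [lra | | exact: cs | ].
    move=> x hx; have h2 : is_derive (fun x => cos (w * x)) x (- w * sin (w * x)) by auto_derive => //; ring.
    by apply: derive_eq (derive_mult (hd x hx) h2); ring.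
  by prove_cont.
have := is_RInt_unique _ _ _ _ h; rewrite RIntR_minus //; last by prove_cont.
rewrite RIntR_scal // cw1 Rmult_0_r cos_0 hp => e; apply: eq_at_R; move: e.
set A := RInt _ 0 1; set B := RInt _ 0 1 => e.
have {}e : A - w * B = 0 by rewrite e; ring.
by apply: (Rmult_eq_reg_l w) => //; field_simplify_eq => //; lra.
Qed.

Lemma beta1_cos m : let w := freq m in RInt (fun x => beta 1 x * cos (w * x)) 0 1 = 0.
Proof.
move=> w; have hw : w <> 0 by exact: w_neq0.
have h : is_RInt (fun x => beta 1 x * cos (w * x)) 0 1
   (((1 - 1 / 2) * sin (w * 1) / w + cos (w * 1) / w ^ 2) - ((0 - 1 / 2) * sin (w * 0) / w + cos (w * 0) / w ^ 2)).
  apply: (FTC (f := fun x => (x - 1 / 2) * sin (w * x) / w + cos (w * x) / w ^ 2)); first lra.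
    by move=> t; rewrite beta1; auto_derive => //; field.
  by prove_cont.
rewrite (is_RInt_unique _ _ _ _ h) Rmult_1_r /w cos_2PI_INR sin_2PI_INR -/w !Rmult_0_r sin_0 cos_0.
by apply: eq_at_R; field.
Qed.

Lemma beta1_sin m : let w := freq m in RInt (fun x => beta 1 x * sin (w * x)) 0 1 = - / w.
Proof.
move=> w; have hw : w <> 0 by exact: w_neq0.
have h : is_RInt (fun x => beta 1 x * sin (w * x)) 0 1
   ((- (1 - 1 / 2) * cos (w * 1) / w + sin (w * 1) / w ^ 2) - (- (0 - 1 / 2) * cos (w * 0) / w + sin (w * 0) / w ^ 2)).
  apply: (FTC (f := fun x => - (x - 1 / 2) * cos (w * x) / w + sin (w * x) / w ^ 2)); first lra.
    by move=> t; rewrite beta1; auto_derive => //; field.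
  by prove_cont.
rewrite (is_RInt_unique _ _ _ _ h) Rmult_1_r /w cos_2PI_INR sin_2PI_INR -/w !Rmult_0_r sin_0 cos_0.
by apply: eq_at_R; field.
Qed.

Lemma beta2_trig m : let w := freq m in
  RInt (fun x => beta 2 x * cos (w * x)) 0 1 = / w ^ 2 /\
  RInt (fun x => beta 2 x * sin (w * x)) 0 1 = 0.
Proof.
move=> w; have hw : w <> 0 by exact: w_neq0.
have [h1 h2] := @ibp_periodic (beta 2) (beta 1) m (@beta_contf 2) (@beta_contf 1)
  (fun x _ => beta_deriv 1 x) (beta_per 0).
rewrite h1 h2 beta1_sin beta1_cos; split; apply: eq_at_R; rewrite -/w; field => //.
Qed.

Lemma RInt_unroll (g h : R -> R) M : cont g -> cont h ->
  (forall i x, h (INR i + x) = h x) ->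
  RInt (fun x => rsum (fun i => g (INR i + x)) M * h x) 0 1 = RInt (fun t => g t * h t) 0 (INR M).
Proof.
move=> hg hh hp.
have cgh : cont (fun t => g t * h t) by exact: cont_mult.
have cs i : cont (fun x => g (INR i + x)) by exact: cont_shift.
elim: M => [|M IH].
  rewrite RInt_point (@RIntR_ext _ (fun _ => 0)); last by move=> x /=; ring.
  by rewrite RIntR_const Rmult_0_l.
rewrite -(@RIntR_Chasles (fun t => g t * h t) 0 (INR M) (INR M.+1)) // -IH.
have -> : RInt (fun t => g t * h t) (INR M) (INR M.+1) = RInt (fun x => g (INR M + x) * h x) 0 1.
  have := @RInt_comp_lin R_CompleteNormedModule (fun t => g t * h t) 1 (INR M) 0 1.
  rewrite Rmult_0_r !Rmult_1_r Rplus_0_l (Rplus_comm 1) -S_INR => <-; last exact: RInt_cont_ex.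
  apply: RIntR_ext => x; rewrite /scal /= /mult /= Rmult_1_l (Rplus_comm (1 * x)) hp.
  by rewrite !Rmult_1_l.
rewrite -RIntR_plus.
- by apply: RIntR_ext => x /=; ring.
- by apply: cont_mult => //; apply: (cont_rsum (f := fun i x => g (INR i + x))).
- exact: cont_mult.
Qed.

Lemma cont_tlin p q : cont (fun t => t ^ 1 * (p * ln t + q)).
Proof.
apply: (cont_ext (f := fun t => p * (t * ln t) + q * t)); first by move=> t; ring.
by prove_cont.
Qed.
#[local] Hint Resolve cont_tlin : cont.

Lemma cont_continuity_pt (f : R -> R) : cont f -> forall x, continuity_pt f x.
Proof. by move=> h x; apply/continuity_pt_filterlim; exact: h. Qed.

Lemma RInt_tlnt_cos p q m M : let w := freq m in
  RInt (fun t => t ^ 1 * (p * ln t + q) * cos (w * t)) 0 (INR M) =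
  p / w ^ 2 * RInt (cosc w) 0 (INR M).
Proof.
move=> w; have hw : w <> 0 by exact: w_neq0.
(* The term [t * ln t * cosc w t] is [ln t * (1 - cos (w * t))]: it absorbs the [ln t * sin (w * t)]
   left by the first integration by parts. The factor [t * ln t] keeps [K] continuous at 0. *)
pose K t := p * (t * ln t * sin (w * t) / w - t * ln t * cosc w t / w ^ 2)
   + q * (t * sin (w * t) / w + cos (w * t) / w ^ 2).
have cg : cont (fun t => t ^ 1 * (p * ln t + q) * cos (w * t)).
  by prove_cont.
have c2 : cont (fun t => p / w * sin (w * t)) by prove_cont.
have c3 : cont (fun t => p / w ^ 2 * cosc w t) by prove_cont.
have hM := pos_INR M.
have wM : w * INR M = 2 * PI * INR (m.+1 * M) by rewrite mult_INR /w; ring.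
have h : is_RInt (fun t => t ^ 1 * (p * ln t + q) * cos (w * t) + p / w * sin (w * t) - p / w ^ 2 * cosc w t)
   0 (INR M) (K (INR M) - K 0).
  apply: FTC_open => //.
  - move=> t ht; rewrite /K /cosc; auto_derive; first by repeat split => //; lra.
    by field; split; lra.
  - move=> t _; apply: cont_continuity_pt; apply: (cont_ext (f := fun t => p / w * (t * ln t * sin (w * t))
      - p / w ^ 2 * (t * ln t * cosc w t) + (q / w * (t * sin (w * t)) + q / w ^ 2 * cos (w * t)))).
      by move=> y; rewrite /K; field.
    by prove_cont.
  - by prove_cont.
have := is_RInt_unique _ _ _ _ h.
rewrite (RIntR_minus _ _ (cont_plus cg c2) c3) (RIntR_plus _ _ cg c2) (RIntR_scal _ _ _ (@cont_sin w)) (RIntR_scal _ _ _ (@cont_cosc w)).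
rewrite RInt_sin_w // Rmult_0_r cos_0 wM cos_2PI_INR.
have -> : K (INR M) - K 0 = 0.
  rewrite /K /cosc wM sin_2PI_INR cos_2PI_INR !Rmult_0_r sin_0 cos_0 /Rdiv !Rminus_diag; ring.
set A := RInt _ _ _; set B := RInt _ _ _ => e.
have {}e : A + p / w * ((1 - 1) / w) - p / w ^ 2 * B = 0 by exact: e.
apply: eq_at_R; have : p / w * ((1 - 1) / w) = 0 by field.
lra.
Qed.

Lemma RInt_tlnt_sin p q m M : let w := freq m in
  RInt (fun t => t ^ 1 * (p * ln t + q) * sin (w * t)) 0 (INR M) =
  - (INR M ^ 1 * (p * ln (INR M) + q)) / w - p / w ^ 2 * RInt (sinw w) 0 (INR M).
Proof.
move=> w; have hw : w <> 0 by exact: w_neq0.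
(* As in the cosine case, [t * ln t * sinw w t] stands for [ln t * sin (w * t)] in a form continuous
   at 0. This time [t * ln t * cos (w * t)] survives at the end [M]. *)
pose K t := p * (- (t * ln t) * cos (w * t) / w + t * ln t * sinw w t / w ^ 2)
   + q * (- t * cos (w * t) / w + sin (w * t) / w ^ 2).
have cg : cont (fun t => t ^ 1 * (p * ln t + q) * sin (w * t)).
  by prove_cont.
have c2 : cont (fun t => p / w * cos (w * t)) by prove_cont.
have c3 : cont (fun t => p / w ^ 2 * sinw w t) by prove_cont.
have hM := pos_INR M.
have wM : w * INR M = 2 * PI * INR (m.+1 * M) by rewrite mult_INR /w; ring.
have h : is_RInt (fun t => t ^ 1 * (p * ln t + q) * sin (w * t) - p / w * cos (w * t) + p / w ^ 2 * sinw w t)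
   0 (INR M) (K (INR M) - K 0).
  apply: FTC_open => //.
  - move=> t ht; have ht0 : t <> 0 by lra.
    apply: (is_derive_ext_loc (fun t => p * (- (t * ln t) * cos (w * t) / w + t * ln t * (sin (w * t) / t) / w ^ 2)
       + q * (- t * cos (w * t) / w + sin (w * t) / w ^ 2))).
      by apply: filter_imp (locally_neq0 ht0) => y hy; rewrite /K sinw_neq.
    rewrite sinw_neq //; auto_derive; first by repeat split => //; lra.
    by field; split; lra.
  - move=> t _; apply: cont_continuity_pt; apply: (cont_ext (f := fun t => - p / w * (t * ln t * cos (w * t))
      + p / w ^ 2 * (t * ln t * sinw w t) + (- q / w * (t * cos (w * t)) + q / w ^ 2 * sin (w * t)))).
      by move=> y; rewrite /K; field.
    by prove_cont.
  - by prove_cont.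
have := is_RInt_unique _ _ _ _ h.
rewrite (RIntR_plus _ _ (cont_minus cg c2) c3) (RIntR_minus _ _ cg c2) (RIntR_scal _ _ _ (@cont_cos w)) (RIntR_scal _ _ _ (@cont_sinw w)).
rewrite RInt_cos_w // Rmult_0_r sin_0 wM sin_2PI_INR.
have -> : K (INR M) - K 0 = - (INR M ^ 1 * (p * ln (INR M) + q)) / w.
  have e0 : INR M * ln (INR M) * sinw w (INR M) = 0.
    case: M {h hM wM} => [|M]; first by rewrite /=; ring.
    have hM := INR_ge1 M.
    have wM : w * INR M.+1 = 2 * PI * INR (m.+1 * M.+1) by rewrite mult_INR /w; ring.
    by rewrite sinw_neq //; [rewrite wM sin_2PI_INR /Rdiv; ring | lra].
  rewrite /K e0 wM sin_2PI_INR cos_2PI_INR !Rmult_0_l Rmult_0_r sin_0 cos_0.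
  by field.
set A := RInt _ _ _; set B := RInt _ _ _ => e.
have {}e : A - p / w * ((0 - 0) / w) + p / w ^ 2 * B = - (INR M ^ 1 * (p * ln (INR M) + q)) / w by exact: e.
apply: eq_at_R; have : p / w * ((0 - 0) / w) = 0 by field.
lra.
Qed.

Definition cos_coef (N j m M : nat) : R := RInt (fun x => dzeta_deriv N j M x * cos (freq m * x)) 0 1.
Definition sin_coef (N j m M : nat) : R := RInt (fun x => dzeta_deriv N j M x * sin (freq m * x)) 0 1.

Lemma cos_per_INR m i x : cos (freq m * (INR i + x)) = cos (freq m * x).
Proof.
rewrite Rmult_plus_distr_l cos_plus (_ : freq m * INR i = 2 * PI * INR (m.+1 * i)).
  by rewrite cos_2PI_INR sin_2PI_INR; ring.
by rewrite mult_INR; ring.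
Qed.

Lemma sin_per_INR m i x : sin (freq m * (INR i + x)) = sin (freq m * x).
Proof.
rewrite Rmult_plus_distr_l sin_plus (_ : freq m * INR i = 2 * PI * INR (m.+1 * i)).
  by rewrite cos_2PI_INR sin_2PI_INR; ring.
by rewrite mult_INR; ring.
Qed.

(** Two orders below the top only [beta 0], [beta 1] and [beta 2] occur, so each coefficient is an
    integral over [0, M] plus explicit terms. *)
Lemma dzeta_deriv_base_split n M (h : R -> R) : cont h ->
  RInt (fun x => dzeta_deriv n.+2 n M x * h x) 0 1 =
  RInt (fun x => rsum (fun i => psi n.+2 n.+1 (INR i + x)) M * h x) 0 1
  - (psi n.+2 n (INR M) * RInt h 0 1 + psi n.+2 n.+1 (INR M) * RInt (fun x => beta 1 x * h x) 0 1
     + psi n.+2 n.+2 (INR M) * RInt (fun x => beta 2 x * h x) 0 1).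
Proof.
move=> hh.
have c0 : cont (fun x => rsum (fun i => psi n.+2 n.+1 (INR i + x)) M * h x).
  apply: cont_mult => //; apply: (cont_rsum (f := fun i x => psi n.+2 n.+1 (INR i + x))) => i _.
  by apply: cont_shift; exact: psi_cont.
have cb k : cont (fun x => beta k x * h x) by prove_cont.
have cs a k : cont (fun x => a * (beta k x * h x)) by prove_cont.
have cs0 a : cont (fun x => a * h x) by prove_cont.
rewrite -!RIntR_scal // -!RIntR_plus // -?RIntR_minus //; [|by prove_cont | exact: cont_plus].
apply: RIntR_ext => x; rewrite /dzeta_deriv (_ : (n.+2 - n).+1 = 3)%N; last lia.
by rewrite /rsum -/rsum [beta 0 x]/= add0n add1n add2n; ring.
Qed.

Lemma psi_lin n t : psi n.+2 n.+1 t = t ^ 1 * (- INR (n.+1)`! * ln t + pd n.+2 n.+1).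
Proof. by rewrite /psi pa_N1 (_ : n.+2 - n.+1 = 1)%N //; lia. Qed.

Lemma psi_top n t : psi n.+2 n.+2 t = - INR (n.+1)`! * (ln t + harmonic n.+1).
Proof. by rewrite /psi subnn pa_N pd_N /=; ring. Qed.

Lemma RInt_cos_full m : RInt (fun x => cos (freq m * x)) 0 1 = 0.
Proof.
rewrite RInt_cos_w; last exact: w_neq0.
by rewrite Rmult_1_r Rmult_0_r sin_2PI_INR sin_0; apply: eq_at_R; rewrite /Rdiv; ring.
Qed.

Lemma RInt_sin_full m : RInt (fun x => sin (freq m * x)) 0 1 = 0.
Proof.
rewrite RInt_sin_w; last exact: w_neq0.
by rewrite Rmult_1_r Rmult_0_r cos_2PI_INR cos_0; apply: eq_at_R; rewrite /Rdiv; ring.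
Qed.

(* The limits of the Fourier coefficients of dzeta_deriv n.+2 n. *)
Definition c_base (n m : nat) : R :=
  - INR (n.+1)`! / (freq m) ^ 2 * (euler_gamma + ln (freq m) - harmonic n.+1).
Definition s_base (n m : nat) : R := INR (n.+1)`! / (freq m) ^ 2 * (PI / 2).

(** The [beta 2] term carries [ln M + harmonic n.+1]: its logarithm cancels the growth of the
    integral of [cosc], and its constant enters the limit. *)
Lemma cos_coef_base n m : is_lim_seq (cos_coef n.+2 n m) (c_base n m).
Proof.
set w := freq m; have hw : w <> 0 by exact: w_neq0.
have h := is_lim_seq_scal_l _ (- INR (n.+1)`! / w ^ 2) _
   (is_lim_seq_minus' _ _ _ _ (@cosc_lim m) (is_lim_seq_const (harmonic n.+1))).
apply: is_lim_seq_ext h => M.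
rewrite /cos_coef dzeta_deriv_base_split; last exact: cont_cos.
rewrite (@RInt_unroll (psi n.+2 n.+1) (fun x => cos (w * x))); [ | exact: psi_cont | exact: cont_cos | exact: cos_per_INR].
rewrite (@RIntR_ext (fun t => psi n.+2 n.+1 t * cos (w * t)) (fun t => t ^ 1 * (- INR (n.+1)`! * ln t + pd n.+2 n.+1) * cos (w * t))); last first.
  by move=> t; rewrite psi_lin.
rewrite RInt_tlnt_cos RInt_cos_full beta1_cos (@beta2_trig m).1 psi_top -/w.
by field.
Qed.

(** The boundary term at [M] of the integral is cancelled by the [beta 1] term, so only the integral
    of [sinw] is left. *)
Lemma sin_coef_base n m : is_lim_seq (sin_coef n.+2 n m) (s_base n m).
Proof.
set w := freq m; have hw : w <> 0 by exact: w_neq0.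
have h := is_lim_seq_scal_l _ (INR (n.+1)`! / w ^ 2) _ (@sinw_lim m).
apply: is_lim_seq_ext h => M.
rewrite /sin_coef dzeta_deriv_base_split; last exact: cont_sin.
rewrite (@RInt_unroll (psi n.+2 n.+1) (fun x => sin (w * x))); [ | exact: psi_cont | exact: cont_sin | exact: sin_per_INR].
rewrite (@RIntR_ext (fun t => psi n.+2 n.+1 t * sin (w * t)) (fun t => t ^ 1 * (- INR (n.+1)`! * ln t + pd n.+2 n.+1) * sin (w * t))); last first.
  by move=> t; rewrite psi_lin.
rewrite RInt_tlnt_sin RInt_sin_full beta1_sin (@beta2_trig m).2 psi_lin -/w.
by field.
Qed.

(* The coefficients after i integrations of a function with coefficients c and s. *)
Fixpoint rot (w c s : R) (i : nat) : R * R :=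
  if i is j.+1 then (- (rot w c s j).2 / w, (rot w c s j).1 / w) else (c, s).

Lemma coef_lim n m i : (i <= n)%N ->
  let r := rot (freq m) (c_base n m) (s_base n m) i in
  is_lim_seq (cos_coef n.+2 (n - i) m) r.1 /\ is_lim_seq (sin_coef n.+2 (n - i) m) r.2.
Proof.
set w := freq m; have hw : w <> 0 by exact: w_neq0.
elim: i => [|i IH] hi /=; first by rewrite subn0; split; [exact: cos_coef_base | exact: sin_coef_base].
have [|h1 h2] := IH; first exact: ltnW.
have e : (n - i = (n - i.+1).+1)%N by lia.
set j := (n - i.+1)%N in e *.
have ib M := @ibp_periodic (dzeta_deriv n.+2 j M) (dzeta_deriv n.+2 j.+1 M) m (@dzeta_deriv_cont n.+2 j M ltac:(lia)) (@dzeta_deriv_cont n.+2 j.+1 M ltac:(lia))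
   (fun x hx => @dzeta_deriv_derive n.+2 j M x ltac:(lia) hx) (@dzeta_deriv_periodic n.+2 j M ltac:(lia)).
split.
  have := is_lim_seq_scal_l _ (- / w) _ h2.
  rewrite (_ : Rbar_mult _ _ = - (rot w (c_base n m) (s_base n m) i).2 / w); last by congr Finite; field.
  apply: is_lim_seq_ext => M.
  by rewrite /cos_coef (ib M).1 e /sin_coef -/w; field.
have := is_lim_seq_scal_l _ (/ w) _ h1.
rewrite (_ : Rbar_mult _ _ = (rot w (c_base n m) (s_base n m) i).1 / w); last by congr Finite; field.
apply: is_lim_seq_ext => M.
by rewrite /sin_coef (ib M).2 e /cos_coef -/w; field.
Qed.

(** Two integrations multiply both coefficients by [- / w ^ 2]; the alternating sign in the theorem
    stems from this and from the sign of [c_base]. *)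
Lemma rot_even w c s p : w <> 0 ->
  rot w c s (2 * p) = ((-1) ^ p * c / w ^ (2 * p), (-1) ^ p * s / w ^ (2 * p)).
Proof.
move=> hw; elim: p => [|p IH]; first by rewrite muln0 /=; congr (_, _); field.
have -> : (2 * p.+1 = (2 * p).+2)%N by lia.
have hp : w ^ (2 * p) <> 0 by exact: pow_nonzero.
rewrite -[rot w c s _.+2]/(- ((rot w c s (2 * p)).1 / w) / w, (- (rot w c s (2 * p)).2 / w) / w) IH /=.
by congr (_, _); field.
Qed.

(** * Orthogonality and partial Fourier sums *)

Lemma RInt_cosZ z : RInt (fun x => cos (2 * PI * IZR z * x)) 0 1 = if Z.eqb z 0 then 1 else 0.
Proof.
case: Z.eqb_spec => hz.
  rewrite hz (@RIntR_ext _ (fun _ => 1)); first by rewrite RIntR_const; apply: eq_at_R; ring.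
  by move=> x; rewrite Rmult_0_r Rmult_0_l cos_0.
have hpi := PI_RGT_0.
have hw : 2 * PI * IZR z <> 0.
  by apply: Rmult_integral_contrapositive_currified; [lra | exact: not_0_IZR].
rewrite RInt_cos_w // Rmult_1_r Rmult_0_r sin_0.
have -> : sin (2 * PI * IZR z) = 0.
  case: (ZArith_dec.Z_le_dec 0 z) => h.
    have -> : z = Z.of_nat (Z.to_nat z) by rewrite Znat.Z2Nat.id.
    by rewrite -INR_IZR_INZ sin_2PI_INR.
  have -> : z = Z.opp (Z.of_nat (Z.to_nat (- z))) by rewrite Znat.Z2Nat.id; lia.
  by rewrite opp_IZR -INR_IZR_INZ Ropp_mult_distr_r_reverse sin_neg sin_2PI_INR Ropp_0.
by apply: eq_at_R; rewrite /Rdiv; ring.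
Qed.

Lemma RInt_sinZ z : RInt (fun x => sin (2 * PI * IZR z * x)) 0 1 = 0.
Proof.
case: (Z.eqb_spec z 0) => hz.
  rewrite hz (@RIntR_ext _ (fun _ => 0)); first by rewrite RIntR_const; apply: eq_at_R; ring.
  by move=> x; rewrite Rmult_0_r Rmult_0_l sin_0.
have hpi := PI_RGT_0.
have hw : 2 * PI * IZR z <> 0.
  by apply: Rmult_integral_contrapositive_currified; [lra | exact: not_0_IZR].
rewrite RInt_sin_w // Rmult_1_r Rmult_0_r cos_0.
have -> : cos (2 * PI * IZR z) = 1.
  case: (ZArith_dec.Z_le_dec 0 z) => h.
    have -> : z = Z.of_nat (Z.to_nat z) by rewrite Znat.Z2Nat.id.
    by rewrite -INR_IZR_INZ cos_2PI_INR.
  have -> : z = Z.opp (Z.of_nat (Z.to_nat (- z))) by rewrite Znat.Z2Nat.id; lia.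
  by rewrite opp_IZR -INR_IZR_INZ Ropp_mult_distr_r_reverse cos_neg cos_2PI_INR.
by apply: eq_at_R; rewrite /Rdiv; ring.
Qed.

Lemma orthogonality k m :
  let C j x := cos (freq j * x) in let S j x := sin (freq j * x) in
  [/\ RInt (fun x => C k x * C m x) 0 1 = (if k == m then 1 / 2 else 0),
      RInt (fun x => S k x * S m x) 0 1 = (if k == m then 1 / 2 else 0)
    & RInt (fun x => S k x * C m x) 0 1 = 0].
Proof.
move=> C S.
(* The frequencies are [k.+1] and [m.+1]: the shifts cancel in the difference and add up to 2 in the
   sum. *)
pose z1 := (Z.of_nat k - Z.of_nat m)%Z; pose z2 := (Z.of_nat k + Z.of_nat m + 2)%Z.
have e1 x : 2 * PI * IZR z1 * x = freq k * x - freq m * x.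
  by rewrite /z1 minus_IZR -!INR_IZR_INZ !S_INR; ring.
have e2 x : 2 * PI * IZR z2 * x = freq k * x + freq m * x.
  by rewrite /z2 !plus_IZR -!INR_IZR_INZ !S_INR; ring.
have cc z : cont (fun x => / 2 * cos (2 * PI * IZR z * x)) by prove_cont.
have cs z : cont (fun x => / 2 * sin (2 * PI * IZR z * x)) by prove_cont.
have d1 : Z.eqb z1 0 = (k == m).
  by apply/idP/idP => [/Z.eqb_eq h | /eqP e]; [apply/eqP; rewrite /z1 in h; lia | rewrite /z1 e Z.sub_diag].
have d2 : Z.eqb z2 0 = false by apply/negP => /Z.eqb_eq h; rewrite /z2 in h; lia.
split.
- rewrite (@RIntR_ext _ (fun x => / 2 * cos (2 * PI * IZR z1 * x) + / 2 * cos (2 * PI * IZR z2 * x))).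
    rewrite RIntR_plus // !RIntR_scal; try exact: cont_cos; rewrite !RInt_cosZ d1 d2.
    by apply: eq_at_R; case: eqP => _; field.
  by move=> x; rewrite /C e1 e2 cos_plus cos_minus; field.
- rewrite (@RIntR_ext _ (fun x => / 2 * cos (2 * PI * IZR z1 * x) - / 2 * cos (2 * PI * IZR z2 * x))).
    rewrite RIntR_minus // !RIntR_scal; try exact: cont_cos; rewrite !RInt_cosZ d1 d2.
    by apply: eq_at_R; case: eqP => _; field.
  by move=> x; rewrite /S e1 e2 cos_plus cos_minus; field.
rewrite (@RIntR_ext _ (fun x => / 2 * sin (2 * PI * IZR z1 * x) + / 2 * sin (2 * PI * IZR z2 * x))).
  rewrite RIntR_plus // !RIntR_scal; try exact: cont_sin; rewrite !RInt_sinZ.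
  by apply: eq_at_R; field.
by move=> x; rewrite /S /C e1 e2 sin_plus sin_minus; field.
Qed.

Definition trig_poly (A B : nat -> R) (M : nat) (x : R) : R :=
  rsum (fun k => A k * cos (freq k * x) + B k * sin (freq k * x)) M.

Lemma rsum_indic (a : nat -> R) m M : (m < M)%N ->
  rsum (fun k => if k == m then a k else 0) M = a m.
Proof.
elim: M => // M IH; rewrite ltnS leq_eqVlt => /orP [/eqP <- | hlt] /=.
  rewrite eqxx (@rsum_ext _ (fun _ => 0)); last by move=> k hk; rewrite ltn_eqF.
  have -> : rsum (fun _ => 0) m = 0 by elim: (m) => //= k ->; ring.
  ring.
by rewrite IH // gtn_eqF //; ring.
Qed.

Lemma cont_trig_poly A B M : cont (trig_poly A B M).
Proof. by rewrite /trig_poly; prove_cont. Qed.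
#[local] Hint Resolve cont_trig_poly : cont.

Lemma RInt_trig_poly A B M (h : R -> R) : cont h ->
  RInt (fun x => trig_poly A B M x * h x) 0 1 =
  rsum (fun k => A k * RInt (fun x => cos (freq k * x) * h x) 0 1
     + B k * RInt (fun x => sin (freq k * x) * h x) 0 1) M.
Proof.
move=> hh.
have c1 k : cont (fun x => cos (freq k * x) * h x) by prove_cont.
have c2 k : cont (fun x => sin (freq k * x) * h x) by prove_cont.
rewrite (@RIntR_ext _ (fun x => rsum (fun k => A k * (cos (freq k * x) * h x)
   + B k * (sin (freq k * x) * h x)) M)); last first.
  by move=> x; rewrite /trig_poly Rmult_comm -rsum_scal; apply: rsum_ext => k _; ring.
rewrite (@RIntR_rsum (fun k x => A k * (cos (freq k * x) * h x)
   + B k * (sin (freq k * x) * h x))); last first.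
  by prove_cont.
apply: rsum_ext => k _; rewrite RIntR_plus; [|by prove_cont..].
by rewrite !RIntR_scal.
Qed.

Lemma trig_poly_cos A B m M : (m < M)%N ->
  RInt (fun x => trig_poly A B M x * cos (freq m * x)) 0 1 = A m / 2.
Proof.
move=> hm; rewrite RInt_trig_poly; last exact: cont_cos.
rewrite (@rsum_ext _ (fun k => if k == m then A k / 2 else 0)); first exact: rsum_indic.
move=> k _; have [-> _ ->] := orthogonality k m.
by apply: eq_at_R; case: eqP => _; field.
Qed.

Lemma trig_poly_sin A B m M : (m < M)%N ->
  RInt (fun x => trig_poly A B M x * sin (freq m * x)) 0 1 = B m / 2.
Proof.
move=> hm; rewrite RInt_trig_poly; last exact: cont_sin.
rewrite (@rsum_ext _ (fun k => if k == m then B k / 2 else 0)); first exact: rsum_indic.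
move=> k _; have [_ -> _] := orthogonality k m.
have [_ _ h] := orthogonality m k.
rewrite (@RIntR_ext (fun x => cos _ * sin _) (fun x => sin (freq m * x) * cos (freq k * x))).
  by rewrite h; apply: eq_at_R; case: eqP => _; field.
by move=> x; rewrite Rmult_comm.
Qed.

Lemma trig_poly_mean A B M : RInt (trig_poly A B M) 0 1 = 0.
Proof.
rewrite (@RIntR_ext _ (fun x => trig_poly A B M x * 1)); last by move=> x; ring.
rewrite (@RInt_trig_poly A B M (fun _ => 1)); last exact: cont_const.
rewrite (@rsum_ext _ (fun _ => 0)); first by elim: M => //= k ->; ring.
move=> k _; rewrite (@RIntR_ext (fun x => cos _ * 1) (fun x => cos (freq k * x))); last by move=> x; ring.
rewrite (@RIntR_ext (fun x => sin _ * 1) (fun x => sin (freq k * x))); last by move=> x; ring.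
by rewrite RInt_cos_full RInt_sin_full; ring.
Qed.

(** Weierstrass' test for the telescoping series of increments. *)
Lemma unif_of_steps (f : nat -> R -> R) b :
  (forall M x, 0 <= x <= 1 -> Rabs (f M.+1 x - f M x) <= b M) -> ex_series b ->
  exists l, unif_lim f l /\ forall x, 0 <= x <= 1 -> is_lim_seq (fun M => f M x) (l x).
Proof.
move=> hb hs.
have b0 M : 0 <= b M by apply: Rle_trans (Rabs_pos _) (hb M 0 ltac:(lra)).
pose l x := real (Lim_seq (fun M => f M x)).
have hl x : 0 <= x <= 1 -> is_lim_seq (fun M => f M x) (l x).
  move=> hx.
  have [s /lim_rsum hs'] : ex_series (fun M => f M.+1 x - f M x).
    by apply: (@ex_series_le R_AbsRing R_CompleteNormedModule _ b) => // M; exact: hb.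
  have h : is_lim_seq (fun M => f M x) (f 0%N x + s).
    apply: is_lim_seq_ext (is_lim_seq_plus' _ _ _ _ (is_lim_seq_const (f 0%N x)) hs') => M.
    by rewrite (rsum_telescope (fun M => f M x)); ring.
  by rewrite /l (is_lim_seq_unique _ _ h).
exists l; split=> // eps he.
have he2 : 0 < eps / 2 by lra.
have [N hN] := rsum_tail b0 hs he2; exists N => M x hM hx.
have [N' hN'] := (lim_seq_eps _ _).1 (hl x hx) _ he2.
pose M' := (M + N')%N.
have h1 := hN' M' (leq_addl _ _).
have h2 : Rabs (f M' x - f M x) <= rsum b M' - rsum b M.
  rewrite /M' rsum_shift (_ : forall u v, u + v - u = v); last by move=> *; ring.
  have -> : f (M + N')%N x - f M x = rsum (fun k => f (M + k).+1 x - f (M + k)%N x) N'.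
    rewrite (@rsum_ext _ (fun k => f (M + k.+1)%N x - f (M + k)%N x)); last by move=> k _; rewrite addnS.
    by rewrite (rsum_telescope (fun k => f (M + k)%N x)) addn0.
  by apply: Rle_trans (Rabs_rsum _ _) _; apply: rsum_le => k _; exact: hb.
have h3 := hN M M' hM (leq_addr _ _).
have /Rabs_le_between h4 := h2; have h5 := Rabs_def2 _ _ h1.
apply: Rabs_le; lra.
Qed.

(** The factor 2 compensates the mean 1/2 of a squared cosine or sine: once [M] exceeds [m], the
    partial Fourier sum has the coefficients [A m / 2] and [B m / 2], the limits of those of
    [dzeta]. The uniform limit of the difference is then 0 by [trig_unique]. *)
Lemma dzeta_limit n (A B b : nat -> R) x :
  (forall m, A m = 2 * (rot (freq m) (c_base n m) (s_base n m) n).1) ->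
  (forall m, B m = 2 * (rot (freq m) (c_base n m) (s_base n m) n).2) ->
  (forall m, Rabs (A m) + Rabs (B m) <= b m) -> ex_series b -> 0 < x <= 1 ->
  is_lim_seq (fun M => dzeta n.+2 M x - trig_poly A B M x) 0.
Proof.
move=> hA hB hb hs hx.
have [Cst [hC hF]] := @dzeta_step_bound n.+2 (ltn0Sn _).
(* Indices start at 1, as in [dzeta_step_bound], away from the junk values of [psiG] at 0. *)
pose d M x := dzeta n.+2 M.+1 x - trig_poly A B M.+1 x.
have dc M : cont (d M).
  apply: cont_minus; last exact: cont_trig_poly.
  apply: (cont_ext (f := dzeta_deriv n.+2 0 M.+1)); first by move=> y; rewrite dzeta_deriv0.
  by apply: dzeta_deriv_cont.
have cF M : cont (dzeta n.+2 M).
  by apply: (cont_ext (f := dzeta_deriv n.+2 0 M)); [move=> y; rewrite dzeta_deriv0 | exact: dzeta_deriv_cont].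
have [|| l [hu hl]] := @unif_of_steps d (fun M => Cst * Rpower (INR M.+1) (- (3 / 2)) + b M.+1).
- move=> M y hy.
  have -> : d M.+1 y - d M y = (dzeta n.+2 M.+2 y - dzeta n.+2 M.+1 y)
      - (A M.+1 * cos (2 * PI * INR M.+2 * y) + B M.+1 * sin (2 * PI * INR M.+2 * y)).
    rewrite /d /trig_poly -[rsum _ M.+2]/(rsum _ M.+1 + (A M.+1 * cos (2 * PI * INR M.+2 * y) + B M.+1 * sin (2 * PI * INR M.+2 * y))).
    by ring.
  apply: Rle_trans (Rabs_triang _ _) _; rewrite Rabs_Ropp.
  apply: Rplus_le_compat; first exact: hF.
  apply: Rle_trans (Rabs_triang _ _) _; apply: Rle_trans (hb M.+1).
  rewrite !Rabs_mult; apply: Rplus_le_compat; rewrite -[X in _ <= X]Rmult_1_r;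
    apply: Rmult_le_compat_l; try exact: Rabs_pos; apply: Rabs_le.
    by have := COS_bound (2 * PI * INR M.+2 * y); lra.
  by have := SIN_bound (2 * PI * INR M.+2 * y); lra.
- have h1 := ex_series_scal_l Cst _ (@ex_series_Rpower (3 / 2) ltac:(lra)).
  have h2 : ex_series (fun M => b M.+1) by apply/(ex_series_incr_1 b).
  exact: (ex_series_plus _ _ h1 h2).
have hnull : trig_null d.
  case=> [|m].
    split; split; try (exact: cont_cos); try (exact: cont_sin).
      apply: (is_lim_seq_ext (fun _ => 0)); last exact: is_lim_seq_const.
      move=> M; rewrite (@RIntR_ext _ (d M)).
        rewrite (RIntR_minus 0 1 (cF M.+1) (@cont_trig_poly A B M.+1)) trig_poly_mean.
        by rewrite (@RIntR_ext _ (dzeta_deriv n.+2 0 M.+1)) ?dzeta_deriv_mean //; [apply: eq_at_R; ring | move=> y; rewrite dzeta_deriv0].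
      by move=> y; rewrite Rmult_0_r Rmult_0_l cos_0 Rmult_1_r.
    apply: (is_lim_seq_ext (fun _ => 0)); last exact: is_lim_seq_const.
    move=> M; rewrite (@RIntR_ext _ (fun _ => 0)).
      by rewrite RIntR_const Rmult_0_l.
    by move=> y; rewrite Rmult_0_r Rmult_0_l sin_0 Rmult_0_r.
  have [hc hs'] := @coef_lim n m n (leqnn n).
  rewrite subnn in hc hs'.
  split; split; try (exact: cont_cos); try (exact: cont_sin).
    have := is_lim_seq_minus' _ _ _ _ hc (is_lim_seq_const (A m / 2)).
    rewrite (_ : (_ - A m / 2) = 0); last by rewrite hA; field.
    move=> /is_lim_seq_incr_1; apply: is_lim_seq_ext_loc; exists m => M /leP hM.
    rewrite -(@trig_poly_cos A B m M.+1) // /cos_coef.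
    have c1 : cont (fun y => dzeta_deriv n.+2 0 M.+1 y * cos (freq m * y)).
      by apply: cont_mult; [exact: dzeta_deriv_cont | exact: cont_cos].
    have c2 : cont (fun y => trig_poly A B M.+1 y * cos (freq m * y)).
      by prove_cont.
    rewrite -(RIntR_minus 0 1 c1 c2); apply: RIntR_ext => y; rewrite /d dzeta_deriv0; ring.
  have := is_lim_seq_minus' _ _ _ _ hs' (is_lim_seq_const (B m / 2)).
  rewrite (_ : (_ - B m / 2) = 0); last by rewrite hB; field.
  move=> /is_lim_seq_incr_1; apply: is_lim_seq_ext_loc; exists m => M /leP hM.
  rewrite -(@trig_poly_sin A B m M.+1) // /sin_coef.
  have c1 : cont (fun y => dzeta_deriv n.+2 0 M.+1 y * sin (freq m * y)).
    by apply: cont_mult; [exact: dzeta_deriv_cont | exact: cont_sin].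
  have c2 : cont (fun y => trig_poly A B M.+1 y * sin (freq m * y)).
    by prove_cont.
  rewrite -(RIntR_minus 0 1 c1 c2); apply: RIntR_ext => y; rewrite /d dzeta_deriv0; ring.
apply/is_lim_seq_incr_1.
rewrite -(trig_unique dc hnull hu hx); apply: hl; lra.
Qed.

(** * The Fourier expansion *)

(** Dividing a series by [1 - s] at [a], where [1 - a = N], makes the coefficient of index 1 equal
    to [c 1 / N + c 0 / N ^ 2]. This combination of the [Acoef] is the s-derivative of
    [t ^ (1 - s) / (1 - s)], differentiated [j] times in t. The first conjunct feeds the
    induction. *)
Lemma Acoef_psi n t j : 0 < t -> let a := (- RtoC (INR n))%C in let N := INR n.+1 in
  Acoef a t j 0 = RtoC (t ^ n.+1 * / t ^ j * (- N * pa n.+1 j)) /\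
  (RtoC (/ N) * Acoef a t j 1 + RtoC (/ N ^ 2) * Acoef a t j 0)%C = RtoC (psiG n.+1 j t).
Proof.
move=> ht a N; have hN : 0 < N by have := INR_ge1 n; rewrite /N; lra.
have ea : (1 - a = RtoC N)%C by rewrite /a /N S_INR RtoC_plus; ring.
have hC : Cpower t (1 - a) = RtoC (t ^ n.+1) by rewrite ea Cpower_real /N Rpower_pow.
elim: j => [|j [IH1 IH2]].
  have ep : pa n.+1 0 = - / N by [].
  have ed : pd n.+1 0 = / N ^ 2 by [].
  rewrite /psiG ep ed pow_O /Acoef hC -!RtoC_mult -RtoC_plus pow_1 pow_O factS fact0 muln1.
  by rewrite (_ : INR 1 = 1) //; split; congr RtoC; field; lra.
have eaj : (1 - a - RtoC (INR j) = RtoC (N - INR j))%C by rewrite ea RtoC_minus.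
have htj : t ^ j <> 0 by apply: pow_nonzero; lra.
split.
  rewrite AcoefS eaj IH1 paS -/N (_ : forall u, u - 0 = u)%C; last by move=> u; ring.
  rewrite -!RtoC_mult -[t ^ j.+1]/(t * t ^ j); congr RtoC; field; lra.
rewrite !AcoefS eaj.
have -> : (RtoC (/ N) * (RtoC (/ t) * (RtoC (N - INR j) * Acoef a t j 1 - Acoef a t j 0))
   + RtoC (/ N ^ 2) * (RtoC (/ t) * (RtoC (N - INR j) * Acoef a t j 0 - 0)))%C =
  (RtoC (/ t) * (RtoC (N - INR j) * (RtoC (/ N) * Acoef a t j 1 + RtoC (/ N ^ 2) * Acoef a t j 0)
    - RtoC (/ N) * Acoef a t j 0))%C by ring.
rewrite IH2 IH1 -!RtoC_mult -RtoC_minus -RtoC_mult; congr RtoC.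
rewrite /psiG paS pdS -/N -[t ^ j.+1]/(t * t ^ j); field; lra.
Qed.

Lemma EM_partial_lin K x (Psi Phi : nat -> R -> C) a b M :
  (a * EM_partial K x Psi M + b * EM_partial K x Phi M)%C =
  EM_partial K x (fun k t => a * Psi k t + b * Phi k t)%C M.
Proof.
rewrite /EM_partial csum_plus !csum_scal.
rewrite (@csum_ext (fun k => RtoC (beta k x) * (a * Psi k (INR M) + b * Phi k (INR M)))%C
  (fun k => a * (RtoC (beta k x) * Psi k (INR M)) + b * (RtoC (beta k x) * Phi k (INR M)))%C).
  by rewrite csum_plus !csum_scal; ring.
by move=> k _; ring.
Qed.

Lemma zeta1_deriv_neg x n : 0 < x <= 1 ->
  exists v, an_deriv (zeta1 x) (- RtoC (INR n)) v /\ Clim (fun M => RtoC (dzeta n.+1 M x)) v.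
Proof.
move=> hx; set a := (- RtoC (INR n))%C; set N := INR n.+1.
have hN : 0 < N by have := INR_ge1 n; rewrite /N; lra.
have ea : (1 - a = RtoC N)%C by rewrite /a /N S_INR RtoC_plus; ring.
have ha : a <> RtoC 1.
  move=> e; have : RtoC N = 0 by rewrite -ea e; ring.
  by move=> /RtoC_inj; lra.
have [|col [h1 h2]] := @hz_analytic x a n.+2 hx.
  by rewrite /a !S_INR (_ : Re (- RtoC (INR n))%C = - INR n) //; lra.
have [||e [r' [hr' he h3]]] := @Cps_div (hz x) a 1 col (1 / 2) ha; first lra.
  by move=> s hs; apply: h2; lra.
exists (e 1%N); split; first by exists e, r'.
have hl := Clim_plus (Clim_scal (RtoC (/ N)) (h1 1%N)) (Clim_scal (RtoC (/ N ^ 2)) (h1 0%N)).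
rewrite he ea.
have hNC : RtoC N <> RtoC 0 by move=> /RtoC_inj; lra.
have -> : (col 1%N / RtoC N + col 0%N / RtoC N / RtoC N)%C =
   (RtoC (/ N) * col 1%N + RtoC (/ N ^ 2) * col 0%N)%C.
  have -> : / N ^ 2 = / N * / N by field; lra.
  by rewrite RtoC_mult RtoC_inv; [field | lra].
apply: (Clim_ext_loc (N := 1)) hl => M hM.
have hM' : 0 < INR M by apply: lt_0_INR; apply/ltP.
rewrite EM_partial_lin /EM_partial /dzeta RtoC_minus -!csum_RtoC; congr (_ - _)%C; apply: csum_ext => k hk.
  have hk0 : 0 < INR k + x by have := pos_INR k; lra.
  by rewrite (Acoef_psi n 1 hk0).2 psiG_psi.
by rewrite (Acoef_psi n k hM').2 psiG_psi // RtoC_mult.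
Qed.

Definition log_term (N m : nat) : R := ln (INR m.+1) / INR m.+1 ^ N.
Definition pow_term (N m : nat) : R := / INR m.+1 ^ N.

Lemma term_bounds n m : 0 <= log_term n.+2 m <= 2 * Rpower (INR m.+1) (- (3 / 2)) /\
  0 <= pow_term n.+2 m <= Rpower (INR m.+1) (- (3 / 2)).
Proof.
rewrite /log_term /pow_term; set y := INR m.+1; have hy : 1 <= y by exact: INR_ge1.
have hy2 : 0 < / y ^ n.+2 by apply: Rinv_0_lt_compat; apply: pow_lt; lra.
have h2 : / y ^ n.+2 <= Rpower y (- 2).
  rewrite -Rpower_pow ?Rpower_Ropp; last lra.
  apply: Rinv_le_contravar; first exact: exp_pos.
  apply: exp_le; apply: Rmult_le_compat_r; first exact: ln_ge0.
  by rewrite (_ : IPR 2 = 2) // !S_INR; have := pos_INR n; lra.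
have hl0 := ln_ge0 hy.
have hl : ln y <= 2 * Rpower y (1 / 2).
  (* [ln y] is twice the logarithm of its square root, so half a power of [y] pays for the
     logarithm. *)
  have : ln (Rpower y (1 / 2)) <= Rpower y (1 / 2) - 1 by apply: ln_le_sub1; exact: exp_pos.
  by rewrite /Rpower ln_exp; lra.
have hR := exp_pos (- 2 * ln y); rewrite -/(Rpower y (- 2)) in hR.
split; split.
- by apply: Rmult_le_pos; lra.
- apply: (Rle_trans _ (2 * Rpower y (1 / 2) * Rpower y (- 2))).
    by apply: Rmult_le_compat; lra.
  by rewrite Rmult_assoc -Rpower_plus; apply: Req_le; congr (2 * Rpower y _); field.
- lra.
- apply: Rle_trans h2 _; apply: exp_le; apply: Rmult_le_compat_r => //; lra.
Qed.

Lemma ex_series_terms n (c d : nat -> R) : (forall m, Rabs (c m) <= 1) ->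
  (forall m, d m = log_term n.+2 m * c m \/ d m = pow_term n.+2 m * c m) -> ex_series d.
Proof.
move=> hc hd.
apply: (@ex_series_le R_AbsRing R_CompleteNormedModule _ (fun m => 2 * Rpower (INR m.+1) (- (3 / 2)))); last first.
  by apply: ex_series_scal_l; apply: ex_series_Rpower; lra.
move=> m; have [h1 h2] := term_bounds n m; have hR := exp_pos (- (3 / 2) * ln (INR m.+1)).
rewrite -/(Rpower (INR m.+1) (- (3 / 2))) in hR.
have hcm := hc m; have hc0 := Rabs_pos (c m).
suff : Rabs (d m) <= 2 * Rpower (INR m.+1) (- (3 / 2)) by [].
case: (hd m) => ->; rewrite Rabs_mult Rabs_pos_eq; try lra.
  have : log_term n.+2 m * Rabs (c m) <= log_term n.+2 m * 1 by apply: Rmult_le_compat_l; lra.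
  lra.
have : pow_term n.+2 m * Rabs (c m) <= pow_term n.+2 m * 1 by apply: Rmult_le_compat_l; lra.
lra.
Qed.

Lemma cos_abs1 y : Rabs (cos y) <= 1.
Proof. by apply: Rabs_le; have := COS_bound y; lra. Qed.
Lemma sin_abs1 y : Rabs (sin y) <= 1.
Proof. by apply: Rabs_le; have := SIN_bound y; lra. Qed.

Lemma series_split n (K L K' : R) (c s : nat -> R) :
  (forall m, Rabs (c m) <= 1) -> (forall m, Rabs (s m) <= 1) ->
  is_lim_seq (rsum (fun m => K * (log_term n.+2 m + L * pow_term n.+2 m) * c m + K * K' * pow_term n.+2 m * s m))
   (K * (Series (fun m => ln (INR m.+1) * c m / INR m.+1 ^ n.+2)
     + L * Series (fun m => c m / INR m.+1 ^ n.+2) + K' * Series (fun m => s m / INR m.+1 ^ n.+2))).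
Proof.
move=> hc hs.
have e1 : ex_series (fun m => ln (INR m.+1) * c m / INR m.+1 ^ n.+2).
  by apply: (ex_series_terms (n := n) hc) => m; left; rewrite /log_term /Rdiv; ring.
have e2 : ex_series (fun m => c m / INR m.+1 ^ n.+2).
  by apply: (ex_series_terms (n := n) hc) => m; right; rewrite /pow_term /Rdiv; ring.
have e3 : ex_series (fun m => s m / INR m.+1 ^ n.+2).
  by apply: (ex_series_terms (n := n) hs) => m; right; rewrite /pow_term /Rdiv; ring.
have /lim_rsum l1 := Series_correct _ e1.
have /lim_rsum l2 := Series_correct _ e2.
have /lim_rsum l3 := Series_correct _ e3.
have h := is_lim_seq_scal_l _ K _ (is_lim_seq_plus' _ _ _ _ (is_lim_seq_plus' _ _ _ _ l1
  (is_lim_seq_scal_l _ L _ l2)) (is_lim_seq_scal_l _ K' _ l3)).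
apply: is_lim_seq_ext h => M.
rewrite -!rsum_scal -!rsum_plus -rsum_scal; apply: rsum_ext => m _.
by rewrite /log_term /pow_term /Rdiv; ring.
Qed.

Lemma coef_bound n (K L K' : R) m :
  Rabs (K * (log_term n.+2 m + L * pow_term n.+2 m)) + Rabs (K * K' * pow_term n.+2 m) <=
  Rabs K * (2 + Rabs L + Rabs K') * Rpower (INR m.+1) (- (3 / 2)).
Proof.
have [h1 h2] := term_bounds n m.
set q := Rpower _ _ in h1 h2 *.
have a1 : Rabs (log_term n.+2 m + L * pow_term n.+2 m) <= 2 * q + Rabs L * q.
  apply: Rle_trans (Rabs_triang _ _) _; rewrite Rabs_mult (Rabs_pos_eq (log_term _ _)) ?(Rabs_pos_eq (pow_term _ _)); try lra.
  by apply: Rplus_le_compat; [lra | apply: Rmult_le_compat_l; [exact: Rabs_pos | lra]].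
have a2 : Rabs (K' * pow_term n.+2 m) <= Rabs K' * q.
  by rewrite Rabs_mult (Rabs_pos_eq (pow_term _ _)); [apply: Rmult_le_compat_l; [exact: Rabs_pos | lra] | lra].
rewrite Rmult_assoc (Rabs_mult K) (Rabs_mult K (K' * _)) -Rmult_plus_distr_l Rmult_assoc.
apply: Rmult_le_compat_l; first exact: Rabs_pos.
lra.
Qed.

Lemma L_sum_lim x n (S : R) : 0 < x <= 1 -> is_lim_seq (fun M => dzeta n.+2 M x) S ->
  L_sum n.+2 x = RtoC S.
Proof.
move=> hx hS.
have [v hv] := choice _ (fun j => @zeta1_deriv_neg x j hx).
rewrite (@L_sum_an_deriv x n.+2 v hx (ltn0Sn _) (fun j => (hv j).1)).
exact: Clim_unique (hv n.+1).2 (Clim_RtoC hS).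
Qed.

Lemma L_sum_trig_poly x n (A B b : nat -> R) (S : R) :
  (forall m, A m = 2 * (rot (freq m) (c_base n m) (s_base n m) n).1) ->
  (forall m, B m = 2 * (rot (freq m) (c_base n m) (s_base n m) n).2) ->
  (forall m, Rabs (A m) + Rabs (B m) <= b m) -> ex_series b -> 0 < x <= 1 ->
  is_lim_seq (trig_poly A B ^~ x) S -> L_sum n.+2 x = RtoC S.
Proof.
move=> hA hB hb hs hx hG; apply: L_sum_lim => //.
have := is_lim_seq_plus' _ _ _ _ (dzeta_limit hA hB hb hs hx) hG.
by rewrite Rplus_0_l; apply: is_lim_seq_ext => M; ring.
Qed.

Theorem theorem3p4 (x : R) (N : nat) (hx0 : 0 < x) (hx1 : x <= 1)
    (hN : (2 <= N)%N) :
  (~~ odd N ->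
    L_sum N x = RtoC
      (2 * (-1) ^ (N./2) * INR (N.-1)`! / (2 * PI) ^ N *
       (Series (fun n : nat =>
          ln (INR n.+1) * cos (2 * PI * INR n.+1 * x) / INR n.+1 ^ N)
        + (ln (2 * PI) + euler_gamma - harmonic N.-1) *
          Series (fun n : nat => cos (2 * PI * INR n.+1 * x) / INR n.+1 ^ N)
        - PI / 2 *
          Series (fun n : nat => sin (2 * PI * INR n.+1 * x) / INR n.+1 ^ N))))
  /\
  (odd N ->
    L_sum N x = RtoC
      (2 * (-1) ^ ((N.-1)./2) * INR (N.-1)`! / (2 * PI) ^ N *
       (Series (fun n : nat =>
          ln (INR n.+1) * sin (2 * PI * INR n.+1 * x) / INR n.+1 ^ N)
        + (ln (2 * PI) + euler_gamma - harmonic N.-1) *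
          Series (fun n : nat => sin (2 * PI * INR n.+1 * x) / INR n.+1 ^ N)
        + PI / 2 *
          Series (fun n : nat => cos (2 * PI * INR n.+1 * x) / INR n.+1 ^ N)))).
Proof.
case: N hN => // -[//|n] _; rewrite -[n.+2.-1]/(n.+1).
have hx : 0 < x <= 1 by lra.
have hpi := PI_RGT_0.
set L := ln (2 * PI) + euler_gamma - harmonic n.+1.
(* This splitting separates the series with [log n] from the constant [ln (2 * PI)] collected in
   [L]. *)
have lw m : ln (freq m) = ln (2 * PI) + ln (INR m.+1).
  by rewrite ln_mult; [ | lra | have := INR_ge1 m; lra].
have hbs (K K' : R) : ex_series (fun m => Rabs K * (2 + Rabs L + Rabs K') * Rpower (INR m.+1) (- (3 / 2))).
  by apply: ex_series_scal_l; apply: ex_series_Rpower; lra.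
have pw m k : (freq m) ^ k = (2 * PI) ^ k * INR m.+1 ^ k by rewrite Rpow_mult_distr.
have ym m : INR m.+1 <> 0 by have := INR_ge1 m; lra.
have pi2 : 2 * PI <> 0 by lra.
split=> hodd.
  have [p hp] : exists p, n = (2 * p)%N.
    by exists n./2; rewrite mul2n even_halfK //; move: hodd; rewrite /= negbK.
  have hh : (n.+2)./2 = p.+1 by rewrite hp; lia.
  rewrite hh; set K := 2 * (-1) ^ p.+1 * INR (n.+1)`! / (2 * PI) ^ n.+2.
  have rw m : rot (freq m) (c_base n m) (s_base n m) n =
     ((-1) ^ p * c_base n m / (freq m) ^ n, (-1) ^ p * s_base n m / (freq m) ^ n).
    by move: (c_base n m) (s_base n m) => c s; rewrite hp rot_even //; exact: w_neq0.
  (* An even number [n] of integrations leaves [c_base] with the cosines and [s_base] with the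
     sines; the sign of [c_base] raises the exponent of -1 from [p] to [p.+1]. *)
  apply: (@L_sum_trig_poly x n (fun m => K * (log_term n.+2 m + L * pow_term n.+2 m)) (fun m => K * (- (PI / 2)) * pow_term n.+2 m) _ _ _ _ _ (hbs K (- (PI / 2))) hx).
  - move=> m; rewrite rw /fst /snd /c_base lw /K /L /log_term /pow_term !pw.
    have h1 := pow_nonzero _ n (ym m); have h2 := pow_nonzero _ n pi2.
    rewrite -[(2 * PI) ^ n.+2]/(2 * PI * (2 * PI * (2 * PI) ^ n)) -[INR m.+1 ^ n.+2]/(INR m.+1 * (INR m.+1 * INR m.+1 ^ n)).
    rewrite -[(-1) ^ p.+1]/(-1 * (-1) ^ p); field; repeat split => //; lra.
  - move=> m; rewrite rw /fst /snd /s_base /K /pow_term !pw.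
    have h1 := pow_nonzero _ n (ym m); have h2 := pow_nonzero _ n pi2.
    rewrite -[(2 * PI) ^ n.+2]/(2 * PI * (2 * PI * (2 * PI) ^ n)) -[INR m.+1 ^ n.+2]/(INR m.+1 * (INR m.+1 * INR m.+1 ^ n)).
    rewrite -[(-1) ^ p.+1]/(-1 * (-1) ^ p); field; repeat split => //; lra.
  - by move=> m; exact: coef_bound.
  have := @series_split n K L (- (PI / 2)) (fun m => cos (freq m * x))
     (fun m => sin (freq m * x)) (fun m => cos_abs1 _) (fun m => sin_abs1 _).
  by rewrite [X in _ + X]Ropp_mult_distr_l_reverse.
have [p hp] : exists p, n = (2 * p).+1.
  by exists n./2; move: hodd; rewrite /= negbK => h; rewrite -{1}(odd_double_half n) h mul2n.
have hh : (n.+1)./2 = p.+1 by rewrite hp; lia.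
rewrite hh; set K := 2 * (-1) ^ p.+1 * INR (n.+1)`! / (2 * PI) ^ n.+2.
have rw m : rot (freq m) (c_base n m) (s_base n m) n =
   (- ((-1) ^ p * s_base n m / (freq m) ^ (2 * p)) / (freq m),
    ((-1) ^ p * c_base n m / (freq m) ^ (2 * p)) / (freq m)).
  move: (c_base n m) (s_base n m) => c s.
  rewrite hp -[rot _ _ _ _.+1]/(- (rot (freq m) c s (2 * p)).2 / (freq m),
    (rot (freq m) c s (2 * p)).1 / (freq m)).
  by rewrite rot_even //; exact: w_neq0.
(* An odd number of integrations interchanges the roles: the cosines carry [s_base] with an
   additional minus sign, the sines carry [c_base]. *)
apply: (@L_sum_trig_poly x n (fun m => K * (PI / 2) * pow_term n.+2 m) (fun m => K * (log_term n.+2 m + L * pow_term n.+2 m)) _ _ _ _ _ (hbs K (PI / 2)) hx).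
- move=> m; rewrite rw /fst /snd /s_base /K /pow_term !pw.
  have h1 := pow_nonzero _ (2 * p) (ym m); have h2 := pow_nonzero _ (2 * p) pi2.
  have -> : (2 * PI) ^ n.+2 = 2 * PI * (2 * PI * (2 * PI * (2 * PI) ^ (2 * p))) by rewrite hp.
  have -> : INR m.+1 ^ n.+2 = INR m.+1 * (INR m.+1 * (INR m.+1 * INR m.+1 ^ (2 * p))) by rewrite hp.
  rewrite -[(-1) ^ p.+1]/(-1 * (-1) ^ p); field; repeat split => //; lra.
- move=> m; rewrite rw /fst /snd /c_base lw /K /L /log_term /pow_term !pw.
  have h1 := pow_nonzero _ (2 * p) (ym m); have h2 := pow_nonzero _ (2 * p) pi2.
  have -> : (2 * PI) ^ n.+2 = 2 * PI * (2 * PI * (2 * PI * (2 * PI) ^ (2 * p))) by rewrite hp.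
  have -> : INR m.+1 ^ n.+2 = INR m.+1 * (INR m.+1 * (INR m.+1 * INR m.+1 ^ (2 * p))) by rewrite hp.
  rewrite -[(-1) ^ p.+1]/(-1 * (-1) ^ p); field; repeat split => //; lra.
- by move=> m; rewrite Rplus_comm; exact: coef_bound.
have := @series_split n K L (PI / 2) (fun m => sin (freq m * x))
     (fun m => cos (freq m * x)) (fun m => sin_abs1 _) (fun m => cos_abs1 _).
by apply: is_lim_seq_ext => M; apply: rsum_ext => m _; rewrite Rplus_comm.
Qed.
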